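(* Let $(M,h,\nabla)$ and $(M',h',\nabla')$ be connected dually flat spaces of dimensions $n$ and $d$, with torifications $\Phi:\mathbb{T}^n\times N\to N$ and $\Phi':\mathbb{T}^d\times N'\to N'$, respectively. Let the smooth map $m:N\to N'$ be a lift of the smooth map $f:M\to M'$. (1) The map $m$ is a Kähler immersion (i.e. a holomorphic isometric immersion) if and only if $f$ is an isometric affine immersion. (2) If $f$ is an isometric affine immersion, then there exists a unique Lie group homomorphism $\rho:\mathbb{T}^n\to\mathbb{T}^d$ with finite kernel such that $m\circ\Phi_a=\Phi'_{\rho(a)}\circ m$ for all $a\in\mathbb{T}^n$.
   Context: Dually flat spaces. A linear connection is flat if its torsion and curvature both vanish. If $(M,h)$ is a Riemannian manifold with a linear connection $\nabla$, the dual connection $\nabla^*$ is the unique linear connection with $Xh(Y,Z)=h(\nabla_XY,Z)+h(Y,\nabla^*_XZ)$ for all vector fields $X,Y,Z$. The triple $(M,h,\nabla)$ is a dually flat space if $\nabla$ and $\nabla^*$ are both flat. A coordinate system $(x_1,\dots,x_n)$ is $\nabla$-affine if $\nabla_{\partial/\partial x_i}\partial/\partial x_j=0$ for all $i,j$. A smooth map $f:M\to M'$ between dually flat spaces is affine if around every point of $M$ (and its image) there are $\nabla$-affine and $\nabla'$-affine coordinate systems in which $f$ is the restriction of an affine map $y\mapsto Ay+B$; it is isometric if $f^*h'=h$. Kähler structure on $TM$ (Dombrowski). Let $(M,h,\nabla)$ be dually flat, $\pi:TM\to M$ the projection, and $K:TTM\to TM$ the connector of $\nabla$ (the map, linear on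 each $T_u(TM)$, with $K(Y_*X)=\nabla_XY$ for all vector fields). For $u\in T_pM$ the map $A\mapsto(\pi_*A,KA)$ identifies $T_u(TM)$ with $T_pM\oplus T_pM$; under it set $g_u((v,w),(v',w'))=h_p(v,v')+h_p(w,w')$, $J_u(v,w)=(-w,v)$, $\omega_u((v,w),(v',w'))=h_p(v,w')-h_p(w,v')$. This makes $TM$ a Kähler manifold, and $TM$ always carries this structure. Parallel lattices. Let $(M,h,\nabla)$ be connected, $\dim M=n$. A parallel lattice is a subset $L\subset TM$ of the form $L=\{\sum_i k_iX_i(p)\mid p\in M,\ k_i\in\mathbb{Z}\}$ where $X=(X_1,\dots,X_n)$ are $\nabla$-parallel vector fields forming a basis of $T_pM$ at every $p$; $X$ is called a generator of $L$. $\Gamma(L)$ is the group of maps $TM\to TM$, $u\mapsto u+\sum_ik_iX_i$ ($k\in\mathbb{Z}^n$); it does not depend on the generator, acts freely and properly by holomorphic isometries, and $M_L=TM/\Gamma(L)$ carries the quotient Kähler structure, with quotient map $q_L:TM\to M_L$. Put $\mathbb{T}^n=\mathbb{R}^n/\mathbb{Z}^n$; for a generator $X$ let $\Phi_X([t],q_L(u))=q_L(u+\sum_it_iX_i)$, an action of $\mathbb{T}^n$ on $M_L$. Torifications and lifts. Let $N$ be a connected Kähler manifold of real dimension $2n$ with an effective holomorphic isometric action $\Phi:\mathbb{T}^n\times N\to N$; write $\Phi_a=\Phi(a,\cdot)$ and let $N^\circ$ be the set of points where $\Phi$ is free. $N$ (or $\Phi$) is a torification of the connected $n$-dimensional dually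 flat space $(M,h,\nabla)$ if there is a toric parametrization, i.e. a triple $(L,X,F)$ where $L$ is a parallel lattice generated by $X$ and $F:M_L\to N^\circ$ is a holomorphic isometric diffeomorphism with $F\circ(\Phi_X)_a=\Phi_a\circ F$ for all $a\in\mathbb{T}^n$. A compatible covering map is a map $\tau:TM\to N^\circ$ of the form $\tau=F\circ q_L$ for some toric parametrization $(L,X,F)$. A smooth map $m:N\to N'$ is a lift of a smooth map $f:M\to M'$ if there are compatible covering maps $\tau:TM\to N^\circ$ and $\tau':TM'\to(N')^\circ$ such that $m\circ\tau=\tau'\circ f_*$, where $f_*:TM\to TM'$ is the derivative. *)

(* Defs.v *)
From HB Require Import structures.
From mathcomp Require Import all_boot all_order all_algebra.
From mathcomp Require Import boolp classical_sets functions cardinality reals.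
From mathcomp Require Import topology normedtype derive.

Set Implicit Arguments.
Unset Strict Implicit.
Unset Printing Implicit Defensive.

Import Order.TTheory GRing.Theory Num.Theory numFieldNormedType.Exports.

Local Open Scope classical_set_scope.
Local Open Scope ring_scope.

Definition choose_or (T : Type) (x0 : T) (P : set T) : T :=
  if pselect (exists x, P x) is left h then projT1 (cid h) else x0.

Section Geometry.
Variable R : realType.

(** * Smooth manifolds *)

(* Meaningful for U open only. *)
Fixpoint Ck_on (n : nat) (V : normedModType R) (k : nat)
    (U : set 'rV[R]_n) (f : 'rV[R]_n -> V) : Prop :=
  match k with
  | 0%N => forall x, U x -> {for x, continuous f}
  | k'.+1 => (forall x, U x -> differentiable f x) /\
             (forall v, Ck_on k' U (fun x => 'd f x v))
  end.

Definition smooth_on n (V : normedModType R) (U : set 'rV[R]_n)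
    (f : 'rV[R]_n -> V) := forall k, Ck_on k U f.

(* [cinv] is only relevant on the image of [cdom] under [cmap]. *)
Record chart (T : Type) (n : nat) := Chart {
  cdom : set T;
  cmap :> T -> 'rV[R]_n;
  cinv : 'rV[R]_n -> T }.

(* Raw data of a manifold of dimension n: its points and an atlas (not
   necessarily maximal). The conditions on the data are in [is_manifold]; the
   topology is the one determined by the atlas, see [mopen]. *)
Record mspace (n : nat) := MSpace {
  mpt :> Type;
  atlas : set (chart mpt n) }.

Arguments atlas {n} m.

Definition crange T n (c : chart T n) : set 'rV[R]_n := c @` cdom c.

Definition valid_chart T n (c : chart T n) :=
  (forall p, cdom c p -> cinv c (c p) = p) /\ open (crange c).

Definition compatible T n (c c' : chart T n) :=
  let U := c @` (cdom c `&` cdom c') in open U /\ smooth_on U (c' \o cinv c).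

Definition mopen n (M : mspace n) (U : set M) :=
  forall c, atlas M c -> open (c @` (U `&` cdom c)).

Definition hausdorff_mspace n (M : mspace n) := forall p q : M, p <> q ->
  exists U V : set M,
    [/\ mopen U, mopen V, U p, V q & U `&` V = set0].

Definition second_countable_mspace n (M : mspace n) :=
  exists B : nat -> set M, (forall i, mopen (B i)) /\
    forall (U : set M) p, mopen U -> U p -> exists i, B i p /\ B i `<=` U.

Definition is_manifold n (M : mspace n) :=
  [/\ forall c, atlas M c -> valid_chart c,
      forall p : M, exists2 c, atlas M c & cdom c p,
      forall c c', atlas M c -> atlas M c' -> compatible c c',
      hausdorff_mspace M & second_countable_mspace M].

Definition connected_mspace n (M : mspace n) :=
  (exists p : M, True) /\
  forall U : set M, mopen U -> mopen (~` U) -> U = set0 \/ U = setT.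

(* An arbitrary coordinate system, i.e. a chart of the maximal atlas. *)
Definition coord_system n (M : mspace n) (c : chart M n) :=
  valid_chart c /\
  forall a, atlas M a -> compatible a c /\ compatible c a.

Definition smooth_map_on n d (M : mspace n) (M' : mspace d) (U : set M)
    (f : M -> M') :=
  forall c c', atlas M c -> atlas M' c' ->
    let W := c @` (U `&` cdom c `&` f @^-1` cdom c') in
    open W /\ smooth_on W (c' \o f \o cinv c).

Definition smooth_map n d (M : mspace n) (M' : mspace d) (f : M -> M') :=
  smooth_map_on setT f.

Definition smooth_fun_on n (M : mspace n) (U : set M) (f : M -> R) :=
  forall c, atlas M c -> smooth_on (c @` (U `&` cdom c)) (f \o cinv c).

(** ** Model, product and quotient manifolds *)

Definition rvspace (n : nat) : mspace n :=
  @MSpace n 'rV[R]_n [set Chart setT id id].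

Definition prod_chart T T' n d (c : chart T n) (c' : chart T' d) :
    chart (T * T') (n + d) :=
  Chart [set x | cdom c x.1 /\ cdom c' x.2]
        (fun x => row_mx (c x.1) (c' x.2))
        (fun y => (cinv c (lsubmx y), cinv c' (rsubmx y))).

Definition prod_mspace n d (M : mspace n) (M' : mspace d) : mspace (n + d) :=
  @MSpace (n + d) (M * M')
    [set e | exists c c', [/\ atlas M c, atlas M' c' & e = prod_chart c c']].

(* The structure on Q for which the surjection q : M -> Q is a local
   diffeomorphism: its charts are the charts of M restricted to open sets on
   which q is injective. Used for quotients by free and proper actions of
   discrete groups. *)
Definition quotient_mspace n (M : mspace n) (Q : Type) (q : M -> Q) :
    mspace n :=
  @MSpace n Q [set c | exists (a : chart M n) (U : set M),
    [/\ atlas M a, mopen U, U `<=` cdom a,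
        (forall u v, U u -> U v -> q u = q v -> u = v) &
        cdom c = q @` U /\
        forall u, U u -> c (q u) = a u /\ cinv c (a u) = q u]].

(** ** Tangent vectors *)

(* A preferred chart at p. *)
Definition chart_at n (M : mspace n) (p : M) : chart M n :=
  choose_or (Chart set0 (fun=> 0) (fun=> p))
    [set c | atlas M c /\ cdom c p].

(* The tangent space at p is 'rV[R]_n: a tangent vector is represented by its
   components in [chart_at p]. *)

Definition tangent_chart n (M : mspace n) (c : chart M n) :
    chart (M * 'rV[R]_n) (n + n) :=
  Chart [set u | cdom c u.1]
        (fun u => row_mx (c u.1)
           ('d (c \o cinv (chart_at u.1)) (chart_at u.1 u.1) u.2))
        (fun y => let p := cinv c (lsubmx y) in
           (p, 'd (chart_at p \o cinv c) (lsubmx y) (rsubmx y))).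

Definition TM n (M : mspace n) : mspace (n + n) :=
  @MSpace (n + n) (M * 'rV[R]_n) [set tangent_chart c | c in atlas M].

Definition tproj n (M : mspace n) (u : TM M) : M := u.1.

(* derivative of f at p *)
Definition dmap n d (M : mspace n) (M' : mspace d) (f : M -> M') (p : M)
    (v : 'rV[R]_n) : 'rV[R]_d :=
  'd (chart_at (f p) \o f \o cinv (chart_at p)) (chart_at p p) v.

Definition tmap n d (M : mspace n) (M' : mspace d) (f : M -> M')
    (u : TM M) : TM M' := (f u.1, dmap f u.1 u.2).

Definition dfun n (M : mspace n) (f : M -> R) (p : M) (v : 'rV[R]_n) : R :=
  'd (f \o cinv (chart_at p)) (chart_at p p) v.

(* components of v in T_p M with respect to the chart c *)
Definition dchart n (M : mspace n) (c : chart M n) (p : M) (v : 'rV[R]_n) :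
    'rV[R]_n :=
  'd (c \o cinv (chart_at p)) (chart_at p p) v.

(* the vector in T_p M with components v with respect to the chart c *)
Definition coord_vec n (M : mspace n) (c : chart M n) (v : 'rV[R]_n) (p : M) :
    'rV[R]_n :=
  'd (chart_at p \o cinv c) (c p) v.

Definition coord_field n (M : mspace n) (c : chart M n) (i : 'I_n) :
    M -> 'rV[R]_n := coord_vec c (delta_mx 0 i).

Definition immersion n d (M : mspace n) (M' : mspace d) (f : M -> M') :=
  smooth_map f /\ forall p, injective (dmap f p).

(** ** Vector fields *)

(* components of the vector field X in the chart c, as functions of the
   coordinates *)
Definition field_rep n (M : mspace n) (c : chart M n) (X : M -> 'rV[R]_n)
    (y : 'rV[R]_n) : 'rV[R]_n := dchart c (cinv c y) (X (cinv c y)).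

Definition smooth_field_on n (M : mspace n) (U : set M) (X : M -> 'rV[R]_n) :=
  forall c, atlas M c -> smooth_on (c @` (U `&` cdom c)) (field_rep c X).

Definition lie_bracket n (M : mspace n) (X Y : M -> 'rV[R]_n) (p : M) :
    'rV[R]_n :=
  let c := chart_at p in
  'd (field_rep c Y) (c p) (X p) - 'd (field_rep c X) (c p) (Y p).

(** * Riemannian metrics and linear connections *)

Definition is_riemannian n (M : mspace n)
    (h : M -> 'rV[R]_n -> 'rV[R]_n -> R) :=
  [/\ forall p a u v w, h p (a *: u + v) w = a * h p u w + h p v w,
      forall p v w, h p v w = h p w v,
      forall p v, v != 0 -> 0 < h p v v &
      forall c v w, atlas M c -> smooth_on (crange c) (fun y =>
        let p := cinv c y in h p (coord_vec c v p) (coord_vec c w p))].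

(* A linear connection D is given by the vectors D p v Y, the covariant
   derivative at p of the vector field Y in the direction v in T_p M, for Y
   defined and smooth on a neighbourhood of p (the value is irrelevant for
   other Y). Thus (nabla_X Y)(p) = D p (X p) Y, as follows. *)
Definition connection n (M : mspace n) :=
  forall p : M, 'rV[R]_n -> (M -> 'rV[R]_n) -> 'rV[R]_n.

Definition cov n (M : mspace n) (D : connection M) (X Y : M -> 'rV[R]_n) :
    M -> 'rV[R]_n := fun p => D p (X p) Y.

(* Locality in Y follows from the Leibniz rule, applied to the indicator
   function of an open neighbourhood of p. *)
Definition is_connection n (M : mspace n) (D : connection M) :=
  forall U : set M, mopen U ->
  [/\ forall p a v w Y, U p -> smooth_field_on U Y ->
        D p (a *: v + w) Y = a *: D p v Y + D p w Y,
      forall p v Y Z, U p -> smooth_field_on U Y -> smooth_field_on U Z ->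
        D p v (fun q => Y q + Z q) = D p v Y + D p v Z,
      forall p v (f : M -> R) Y, U p ->
        smooth_fun_on U f -> smooth_field_on U Y ->
        D p v (fun q => f q *: Y q) = dfun f p v *: Y p + f p *: D p v Y &
      forall X Y, smooth_field_on U X -> smooth_field_on U Y ->
        smooth_field_on U (cov D X Y)].

Definition torsion_free n (M : mspace n) (D : connection M) :=
  forall (U : set M) X Y p, mopen U -> U p ->
    smooth_field_on U X -> smooth_field_on U Y ->
    cov D X Y p - cov D Y X p - lie_bracket X Y p = 0.

Definition curvature_free n (M : mspace n) (D : connection M) :=
  forall (U : set M) X Y Z p, mopen U -> U p ->
    smooth_field_on U X -> smooth_field_on U Y -> smooth_field_on U Z ->
    cov D X (cov D Y Z) p - cov D Y (cov D X Z) p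
      - cov D (lie_bracket X Y) Z p = 0.

Definition flat_connection n (M : mspace n) (D : connection M) :=
  torsion_free D /\ curvature_free D.

Definition dual_connection n (M : mspace n)
    (h : M -> 'rV[R]_n -> 'rV[R]_n -> R) (D D' : connection M) :=
  is_connection D' /\
  forall (U : set M) X Y Z p, mopen U -> U p ->
    smooth_field_on U X -> smooth_field_on U Y -> smooth_field_on U Z ->
    dfun (fun q => h q (Y q) (Z q)) p (X p)
      = h p (cov D X Y p) (Z p) + h p (Y p) (cov D' X Z p).

(** * Dually flat spaces *)

(* Raw data (M, h, nabla). *)
Record dfspace (n : nat) := DFSpace {
  df_mspace :> mspace n;
  df_metric : df_mspace -> 'rV[R]_n -> 'rV[R]_n -> R;
  df_conn : connection df_mspace }.

Arguments df_metric {n} d.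
Arguments df_conn {n} d.

Definition dually_flat n (M : dfspace n) :=
  [/\ is_manifold M, is_riemannian (df_metric M),
      is_connection (df_conn M), flat_connection (df_conn M) &
      exists2 D', dual_connection (df_metric M) (df_conn M) D' &
                  flat_connection D'].

Definition affine_coords n (M : dfspace n) (c : chart M n) :=
  coord_system c /\
  forall p i j, cdom c p ->
    cov (df_conn M) (coord_field c i) (coord_field c j) p = 0.

Definition affine_map n d (M : dfspace n) (M' : dfspace d) (f : M -> M') :=
  smooth_map f /\
  forall p, exists (c : chart M n) (c' : chart M' d)
      (A : 'M[R]_(n, d)) (B : 'rV[R]_d),
    [/\ affine_coords c, affine_coords c', cdom c p, cdom c' (f p) &
        forall q, cdom c q -> cdom c' (f q) /\ c' (f q) = c q *m A + B].

Definition isometric n d (M : mspace n) (M' : mspace d)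
    (g : M -> 'rV[R]_n -> 'rV[R]_n -> R) (g' : M' -> 'rV[R]_d -> 'rV[R]_d -> R)
    (f : M -> M') :=
  forall p v w, g' (f p) (dmap f p v) (dmap f p w) = g p v w.

Definition isometric_affine_immersion n d (M : dfspace n) (M' : dfspace d)
    (f : M -> M') :=
  [/\ immersion f, isometric (df_metric M) (df_metric M') f &
      affine_map f].

(** * Kaehler manifolds *)

(* Raw data of a Kaehler manifold of real dimension 2n: metric and complex
   structure tensor. *)
Record kspace (n : nat) := KSpace {
  k_mspace :> mspace (n + n);
  k_metric : k_mspace -> 'rV[R]_(n + n) -> 'rV[R]_(n + n) -> R;
  k_J : k_mspace -> 'rV[R]_(n + n) -> 'rV[R]_(n + n) }.

Arguments k_metric {n} k.
Arguments k_J {n} k.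

(* multiplication by i on C^n, where (x, y) stands for x + i y *)
Definition Jstd n (y : 'rV[R]_(n + n)) : 'rV[R]_(n + n) :=
  row_mx (- rsubmx y) (lsubmx y).

Definition complex_structure n (M : mspace (n + n))
    (J : M -> 'rV[R]_(n + n) -> 'rV[R]_(n + n)) :=
  forall p : M, exists c : chart M (n + n), [/\ coord_system c, cdom c p &
    forall q v, cdom c q -> dchart c q (J q v) = Jstd (dchart c q v)].

Definition k_form n (N : kspace n) (p : N) (v w : 'rV[R]_(n + n)) : R :=
  k_metric N p (k_J N p v) w.

(* The exterior derivative evaluated on coordinate vector fields, which
   commute. *)
Definition closed_form n (M : mspace n)
    (w : M -> 'rV[R]_n -> 'rV[R]_n -> R) :=
  forall c v1 v2 v3 y, atlas M c -> crange c y ->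
    let W a b := fun z : 'rV[R]_n =>
      let p := cinv c z in w p (coord_vec c a p) (coord_vec c b p) in
    'd (W v2 v3) y v1 + 'd (W v3 v1) y v2 + 'd (W v1 v2) y v3 = 0.

Definition is_kahler n (N : kspace n) :=
  [/\ is_manifold N, is_riemannian (k_metric N),
      complex_structure (k_J N),
      forall p v w, k_metric N p (k_J N p v) (k_J N p w) = k_metric N p v w &
      closed_form (@k_form n N)].

Definition holomorphic n d (N : kspace n) (N' : kspace d) (f : N -> N') :=
  smooth_map f /\
  forall p v, dmap f p (k_J N p v) = k_J N' (f p) (dmap f p v).

Definition kahler_immersion n d (N : kspace n) (N' : kspace d)
    (f : N -> N') :=
  [/\ immersion f, holomorphic f &
      isometric (k_metric N) (k_metric N') f].

(** ** Dombrowski's construction *)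

(* K is the connector of D, seen as a family of maps T_u(TM) -> T_(pi u) M;
   the second condition is K (Y_* v) = nabla_v Y. *)
Definition is_connector n (M : mspace n) (D : connection M)
    (K : TM M -> 'rV[R]_(n + n) -> 'rV[R]_n) :=
  (forall u a A B, K u (a *: A + B) = a *: K u A + K u B) /\
  forall (U : set M) Y p v, mopen U -> U p -> smooth_field_on U Y ->
    K (p, Y p) (@dmap _ _ M (TM M) (fun q => (q, Y q)) p v) = D p v Y.

Definition connector n (M : mspace n) (D : connection M) :
    TM M -> 'rV[R]_(n + n) -> 'rV[R]_n :=
  choose_or (fun _ _ => 0) (is_connector D).

Section Dombrowski.
Variables (n : nat) (M : dfspace n).

Definition hor (u : TM M) (A : 'rV[R]_(n + n)) : 'rV[R]_n :=
  dmap (@tproj n M) u A.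

Definition ver (u : TM M) (A : 'rV[R]_(n + n)) : 'rV[R]_n :=
  connector (df_conn M) u A.

Definition TM_metric (u : TM M) (A B : 'rV[R]_(n + n)) : R :=
  df_metric M u.1 (hor u A) (hor u B) + df_metric M u.1 (ver u A) (ver u B).

(* J (v, w) = (- w, v); the associated form g (J A, B) is h(v, w') - h(w, v'). *)
Definition TM_J (u : TM M) (A : 'rV[R]_(n + n)) : 'rV[R]_(n + n) :=
  choose_or 0 [set B | hor u B = - ver u A /\ ver u B = hor u A].

End Dombrowski.

(** * Tori *)

Definition int_lattice (n : nat) : {pred 'rV[R]_n} :=
  fun v => v \is a mxOver Num.int.

Fact int_lattice_zmod_closed n : zmod_closed (@int_lattice n).
Proof.
split=> [|u v /mxOverP uZ /mxOverP vZ]; first exact/mxOver0/rpred0.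
by apply/mxOverP => i j; rewrite !mxE rpredB.
Qed.

HB.instance Definition _ n :=
  GRing.isZmodClosed.Build 'rV[R]_n (@int_lattice n)
    (@int_lattice_zmod_closed n).

Definition torus (n : nat) := Quotient.quot (@int_lattice n).
HB.instance Definition _ n := GRing.Zmodule.on (torus n).

Definition torus_pi n (t : 'rV[R]_n) : torus n := (\pi_(torus n) t)%qT.

Definition torus_mspace (n : nat) : mspace n :=
  quotient_mspace (M := rvspace n) (@torus_pi n).

Definition lie_group_hom n d (rho : torus n -> torus d) :=
  (forall a b, rho (a + b) = rho a + rho b) /\
  smooth_map (rho : torus_mspace n -> torus_mspace d).

Definition torus_action n (N : kspace n) (Phi : torus n -> N -> N) :=
  [/\ forall x, Phi 0 x = x,
      forall a b x, Phi (a + b) x = Phi a (Phi b x) &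
      smooth_map (fun y : prod_mspace (torus_mspace n) N => Phi y.1 y.2)].

Definition effective_action n (N : Type) (Phi : torus n -> N -> N) :=
  forall a, (forall x, Phi a x = x) -> a = 0.

Definition free_points n (N : Type) (Phi : torus n -> N -> N) : set N :=
  [set x | forall a, Phi a x = x -> a = 0].

(** * Parallel lattices *)

Section Lattice.
Variables (n : nat) (M : dfspace n).

Definition parallel_field (X : M -> 'rV[R]_n) :=
  smooth_field_on setT X /\ forall p v, df_conn M p v X = 0.

Definition generates (X : 'I_n -> M -> 'rV[R]_n) (L : set (TM M)) :=
  [/\ forall i, parallel_field (X i),
      forall p, (\matrix_i X i p) \in unitmx &
      L = [set u | exists k : 'I_n -> int,
                     u.2 = \sum_i X i u.1 *~ k i]].

Definition translation (X : 'I_n -> M -> 'rV[R]_n) (t : 'rV[R]_n)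
    (u : TM M) : TM M := (u.1, u.2 + \sum_i t 0 i *: X i u.1).

(* The group Gamma(L), for L generated by X. *)
Definition Gamma (X : 'I_n -> M -> 'rV[R]_n) : set (TM M -> TM M) :=
  [set translation X k | k in [set k | k \in @int_lattice n]].

(* M_L, as the set of orbits of Gamma(L). *)
Definition ML_type (X : 'I_n -> M -> 'rV[R]_n) :=
  {O : set (TM M) | exists u, O = [set g u | g in Gamma X]}.

Definition qL (X : 'I_n -> M -> 'rV[R]_n) (u : TM M) : ML_type X :=
  exist _ [set g u | g in Gamma X] (ex_intro _ u erefl).

Definition ML_mspace (X : 'I_n -> M -> 'rV[R]_n) : mspace (n + n) :=
  quotient_mspace (qL X).

Definition dqL X (u : TM M) (A : 'rV[R]_(n + n)) : 'rV[R]_(n + n) :=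
  dmap (qL X : TM M -> ML_mspace X) u A.

(* The quotient Kaehler structure: tangent vectors of M_L are lifted to TM
   through the derivative of q_L. *)
Definition ML_metric X (x : ML_mspace X) (v w : 'rV[R]_(n + n)) : R :=
  choose_or 0 [set r | exists u A B,
    [/\ qL X u = x, dqL X u A = v, dqL X u B = w & r = TM_metric u A B]].

Definition ML_J X (x : ML_mspace X) (v : 'rV[R]_(n + n)) : 'rV[R]_(n + n) :=
  choose_or 0 [set w | exists u A,
    [/\ qL X u = x, dqL X u A = v & w = dqL X u (TM_J u A)]].

Definition ML X : kspace n := @KSpace n (ML_mspace X) (@ML_metric X) (@ML_J X).

Definition ML_lift X (x : ML X) : TM M := projT1 (cid (proj2_sig x)).

(* Phi_X([t], q_L(u)) = q_L(u + sum_i t_i X_i), for representatives t and u *)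
Definition ML_action X (a : torus n) (x : ML X) : ML X :=
  qL X (translation X (repr a) (ML_lift x)).

End Lattice.

(** * Torifications and lifts *)

Section Torification.
Variables (n : nat) (M : dfspace n) (N : kspace n) (Phi : torus n -> N -> N).

Definition diffeo_onto d (Q Q' : mspace d) (S : set Q') (F : Q -> Q') :=
  smooth_map F /\
  exists G : Q' -> Q, [/\ smooth_map_on S G, forall x, S (F x),
    forall x, G (F x) = x & forall y, S y -> F (G y) = y].

Definition toric_parametrization (L : set (TM M)) (X : 'I_n -> M -> 'rV[R]_n)
    (F : ML X -> N) :=
  [/\ generates X L,
      diffeo_onto (free_points Phi) F,
      holomorphic F,
      isometric (k_metric (ML X)) (k_metric N) F &
      forall a x, F (ML_action a x) = Phi a (F x)].

Definition torification :=
  [/\ is_kahler N /\ connected_mspace N,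
      torus_action Phi, effective_action Phi,
      forall a, holomorphic (Phi a) /\
                isometric (k_metric N) (k_metric N) (Phi a) &
      exists L X F, @toric_parametrization L X F].

Definition compatible_covering (tau : TM M -> N) :=
  exists L X F, @toric_parametrization L X F /\ tau = F \o qL X.

End Torification.

Definition is_lift n d (M : dfspace n) (M' : dfspace d)
    (N : kspace n) (N' : kspace d)
    (Phi : torus n -> N -> N) (Phi' : torus d -> N' -> N')
    (m : N -> N') (f : M -> M') :=
  exists (tau : TM M -> N) (tau' : TM M' -> N'),
    [/\ compatible_covering Phi tau, compatible_covering Phi' tau' &
        m \o tau = tau' \o tmap f].

End Geometry.

(* Main.v *)
Require Import Defs.
From HB Require Import structures.
From mathcomp Require Import all_boot all_order all_algebra.
From mathcomp Require Import boolp classical_sets functions cardinality reals.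
From mathcomp Require Import topology normedtype landau sequences derive realfun.
From mathcomp Require Import interval_inference archimedean.
From mathcomp Require Import ring lra zify ring_quotient generic_quotient.

Set Implicit Arguments.
Unset Strict Implicit.
Unset Printing Implicit Defensive.

Import Order.TTheory GRing.Theory Num.Theory numFieldNormedType.Exports.

Local Open Scope classical_set_scope.
Local Open Scope ring_scope.

Local Arguments atlas {R n} m _.
Local Arguments df_metric {R n} d _ _ _.
Local Arguments df_conn {R n} d _ _ _.
Local Arguments k_metric {R n} k _ _ _.
Local Arguments k_J {R n} k _ _.

(** Let [tau : TM -> N] and [tau' : TM' -> N'] be the compatible coverings of
    the lift, so that [m \o tau = tau' \o tmap f]. A compatible covering is a
    local holomorphic isometry onto the free points, its fibres are the orbits
    of the integral translations, and it turns the translation by [t] into the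
    action of the class of [t] ([kahler_covering]). Over the free points, every
    property of [m] is therefore a property of [tmap f]; since free points are
    dense ([free_points_dense]), the closed conditions of being complex linear,
    isometric or equivariant extend to the whole of [N].

    A parallel frame [X] makes [TM] a product: [u] is given by its foot point
    and by its coordinates [frame_coord X u]. The connector is then simply the
    derivative of the frame coordinates ([connectorE]). Let [B] be the matrix
    of [df] in the parallel frames of [M] and [M'], whose rows are
    [frame_diff]. The frame coordinates of [tmap f u] are those of [u]
    multiplied by [B]; differentiating, the horizontal part of the image of [A]
    is the image of the horizontal part, whereas its vertical part is the image
    of the vertical part plus a term linear in [dB] ([hor_tmap], [ver_tmap]).
    As [J] exchanges both parts up to sign, [tmap f] is holomorphic if and only
    if [dB = 0] ([tmap_holomorphic]), and when [dB = 0] it is isometric if and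
    only if [f] is ([tmap_isometric], [isometric_of_tmap]).

    On the other hand [dB = 0] means that [f] is affine
    ([affine_of_frame_diff0], [frame_diff0_of_affine]). Coordinate fields of
    affine coordinates are locally constant combinations of the frame, which
    gives one direction. For the other one, the coframe dual to a parallel
    frame is closed because the connection has no torsion; the lemma of
    Poincare and the inverse function theorem integrate it to coordinates whose
    coordinate fields are the frame itself ([affine_chart]). In such coordinates
    the derivative of [f] is the constant matrix [B].

    For the second assertion, [B] is constant as [M] is connected, so [tmap f]
    carries the translation by [t] to the translation by [t *m B]. Comparing
    fibres of [tau] and [tau'], [B] maps integral vectors to integral vectors,
    and [t |-> t *m B] descends to the homomorphism of tori [torus_hom]. The
    rows of [B] are independent because [f] is an immersion, hence [B *m B^T]
    is an invertible integral matrix, and its determinant bounds the kernel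
    ([torus_hom_kernel]). Uniqueness holds because the image of [m] contains
    free points.

    Density of the free points: the stabilizer of a point which is not free is
    a closed subgroup of the torus, and a nontrivial one contains a nonzero
    torsion element ([closed_subgroup_torsion]). The torus has countably many
    torsion elements, and the fixed set of each nonzero one has empty interior
    ([torsion_fix_empty]); the theorem of Baire concludes. *)

(** * Derivatives *)

(** The definition through Landau symbols is rarely convenient in estimates;
    this is the usual epsilon form of differentiability. *)
Lemma is_diffP (R : realType) (V W : normedModType R) (f : V -> W) (x : V)
    (L : {linear V -> W}) : continuous L ->
  (is_diff x f L <->
   forall e, 0 < e ->
     \forall y \near x, `|f y - f x - L (y - x)| <= e * `|y - x|).
Proof.
move=> Lc; have key : (f \o shift x = cst (f x) + L +o_ 0 id) <->
   forall e, 0 < e ->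
     \forall y \near x, `|f y - f x - L (y - x)| <= e * `|y - x|.
  split=> [/eqaddoP h e e0|h].
    apply/nbhs0P; apply: filterS (h _ e0) => y.
    by rewrite !fctE /= [x + y]addrC addrK opprD addrA.
  apply/eqaddoP => e e0; have /nbhs0P := h _ e0; apply: filterS => y.
  by rewrite !fctE /= [x + y]addrC addrK opprD addrA.
split=> [[df dfL]|/key h].
  by apply/key; rewrite -dfL; exact: diff_locally.
have dL := diff_unique Lc h.
by apply: DiffDef => //; apply/diff_locallyP; rewrite dL.
Qed.

Lemma near_eq_is_diff (R : realType) (V W : normedModType R) (f g : V -> W)
    (x : V) (L : {linear V -> W}) : continuous L ->
  {near x, f =1 g} -> is_diff x f L -> is_diff x g L.
Proof.
move=> Lc fg /(is_diffP _ _ Lc) h; apply/(is_diffP _ _ Lc) => e /h {}h.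
have fgx := nbhs_singleton fg; near=> y.
by rewrite -fgx -(near fg y) //; near: y.
Unshelve. all: by end_near. Qed.

Lemma near_eq_differentiable (R : realType) (V W : normedModType R)
    (f g : V -> W) (x : V) : {near x, f =1 g} ->
  differentiable f x -> differentiable g x /\ forall v, 'd g x v = 'd f x v.
Proof.
move=> fg df; have /(near_eq_is_diff _ fg) [|dg dgf] := differentiableP df.
  exact: diff_continuous.
by split=> // v; rewrite dgf.
Qed.

Lemma is_diffE (R : realType) (V W : normedModType R) (f : V -> W) (x : V) L :
  is_diff x f L -> differentiable f x /\ forall v, 'd f x v = L v.
Proof. by case=> df fE; split=> // v; rewrite fE. Qed.

Lemma diff_Z (R : realType) (V W : normedModType R) (f : V -> W) (x : V) a v :
  'd f x (a *: v) = a *: 'd f x v.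
Proof. exact: linearZ. Qed.

Lemma diff_D (R : realType) (V W : normedModType R) (f : V -> W) (x : V) v w :
  'd f x (v + w) = 'd f x v + 'd f x w.
Proof. exact: linearD. Qed.

Lemma diff_0 (R : realType) (V W : normedModType R) (f : V -> W) (x : V) :
  'd f x 0 = 0.
Proof. exact: linear0. Qed.

(** * Smooth functions near a point *)

Section PointwiseSmooth.
Variable R : realType.

(** [Ck_on] is meaningful on open sets only, and its set has to be carried along.
    The pointwise version says the same on some neighbourhood of [x], so that it
    depends on the germ of [f] at [x] only ([near_eq_Ck]) and no domain has to be
    mentioned. *)
Fixpoint Ck_at (n : nat) (V : normedModType R) (k : nat)
    (f : 'rV[R]_n -> V) (x : 'rV[R]_n) : Prop :=
  match k with
  | 0%N => \forall y \near x, {for y, continuous f}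
  | k'.+1 => (\forall y \near x, differentiable f y) /\
             (forall v, Ck_at k' (fun y => 'd f y v) x)
  end.

Definition smooth_at n (V : normedModType R) (f : 'rV[R]_n -> V) x :=
  forall k, Ck_at k f x.

Lemma near_all (T : topologicalType) (x : T) (P : set T) :
  (forall y, P y) -> \forall y \near x, P y.
Proof. by move=> h; near=> y. Unshelve. all: by end_near. Qed.

Section OneSource.
Variables (n : nat).
Implicit Types (V W : normedModType R) (x : 'rV[R]_n).

Lemma Ck_onP V k U (f : 'rV[R]_n -> V) : open U ->
  Ck_on k U f <-> forall x, U x -> Ck_at k f x.
Proof.
move=> Uo; elim: k f => [|k IH] f /=.
  split=> h x Ux; last exact: nbhs_singleton (h x Ux).
  by apply: filterS (open_nbhs_nbhs (conj Uo Ux)) => y; exact: h.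
split=> [[df dfC] x Ux|h].
  split; last by move=> v; have /IH := dfC v; exact.
  by apply: filterS (open_nbhs_nbhs (conj Uo Ux)) => y; exact: df.
split=> [x /h [dfx _]|v]; first exact: nbhs_singleton dfx.
by apply/IH => x /h [].
Qed.

Lemma smooth_onP V U (f : 'rV[R]_n -> V) : open U ->
  smooth_on U f <-> forall x, U x -> smooth_at f x.
Proof.
move=> Uo; split=> [h x Ux k|h k]; first exact: (Ck_onP k f Uo).1 (h k) x Ux.
by apply/(Ck_onP k f Uo) => x Ux; apply: h.
Qed.

Lemma near_eq_Ck V k (f g : 'rV[R]_n -> V) x :
  {near x, f =1 g} -> Ck_at k f x -> Ck_at k g x.
Proof.
elim: k f g => [|k IH] f g fg /=; have fgx := nbhs_singleton fg.
  move/near_join : fg => fg h; near=> y.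
  have fy : {for y, continuous f} by near: y.
  have fgy : {near y, f =1 g} by near: y; exact: fg.
  move: fy; rewrite /prop_for /continuous_at (nbhs_singleton fgy).
  by apply: cvg_trans; apply: near_eq_cvg fgy.
move/near_join : fg => fg [df dC]; split=> [|v].
  near=> y; have dfy : differentiable f y by near: y.
  have fgy : {near y, f =1 g} by near: y; exact: fg.
  by have [] := near_eq_differentiable fgy dfy.
apply: IH (dC v); near=> y.
have dfy : differentiable f y by near: y.
have fgy : {near y, f =1 g} by near: y; exact: fg.
by have [_ ->] := near_eq_differentiable fgy dfy.
Unshelve. all: by end_near. Qed.

Lemma near_eq_smooth V (f g : 'rV[R]_n -> V) x :
  {near x, f =1 g} -> smooth_at f x -> smooth_at g x.
Proof. by move=> fg h k; exact: near_eq_Ck fg (h k). Qed.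

Lemma CkW V k (f : 'rV[R]_n -> V) x : Ck_at k.+1 f x -> Ck_at k f x.
Proof.
elim: k f => [|k IH] f [df dC] /=.
  by apply: filterS df => y; exact: differentiable_continuous.
by split=> // v; apply: IH.
Qed.

Lemma Ck_continuous V k (f : 'rV[R]_n -> V) x :
  Ck_at k f x -> \forall y \near x, {for y, continuous f}.
Proof. by elim: k => // k IH /CkW. Qed.

Lemma smooth_continuous V (f : 'rV[R]_n -> V) x :
  smooth_at f x -> {for x, continuous f}.
Proof. by move=> h; exact: nbhs_singleton (h 0%N). Qed.

Lemma smooth_near_diff V (f : 'rV[R]_n -> V) x :
  smooth_at f x -> \forall y \near x, differentiable f y.
Proof. by move=> h; have [] := h 1%N. Qed.

Lemma smooth_diff V (f : 'rV[R]_n -> V) x : smooth_at f x -> differentiable f x.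
Proof. by move=> /smooth_near_diff /nbhs_singleton. Qed.

Lemma smooth_deriv V (f : 'rV[R]_n -> V) x v :
  smooth_at f x -> smooth_at (fun y => 'd f y v) x.
Proof. by move=> h k; have [_] := h k.+1; exact. Qed.

Lemma Ck_cst V k (a : V) x : Ck_at k (fun=> a) x.
Proof.
elim: k a => [|k IH] a /=; first by apply: near_all => y; exact: cst_continuous.
split=> [|v]; first by apply: near_all => y; exact: differentiable_cst.
apply: near_eq_Ck (IH 0); near=> y; rewrite diff_cst.
Unshelve. all: by end_near. Qed.

Lemma Ck_lin V W k (L : {linear V -> W}) (f : 'rV[R]_n -> V) x :
  continuous L -> Ck_at k f x -> Ck_at k (fun y => L (f y)) x.
Proof.
move=> Lc; elim: k f => [|k IH] f /=.
  by apply: filterS => y fy; apply: continuous_comp => //; exact: Lc.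
move=> [df dC]; split=> [|v].
  near=> y; apply: (@differentiable_comp _ _ _ _ f L); first by near: y.
  exact: linear_differentiable.
apply: near_eq_Ck (IH _ (dC v)); near=> y.
have dfy : differentiable f y by near: y.
rewrite (@diff_comp _ _ _ _ f L) //; last exact: linear_differentiable.
by rewrite /= (diff_lin _ Lc).
Unshelve. all: by end_near. Qed.

Lemma Ck_linear V k (L : {linear 'rV[R]_n -> V}) x :
  continuous L -> Ck_at k L x.
Proof.
case: k => [|k] Lc /=; first by apply: near_all => y; exact: Lc.
split=> [|v]; first by apply: near_all => y; exact: linear_differentiable.
by apply: near_eq_Ck (Ck_cst _ (L v) _); near=> y; rewrite (diff_lin _ Lc).
Unshelve. all: by end_near. Qed.

Lemma Ck_add V k (f g : 'rV[R]_n -> V) x :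
  Ck_at k f x -> Ck_at k g x -> Ck_at k (fun y => f y + g y) x.
Proof.
elim: k f g => [|k IH] f g /=.
  by move=> fx gx; near=> y; apply: (@continuousD _ _ _ f g); near: y.
move=> [df dfC] [dg dgC]; split=> [|v].
  by near=> y; apply: (@differentiableD _ _ _ f g); near: y.
apply: near_eq_Ck (IH _ _ (dfC v) (dgC v)); near=> y.
by rewrite (@diffD _ _ _ f g) //; near: y.
Unshelve. all: by end_near. Qed.

Lemma Ck_sum V k (I : Type) (r : seq I) (P : pred I)
    (f : I -> 'rV[R]_n -> V) x :
  (forall i, P i -> Ck_at k (f i) x) ->
  Ck_at k (fun y => \sum_(i <- r | P i) f i y) x.
Proof.
move=> fC; have -> : (fun y => \sum_(i <- r | P i) f i y) =
    \big[(fun f g y => f y + g y)/(fun=> 0)]_(i <- r | P i) f i.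
  apply/funext => y; elim/big_rec2: _ => // i a b _ ->; first by [].
apply: (big_ind (fun f : 'rV[R]_n -> V => Ck_at k f x)) => //.
  exact: Ck_cst.
by move=> ? ?; exact: Ck_add.
Qed.

(** By induction on [k] through the product rule, whose factors [f] and ['d g]
    are both of class [C^k] at the next step. *)
Lemma Ck_mul k (f g : 'rV[R]_n -> R) x :
  Ck_at k f x -> Ck_at k g x -> Ck_at k (fun y => f y * g y) x.
Proof.
elim: k f g => [|k IH] f g.
  by move=> fx gx; near=> y; apply: (@continuousM _ _ f g); near: y.
move=> /[dup] /CkW fC [df dfC] /[dup] /CkW gC [dg dgC]; split=> [|v].
  by near=> y; apply: (@differentiableM _ _ f g); near: y.
have := Ck_add (IH _ _ fC (dgC v)) (IH _ _ gC (dfC v)).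
apply: near_eq_Ck; near=> y.
by rewrite (@diffM _ _ f g) //; near: y.
Unshelve. all: by end_near. Qed.

Lemma Ck_inv k (f : 'rV[R]_n -> R) x : f x != 0 ->
  Ck_at k f x -> Ck_at k (fun y => (f y)^-1) x.
Proof.
move=> fx0; elim: k f fx0 => [|k IH] f fx0.
  move=> fx; have fn0 : \forall y \near x, f y != 0.
    have := nbhs_singleton fx => /cvgr_neq0; exact.
  by near=> y; apply: (@continuousV _ _ f); near: y.
move=> /[dup] /CkW fC [df dfC].
have fn0 : \forall y \near x, f y != 0.
  have := nbhs_singleton (Ck_continuous fC) => /cvgr_neq0; exact.
split=> [|v].
  by near=> y; apply: (@differentiableV _ _ f); near: y.
have fV := IH _ fx0 fC.
have := Ck_mul (Ck_cst _ (-1 : R) _) (Ck_mul (Ck_mul fV fV) (dfC v)).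
apply: near_eq_Ck; near=> y.
rewrite (@diffV _ _ f) ?mulN1r /=; [|by near: y..].
by rewrite scaleNr -expr2 exprVn.
Unshelve. all: by end_near. Qed.

End OneSource.
End PointwiseSmooth.

Section Components.
Variable R : realType.
Implicit Types (n m : nat) (V W : normedModType R).

Lemma rV_sum_delta n (v : 'rV[R]_n) : v = \sum_j v 0 j *: delta_mx 0 j.
Proof. exact: row_sum_delta. Qed.

Lemma linear_rV n V (L : {linear 'rV[R]_n -> V}) v :
  L v = \sum_j v 0 j *: L (delta_mx 0 j).
Proof.
by rewrite {1}(rV_sum_delta v) linear_sum; apply: eq_bigr => j _; rewrite linearZ.
Qed.

Lemma continuous_sum (T : topologicalType) V (I : Type) (r : seq I)
    (f : I -> T -> V) x :
  (forall i, {for x, continuous (f i)}) ->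
  {for x, continuous (fun y => \sum_(i <- r) f i y)}.
Proof.
move=> fc; elim: r => [|i r IH].
  by under [X in {for _, continuous X}]eq_fun do rewrite big_nil;
    exact: cst_continuous.
under [X in {for _, continuous X}]eq_fun do rewrite big_cons.
exact: (@continuousD _ _ _ (f i) (fun y => \sum_(i <- r) f i y)).
Qed.

Lemma continuous_linear_rV n V (L : {linear 'rV[R]_n -> V}) : continuous L.
Proof.
move=> x; have -> : (L : _ -> _) = fun v => \sum_j v 0 j *: L (delta_mx 0 j).
  by apply/funext => v; exact: linear_rV.
suff h : {for x, continuous (fun v : 'rV[R]_n => \sum_j v 0 j *: L (delta_mx 0 j))}.
  exact: h.
apply: continuous_sum => j.
apply: (@continuous_comp _ _ _ (fun v : 'rV[R]_n => v 0 j)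
  (fun a : R => a *: L (delta_mx 0 j))); first exact: coord_continuous.
exact: scalel_continuous.
Qed.

Section Cod.
Variables (n : nat).
Implicit Types x : 'rV[R]_n.

Lemma Ck_linfun V W k (L : V -> W) (f : 'rV[R]_n -> V) x :
  linear L -> continuous L -> Ck_at k f x -> Ck_at k (fun y => L (f y)) x.
Proof.
move=> Ll Lc fk; pose LM := GRing.isLinear.Build _ _ _ _ _ Ll.
pose LL : {linear _ -> _} := HB.pack L LM.
exact: (@Ck_lin _ _ _ _ _ LL).
Qed.

Lemma Ck_coord m k (f : 'rV[R]_n -> 'rV[R]_m) x :
  Ck_at k f x <-> forall j, Ck_at k (fun y => f y 0 j) x.
Proof.
split=> [fk j|fk].
  apply: (@Ck_linfun _ _ _ (fun v : 'rV[R]_m => v 0 j)) => //.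
    by move=> a u v; rewrite !mxE.
  exact: coord_continuous.
have -> : f = fun y => \sum_j f y 0 j *: delta_mx 0 j.
  by apply/funext => y; exact: rV_sum_delta.
apply: Ck_sum => j _.
apply: (@Ck_linfun _ _ _ (fun a : R => a *: delta_mx 0 j)) => //.
  by move=> a u v; rewrite scalerDl scalerA.
exact: scalel_continuous.
Qed.

Lemma Ck_scale m k (f : 'rV[R]_n -> R) (g : 'rV[R]_n -> 'rV[R]_m) x :
  Ck_at k f x -> Ck_at k g x -> Ck_at k (fun y => f y *: g y) x.
Proof.
move=> fk /Ck_coord gk; apply/Ck_coord => j.
have := Ck_mul fk (gk j).
by under [X in Ck_at _ X _ -> _]eq_fun do rewrite -[_ * _]/(_ *: _);
  under [X in _ -> Ck_at _ X _]eq_fun do rewrite mxE.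
Qed.

End Cod.

(** Induction on [k] needs the chain rule with a fixed direction: the derivative
    of the composite along [v] is the combination of the partial derivatives of
    [g] at [f y] with the coordinates of the derivative of [f], and both kinds of
    factors are covered by the induction hypothesis. *)
Lemma Ck_comp n m p k (g : 'rV[R]_m -> 'rV[R]_p) (f : 'rV[R]_n -> 'rV[R]_m) x :
  Ck_at k g (f x) -> Ck_at k f x -> Ck_at k (fun y => g (f y)) x.
Proof.
elim: k g => [|k IH] g.
  move=> gk fk; have fx := nbhs_singleton fk.
  near=> y; apply: (@continuous_comp _ _ _ f g); first by near: y.
  by near: y; exact: fx gk.
move=> [dg gk] /[dup] /CkW fkk [df fk].
have fx := nbhs_singleton (Ck_continuous fkk).
have dgf : \forall y \near x, differentiable g (f y) by exact: fx dg.
split=> [|v].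
  by near=> y; apply: (@differentiable_comp _ _ _ _ f g); near: y.
have : Ck_at k (fun y => \sum_j ('d f y v) 0 j *: 'd g (f y) (delta_mx 0 j)) x.
  apply: Ck_sum => j _; apply: Ck_scale; last exact: (IH _ (gk _) fkk).
  exact: (Ck_coord _ _ _).1 (fk v) j.
apply: near_eq_Ck; near=> y.
by rewrite (@diff_comp _ _ _ _ f g) ?[RHS]/=; [rewrite -linear_rV|near: y..].
Unshelve. all: by end_near. Qed.

Lemma Ck_compR n m k (g : 'rV[R]_m -> R) (f : 'rV[R]_n -> 'rV[R]_m) x :
  Ck_at k g (f x) -> Ck_at k f x -> Ck_at k (fun y => g (f y)) x.
Proof.
move=> gk fk; have gk' : Ck_at k (fun z => g z *: (delta_mx 0 0 : 'rV[R]_1)) (f x).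
  apply: (@Ck_linfun _ _ _ _ (fun a : R => a *: delta_mx 0 0)) => //.
    by move=> a u v; rewrite scalerDl scalerA.
  exact: scalel_continuous.
have /Ck_coord/(_ 0) := Ck_comp gk' fk.
by under [X in Ck_at _ X _ -> _]eq_fun do rewrite !mxE eqxx mulr1.
Qed.

Section SmoothRules.
Variables (n : nat) (x : 'rV[R]_n).

Lemma smooth_cst V (a : V) : smooth_at (fun=> a) x.
Proof. by move=> k; exact: Ck_cst. Qed.

Lemma smooth_linear m (L : {linear 'rV[R]_n -> 'rV[R]_m}) : smooth_at L x.
Proof. by move=> k; apply: Ck_linear; exact: continuous_linear_rV. Qed.

Lemma smooth_linfun V (L : 'rV[R]_n -> V) : linear L -> smooth_at L x.
Proof.
move=> Ll k; pose LM := GRing.isLinear.Build _ _ _ _ _ Ll.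
pose LL : {linear _ -> _} := HB.pack L LM.
by apply: (@Ck_linear _ _ _ _ LL); exact: continuous_linear_rV.
Qed.

Lemma smooth_id : smooth_at id x.
Proof. exact: smooth_linfun. Qed.

Lemma smooth_add V (f g : 'rV[R]_n -> V) :
  smooth_at f x -> smooth_at g x -> smooth_at (fun y => f y + g y) x.
Proof. by move=> fs gs k; exact: Ck_add. Qed.

Lemma smooth_sum V (I : Type) (r : seq I) (P : pred I) (f : I -> 'rV[R]_n -> V) :
  (forall i, P i -> smooth_at (f i) x) ->
  smooth_at (fun y => \sum_(i <- r | P i) f i y) x.
Proof. by move=> fs k; apply: Ck_sum => i /fs. Qed.

Lemma smooth_mul (f g : 'rV[R]_n -> R) :
  smooth_at f x -> smooth_at g x -> smooth_at (fun y => f y * g y) x.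
Proof. by move=> fs gs k; exact: Ck_mul. Qed.

Lemma smooth_scale m (f : 'rV[R]_n -> R) (g : 'rV[R]_n -> 'rV[R]_m) :
  smooth_at f x -> smooth_at g x -> smooth_at (fun y => f y *: g y) x.
Proof. by move=> fs gs k; exact: Ck_scale. Qed.

Lemma smooth_prod (I : Type) (r : seq I) (P : pred I) (f : I -> 'rV[R]_n -> R) :
  (forall i, P i -> smooth_at (f i) x) ->
  smooth_at (fun y => \prod_(i <- r | P i) f i y) x.
Proof.
move=> fC; have -> : (fun y => \prod_(i <- r | P i) f i y) =
    \big[(fun f g y => f y * g y)/(fun=> 1)]_(i <- r | P i) f i.
  by apply/funext => y; elim/big_rec2: _ => // i a b _ ->.
apply: (big_ind (fun f : 'rV[R]_n -> R => smooth_at f x)) => //.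
  exact: smooth_cst.
by move=> ? ?; exact: smooth_mul.
Qed.

Lemma smooth_inv (f : 'rV[R]_n -> R) : f x != 0 ->
  smooth_at f x -> smooth_at (fun y => (f y)^-1) x.
Proof. by move=> f0 fs k; exact: Ck_inv. Qed.

Lemma smooth_coord m (f : 'rV[R]_n -> 'rV[R]_m) :
  smooth_at f x <-> forall j, smooth_at (fun y => f y 0 j) x.
Proof.
split=> [fs j k|fs k]; first exact: (Ck_coord _ _ _).1 (fs k) j.
by apply/Ck_coord => j; exact: fs.
Qed.

Lemma smooth_comp m p (g : 'rV[R]_m -> 'rV[R]_p) (f : 'rV[R]_n -> 'rV[R]_m) :
  smooth_at g (f x) -> smooth_at f x -> smooth_at (fun y => g (f y)) x.
Proof. by move=> gs fs k; exact: Ck_comp. Qed.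

Lemma smooth_compR m (g : 'rV[R]_m -> R) (f : 'rV[R]_n -> 'rV[R]_m) :
  smooth_at g (f x) -> smooth_at f x -> smooth_at (fun y => g (f y)) x.
Proof. by move=> gs fs k; exact: Ck_compR. Qed.

Lemma smooth_row_mx m p (f : 'rV[R]_n -> 'rV[R]_m) (g : 'rV[R]_n -> 'rV[R]_p) :
  smooth_at f x -> smooth_at g x -> smooth_at (fun y => row_mx (f y) (g y)) x.
Proof.
move=> /smooth_coord fs /smooth_coord gs; apply/smooth_coord => j.
case: (split_ordP j) => i ->.
  by under [X in smooth_at X]eq_fun do rewrite row_mxEl; exact: fs.
by under [X in smooth_at X]eq_fun do rewrite row_mxEr; exact: gs.
Qed.

(** Matrices are treated entrywise, so that no norm on them is involved. *)
Definition smooth_mx m p (A : 'rV[R]_n -> 'M[R]_(m, p)) :=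
  forall i j, smooth_at (fun y => A y i j) x.

Lemma smooth_det m (A : 'rV[R]_n -> 'M[R]_m) :
  smooth_mx A -> smooth_at (fun y => \det (A y)) x.
Proof.
move=> As; apply: smooth_sum => s _; apply: smooth_mul; first exact: smooth_cst.
by apply: smooth_prod => i _; exact: As.
Qed.

(** By the formula of Cramer: near [x] the determinant does not vanish, and the
    cofactors are polynomials in the entries. *)
Lemma smooth_invmx m (A : 'rV[R]_n -> 'M[R]_m) :
  A x \in unitmx -> smooth_mx A -> smooth_mx (fun y => invmx (A y)).
Proof.
rewrite unitmxE unitfE => A0 As i j.
have dA := smooth_det As.
have h : smooth_at (fun y => (\det (A y))^-1 * cofactor (A y) j i) x.
  apply: smooth_mul; first exact: smooth_inv.
  apply: smooth_mul; first exact: smooth_cst.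
  apply: smooth_sum => s _; apply: smooth_mul; first exact: smooth_cst.
  apply: smooth_prod => l _.
  by under [X in smooth_at X]eq_fun do rewrite !mxE; exact: As.
apply: near_eq_smooth h; near=> y.
have Ay : \det (A y) != 0.
  by near: y; have /smooth_continuous/cvgr_neq0 := dA; exact.
by rewrite /invmx unitmxE unitfE Ay !mxE.
Unshelve. all: by end_near. Qed.

Lemma smooth_mulmx m p q (A : 'rV[R]_n -> 'M[R]_(m, p)) (B : 'rV[R]_n -> 'M[R]_(p, q)) :
  smooth_mx A -> smooth_mx B -> smooth_mx (fun y => A y *m B y).
Proof.
move=> As Bs i j; under [X in smooth_at X]eq_fun do rewrite mxE.
by apply: smooth_sum => l _; exact: smooth_mul.
Qed.

Lemma smooth_rV_mx m (f : 'rV[R]_n -> 'rV[R]_m) : smooth_at f x <-> smooth_mx f.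
Proof.
split=> [/smooth_coord h i j|h]; first by rewrite ord1; exact: h.
by apply/smooth_coord => j; exact: h.
Qed.

End SmoothRules.

Lemma smooth_lsubmx n m x : smooth_at (@lsubmx R 1 n m) x.
Proof. exact: smooth_linear. Qed.

Lemma smooth_rsubmx n m x : smooth_at (@rsubmx R 1 n m) x.
Proof. exact: smooth_linear. Qed.

(** This is why the transition maps of the tangent bundle, and the tangent lift
    of a smooth map, are smooth. *)
Lemma smooth_tangent n m (f : 'rV[R]_n -> 'rV[R]_m) (x : 'rV[R]_(n + n)) :
  smooth_at f (lsubmx x) -> smooth_at (fun y => 'd f (lsubmx y) (rsubmx y)) x.
Proof.
move=> fs; have h : smooth_at (fun y : 'rV[R]_(n + n) => \sum_j rsubmx y 0 j *:
    'd f (lsubmx y) (delta_mx 0 j)) x.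
  apply: smooth_sum => j _; apply: smooth_scale.
    by apply: (smooth_coord _ _).1; exact: smooth_rsubmx.
  apply: (@smooth_comp _ _ _ _ (fun z => 'd f z (delta_mx 0 j)) lsubmx).
    exact: smooth_deriv.
  exact: smooth_lsubmx.
apply: near_eq_smooth h; near=> y; by rewrite -linear_rV.
Unshelve. all: by end_near. Qed.

Lemma diff_coord n m (f : 'rV[R]_n -> 'rV[R]_m) x v j :
  differentiable f x -> 'd (fun y => f y 0 j) x v = ('d f x v) 0 j.
Proof.
move=> df; have Ll : linear (fun w : 'rV[R]_m => w 0 j : R).
  by move=> a u w; rewrite !mxE.
pose LM := GRing.isLinear.Build _ _ _ _ _ Ll.
pose LL : {linear _ -> _} := HB.pack (fun w : 'rV[R]_m => w 0 j : R) LM.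
have Lc : continuous LL by exact: coord_continuous.
rewrite -[fun y => _]/(LL \o f) diff_comp //; last exact: linear_differentiable.
by rewrite /= (diff_lin _ Lc).
Qed.

End Components.

(** * Mean value inequality *)

Section MeanValue.
Variable R : realType.

Lemma rV_norm_le m (v : 'rV[R]_m) (B : R) : 0 <= B ->
  (forall j, `|v 0 j| <= B) -> `|v| <= B.
Proof.
move=> B0 vB; rewrite [leLHS]/Num.Def.normr /= mx_normrE.
by apply: bigmax_le => // -[i j] _ /=; rewrite ord1.
Qed.

Lemma rV_coord_le m (v : 'rV[R]_m) j : `|v 0 j| <= `|v|.
Proof.
rewrite [leRHS]/Num.Def.normr /= mx_normrE.
exact: (le_bigmax _ (fun i : 'I_1 * 'I_m => `|v i.1 i.2|) (0, j)).
Qed.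

(** The mean value theorem applied to [f] along the segment from [x] to [x + h]. *)
Lemma mvt_line n (f : 'rV[R]_n -> R) (x h : 'rV[R]_n) :
  (forall t : R, 0 <= t <= 1 -> differentiable f (x + t *: h)) ->
  exists2 c, 0 < c < 1 & f (x + h) - f x = 'd f (x + c *: h) h.
Proof.
move=> df.
have dg (t : R) : 0 <= t <= 1 ->
    is_diff t (fun t : R => f (x + t *: h)) (fun s => 'd f (x + t *: h) (s *: h)).
  move=> t01; have dl : is_diff t (fun t : R => x + t *: h) ( *:%R ^~ h).
    have := is_diffD (is_diff_cst x t) (is_diff_scalel t h).
    by rewrite add0r.
  have := df t t01 => /differentiableP dfx.
  exact: (@is_diff_comp _ _ _ _ (fun t : R => x + t *: h) _ f).
have dd (t : R) : 0 <= t <= 1 ->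
    is_derive t 1 (fun t : R => f (x + t *: h)) ('d f (x + t *: h) h).
  move=> /dg dt; have dt' := @ex_diff _ _ _ _ _ _ _ dt.
  apply: DeriveDef; first exact: diff_derivable.
  by rewrite deriveE // diff_val scale1r.
have [||c c01 fE] := @MVT R (fun t : R => f (x + t *: h))
    (fun t => 'd f (x + t *: h) h) 0 1 ltr01.
- by move=> t; rewrite in_itv /= => /andP[t0 t1]; apply: dd; rewrite !ltW.
- apply: derivable_within_continuous => t; rewrite in_itv /= => t01.
  by have [] := dd t t01.
exists c; first by move: c01; rewrite in_itv.
by move: fE; rewrite scale1r scale0r addr0 subr0 mulr1.
Qed.

(** A vector valued map has no intermediate point common to all its components;
    applying the scalar theorem to each of them still gives an inequality for the
    supremum norm. The vector [w] is the candidate for the increment. *)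
Lemma mvt_ineq n m (f : 'rV[R]_n -> 'rV[R]_m) x h w (B : R) :
  (forall t : R, 0 <= t <= 1 -> differentiable f (x + t *: h)) ->
  (forall t : R, 0 <= t <= 1 -> `|'d f (x + t *: h) h - w| <= B) ->
  `|f (x + h) - f x - w| <= B.
Proof.
move=> df dB; have B0 : 0 <= B.
  by apply: le_trans (dB 0 _); rewrite // lexx ler01.
apply: rV_norm_le => // j; rewrite !mxE.
have [t t01|c c01 ->] := @mvt_line n (fun y => f y 0 j) x h.
  apply: (@differentiable_comp _ _ _ _ f (fun v : 'rV[R]_m => v 0 j)).
    exact: df.
  exact: differentiable_coord.
have c01' : 0 <= c <= 1 by case/andP: c01 => *; rewrite !ltW.
rewrite diff_coord; last exact: df.
have := le_trans (rV_coord_le _ j) (dB c c01').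
by rewrite !mxE.
Qed.

Lemma ball_segment n (x a b : 'rV[R]_n) (e t : R) : ball x e a -> ball x e b ->
  0 <= t <= 1 -> ball x e (a + t *: (b - a)).
Proof.
rewrite -ball_normE /= => xa xb /andP[t0 t1].
have -> : x - (a + t *: (b - a)) = (1 - t) *: (x - a) + t *: (x - b).
  rewrite scalerBl scale1r -addrA -[x - _]/(x + _) opprD; apply/rowP => j.
  by rewrite !mxE; ring.
apply: le_lt_trans (ler_normD _ _) _; rewrite !normrZ.
rewrite (ger0_norm t0) ger0_norm ?subr_ge0 //.
have [->|t0'] := eqVneq t 0; first by rewrite subr0 mul1r mul0r addr0.
have tp : 0 < t by rewrite lt_neqAle eq_sym t0'.
have -> : e = (1 - t) * e + t * e by ring.
apply: ler_ltD; first by apply: ler_wpM2l; [rewrite subr_ge0|exact: ltW].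
by rewrite ltr_pM2l.
Qed.

(** Continuity of the partial derivatives at [x], for the finitely many basis
    vectors, gives continuity of the derivative for the operator norm. *)
Lemma near_diff_close n m (f : 'rV[R]_n -> 'rV[R]_m) x e : 0 < e ->
  Ck_at 1 f x -> \forall y \near x, forall v, `|'d f y v - 'd f x v| <= e * `|v|.
Proof.
move=> e0 [_ dC].
pose e' := e / n.+1%:R; have e'0 : 0 < e' by rewrite divr_gt0.
have H (j : 'I_n) : \forall y \near x, `|'d f x (delta_mx 0 j) - 'd f y (delta_mx 0 j)| < e'.
  have := nbhs_singleton (dC (delta_mx 0 j)).
  by move=> /cvgrPdist_lt /(_ _ e'0).
have {}H : \forall y \near x, forall j : 'I_n, `|'d f x (delta_mx 0 j) - 'd f y (delta_mx 0 j)| < e'.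
  exact: (@filter_forall _ _ (fun (j : 'I_n) y => `|'d f x (delta_mx 0 j) - 'd f y (delta_mx 0 j)| < e') (nbhs x) _ H).
apply: filterS H => y Hy v.
have -> : 'd f y v - 'd f x v = \sum_j v 0 j *:
    ('d f y (delta_mx 0 j) - 'd f x (delta_mx 0 j)).
  rewrite [X in X - _ = _]linear_rV [X in _ - X = _]linear_rV -sumrB.
  by apply: eq_bigr => j _; rewrite scalerBr.
apply: le_trans (ler_norm_sum _ _ _) _.
apply: (@le_trans _ _ (\sum_(j < n) e' * `|v|)).
  apply: ler_sum => j _; rewrite normrZ mulrC; apply: ler_pM => //.
    by rewrite distrC ltW.
  exact: rV_coord_le.
rewrite sumr_const card_ord -mulr_natr mulrAC; apply: ler_wpM2r => //.
rewrite /e' -mulrA ler_piMr ?ltW // ?ltr_pdivrMl ?ltr0n // mulr1 ltr_nat.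
exact: ltnSn.
Qed.

(** Unlike in the definition of the derivative both points vary; the inverse
    function theorem and [finite_order_fix] depend on this. *)
Lemma strict_diff n m (f : 'rV[R]_n -> 'rV[R]_m) x e : 0 < e ->
  Ck_at 1 f x -> exists2 r, 0 < r & forall y z, ball x r y -> ball x r z ->
     `|f y - f z - 'd f x (y - z)| <= e * `|y - z|.
Proof.
move=> e0 /[dup] f1 [df _].
have /nbhs_ballP [r /= r0 rP] : \forall y \near x, differentiable f y /\
    forall v, `|'d f y v - 'd f x v| <= e * `|v|.
  near=> y; split; first by near: y.
  by near: y; exact: near_diff_close.
exists r => // y z xy xz.
have := @mvt_ineq _ _ f z (y - z) ('d f x (y - z)) (e * `|y - z|).
rewrite subrKC; apply=> t t01.
  by have [] := rP _ (ball_segment xz xy t01).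
by have [_] := rP _ (ball_segment xz xy t01); exact.
Unshelve. all: by end_near. Qed.

Lemma diff0_const n m (f : 'rV[R]_n -> 'rV[R]_m) x r y z :
  (forall y, ball x r y -> differentiable f y /\ forall v, 'd f y v = 0) ->
  ball x r y -> ball x r z -> f y = f z.
Proof.
move=> h xy xz; apply/eqP; rewrite -subr_eq0 -normr_le0.
have := @mvt_ineq _ _ f z (y - z) 0 0.
rewrite subrKC subr0; apply=> t t01.
  by have [] := h _ (ball_segment xz xy t01).
by have [_ ->] := h _ (ball_segment xz xy t01); rewrite subr0 normr0.
Qed.

End MeanValue.

(** * Symmetry of second derivatives *)

Section Schwarz.
Variable R : realType.

(** Two applications of the mean value theorem: first to [f (y + s w) - f y] in
    the direction [v], then to the derivative along [v] in the direction [w]. *)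
Lemma second_difference n (f : 'rV[R]_n -> R) (x v w : 'rV[R]_n) (r s : R) :
  0 < s -> s * (`|v| + `|w|) < r ->
  (forall y, ball x r y ->
     differentiable f y /\ differentiable (fun z => 'd f z v) y) ->
  exists2 y, ball x r y &
    f (x + s *: v + s *: w) - f (x + s *: v) - (f (x + s *: w) - f x)
      = s * s * 'd (fun z => 'd f z v) y w.
Proof.
move=> s0 sr fd.
have inball (a b : R) : 0 <= a <= 1 -> 0 <= b <= 1 ->
    ball x r (x + a *: (s *: v) + b *: (s *: w)).
  move=> /andP[a0 a1] /andP[b0 b1]; rewrite -ball_normE /=.
  rewrite -addrA opprD addrA subrr add0r normrN.
  apply: le_lt_trans sr; apply: le_trans (ler_normD _ _) _.
  rewrite !normrZ (ger0_norm a0) (ger0_norm b0) (gtr0_norm s0) mulrDr.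
  by apply: lerD; rewrite mulrA; apply: ler_wpM2r => //; apply: ler_piMl => //; exact: ltW.
pose F y := f (y + s *: w) - f y.
have shd y : ball x r (y + s *: w) ->
    is_diff y (fun y => f (y + s *: w)) ('d f (y + s *: w)).
  move=> yr; have dl : is_diff y (fun y : 'rV[R]_n => y + s *: w) id.
    have := is_diffD (is_diff_id y) (is_diff_cst (s *: w) y).
    by rewrite addr0.
  have [dfy _] := fd _ yr; have := differentiableP dfy.
  exact: (@is_diff_comp _ _ _ _ (fun y : 'rV[R]_n => y + s *: w) id f).
have b0 : ((0 : R) <= (0 : R) <= (1 : R)) by apply/andP; split.
have b1 : ((0 : R) <= (1 : R) <= (1 : R)) by apply/andP; split.
have Fd (t : R) : 0 <= t <= 1 -> is_diff (x + t *: (s *: v)) F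
    (fun z => 'd f (x + t *: (s *: v) + s *: w) z - 'd f (x + t *: (s *: v)) z).
  move=> t01; apply: is_diffB.
    by apply: shd; have := inball _ _ t01 b1; rewrite scale1r.
  apply: differentiableP; have := inball _ _ t01 b0; rewrite scale0r addr0.
  by move=> /fd [].
have [t t01|c c01 FE] := @mvt_line R n F x (s *: v).
  by have [] := is_diffE (Fd t t01).
have c01' : 0 <= c <= 1 by case/andP: c01 => *; rewrite !ltW.
have [_ dFE] := is_diffE (Fd c c01').
pose y := x + c *: (s *: v).
have [t t01|c' c'01 gE] := @mvt_line R n (fun z => 'd f z v) y (s *: w).
  by have /fd [] := inball _ _ c01' t01.
have c'01' : 0 <= c' <= 1 by case/andP: c'01 => *; rewrite !ltW.
exists (y + c' *: (s *: w)); first exact: inball.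
transitivity ('d f (y + s *: w) (s *: v) - 'd f y (s *: v)).
  exact: (etrans FE (dFE _)).
transitivity (s * ('d f (y + s *: w) v - 'd f y v)).
  by rewrite mulrBr; congr (_ - _); exact: diff_Z.
rewrite -[RHS]mulrA; congr (s * _); apply: (etrans gE); exact: diff_Z.
Qed.

(** The second difference is symmetric in [v] and [w], so both mixed derivatives
    take a common value at points close to [x]; continuity makes them equal at
    [x]. *)
Lemma schwarzR n (f : 'rV[R]_n -> R) x v w : Ck_at 2 f x ->
  'd (fun y => 'd f y v) x w = 'd (fun y => 'd f y w) x v.
Proof.
move=> [df dC]; have [dv dvC] := dC v; have [dw dwC] := dC w.
have cv := nbhs_singleton (dvC w); have cw := nbhs_singleton (dwC v).
apply/eqP; rewrite -subr_eq0 -normr_le0; apply/ler_addgt0Pr => e e0.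
rewrite add0r.
have e2 : 0 < e / 2 by rewrite divr_gt0.
have key (A B C D : R) : `|A - C| < e / 2 -> `|B - D| < e / 2 -> C = D ->
    `|A - B| <= e.
  move=> AC BD CD; rewrite (splitr e); apply: le_trans (ler_distD C _ _) _.
  by apply: lerD; [exact: ltW|rewrite CD distrC ltW].
have /nbhs_ballP [r /= r0 rP] : \forall y \near x,
    [/\ differentiable f y /\ differentiable (fun z => 'd f z v) y,
        differentiable (fun z => 'd f z w) y,
        `|'d (fun y => 'd f y v) x w - 'd (fun y => 'd f y v) y w| < e / 2 &
        `|'d (fun y => 'd f y w) x v - 'd (fun y => 'd f y w) y v| < e / 2].
  near=> y; split; first split; near: y => //.
    by move/cvgrPdist_lt : cv => /(_ _ e2).
  by move/cvgrPdist_lt : cw => /(_ _ e2).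
(* The step is small enough for the whole parallelogram to stay in the ball. *)
pose s := r / (`|v| + `|w| + 1) / 2.
have D0 : 0 < `|v| + `|w| + 1 by rewrite ltr_wpDl // addr_ge0.
have s0 : 0 < s by rewrite !divr_gt0.
have sr : s * (`|v| + `|w|) < r.
  rewrite /s mulrAC ltr_pdivrMr // mulrAC ltr_pdivrMr //.
  rewrite -mulrA ltr_pM2l //.
  by have := normr_ge0 v; have := normr_ge0 w; lra.
have [|y1 y1r E1] := @second_difference _ f x v w r s s0 sr.
  by move=> y /rP [].
have [||y2 y2r E2] := @second_difference _ f x w v r s s0.
- by rewrite addrC.
- by move=> y /rP [[]].
have ss0 : s * s != 0 by rewrite mulf_neq0 // gt_eqF.
have /(mulfI ss0) EE : s * s * 'd (fun z => 'd f z v) y1 w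
    = s * s * 'd (fun z => 'd f z w) y2 v.
  rewrite -E1 -E2 [x + s *: w + _]addrAC.
  by rewrite !opprB !addrA; ring.
have [_ _ h1 _] := rP _ y1r; have [_ _ _ h2] := rP _ y2r.
exact: key h1 h2 EE.
Unshelve. all: by end_near. Qed.

Lemma schwarz n m (f : 'rV[R]_n -> 'rV[R]_m) x v w : smooth_at f x ->
  'd (fun y => 'd f y v) x w = 'd (fun y => 'd f y w) x v.
Proof.
move=> fs; apply/rowP => j.
have fj : Ck_at 2 (fun y => f y 0 j) x by apply: (smooth_coord _ _).1.
have H u u' : ('d (fun y => 'd f y u) x u') 0 j
    = 'd (fun y => 'd (fun z => f z 0 j) y u) x u'.
  have du := smooth_diff (smooth_deriv u fs).
  have df := smooth_near_diff fs.
  have E : {near x, (fun y => ('d f y u) 0 j)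
      =1 (fun y => 'd (fun z => f z 0 j) y u)}.
    by apply: filterS df => y dfy; rewrite diff_coord.
  have [|_ dE] := near_eq_differentiable E.
    exact: smooth_diff ((smooth_coord _ _).1 (smooth_deriv u fs) j).
  exact: etrans (esym (diff_coord _ _ du)) (esym (dE u')).
exact: etrans (H v w) (etrans (schwarzR _ _ fj) (esym (H w v))).
Qed.
End Schwarz.

(** * The inverse function theorem *)

(** The fixed point theorem is applied in the space of row vectors. *)
HB.instance Definition _ (R : realType) (m n : nat) := Complete.on 'M[R]_(m, n).

Section InverseFunction.
Variable R : realType.

Lemma mulmx_bound n m (P : 'M[R]_(n, m)) :
  exists2 C, 0 < C & forall v : 'rV[R]_n, `|v *m P| <= C * `|v|.
Proof.
exact: (linear_lipschitz (@continuous_linear_rV R n _ (mulmxr P))).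
Qed.

Lemma smooth_jacobian n m (g : 'rV[R]_n -> 'rV[R]_m) x :
  smooth_at g x -> smooth_mx x (fun y => 'J g y).
Proof.
move=> gs i j; under [X in smooth_at X]eq_fun do rewrite mxE.
exact: (smooth_coord _ _).1 (smooth_deriv _ gs) j.
Qed.

Lemma jacobianE n m (g : 'rV[R]_n -> 'rV[R]_m) x v : 'd g x v = v *m 'J g x.
Proof. by rewrite mul_rV_lin1. Qed.

Lemma jacobian_invK n (g : 'rV[R]_n -> 'rV[R]_n) x v :
  'J g x \in unitmx -> 'd g x v *m invmx ('J g x) = v.
Proof. by move=> Jx; rewrite jacobianE -mulmxA mulmxV ?mulmx1. Qed.

(** Solving [f a = y] amounts to finding a fixed point of [a |-> a - f a + y],
    which is a contraction of the closed ball by the hypothesis on [f]. *)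
Lemma near_id_onto n (f : 'rV[R]_n -> 'rV[R]_n) x r y : 0 < r ->
  (forall a b, closed_ball x r a -> closed_ball x r b ->
     `|f a - f b - (a - b)| <= 2^-1 * `|a - b|) ->
  `|y - f x| <= r / 2 -> exists2 a, closed_ball x r a & f a = y.
Proof.
move=> r0 fC yx.
have cb a : closed_ball x r a <-> `|x - a| <= r.
  by rewrite closed_ballE.
pose T a := a - f a + y.
have Tfun a : closed_ball x r a -> closed_ball x r (T a).
  move=> /[dup] xa' /cb xa; apply/cb; rewrite distrC.
  have -> : T a - x = - (f a - f x - (a - x)) + (y - f x).
    by apply/rowP => j; rewrite !mxE; ring.
  apply: le_trans (ler_normD _ _) _; rewrite normrN (splitr r).
  apply: lerD => //; apply: le_trans (fC _ _ xa' _) _.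
    by apply/cb; rewrite subrr normr0 ltW.
  by rewrite [2^-1 * _]mulrC ler_pM2r ?invr_gt0 // distrC.
pose TM := isFun.Build _ _ _ _ T Tfun.
pose TT : {fun closed_ball x r >-> closed_ball x r} := HB.pack T TM.
have [|||a xa aT] := @banach_fixed_point R 'rV[R]_n (closed_ball x r) TT.
- have h : 0 <= 2^-1 :> R by rewrite invr_ge0.
  exists (NngNum h); split; first by rewrite /= invf_lt1 // ltr1n.
  move=> [a b] /= [xa xb].
  have -> : T a - T b = - (f a - f b - (a - b)).
    by apply/rowP => j; rewrite !mxE; ring.
  by rewrite normrN; exact: fC.
- exact: closed_ball_closed.
- by exists x; apply/cb; rewrite subrr normr0 ltW.
exists a => //; move: aT; rewrite /= /T => /eqP.
by rewrite -[X in X == _]addr0 -addrA (inj_eq (addrI a)) eq_sym addrC subr_eq0 => /eqP.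
Qed.

(** After composition with the inverse of the Jacobian at [x0], the map is close
    to the identity in the sense of [strict_diff]; hence it is injective with a
    Lipschitz inverse, and open by [near_id_onto]. The inverse [k] is then
    differentiable with derivative the inverse of the Jacobian at [k y], and this
    formula gives smoothness of [k] by induction on the order. *)
Theorem inverse_function n (g : 'rV[R]_n -> 'rV[R]_n) U x0 :
  open U -> U x0 -> smooth_on U g -> 'J g x0 \in unitmx ->
  exists V k, [/\ open V, V x0, V `<=` U,
    forall W, open W -> W `<=` V -> open (g @` W) &
    (forall x, V x -> k (g x) = x) /\ smooth_on (g @` V) k].
Proof.
move=> Uo Ux0 /(smooth_onP _ Uo) gs J0.
pose P := invmx ('J g x0).
have Js := smooth_jacobian (gs x0 Ux0).
have h2 : (0 : R) < 2^-1 by rewrite invr_gt0.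
pose f y := g y *m P.
have fs : smooth_at f x0.
  exact: (smooth_comp (smooth_linear (g x0) (mulmxr P)) (gs x0 Ux0)).
have fd v : 'd f x0 v = v.
  have dg := smooth_diff (gs x0 Ux0).
  have Lc := @continuous_linear_rV R n _ (mulmxr P).
  have [_ ->] := is_diffE (@is_diff_comp _ _ _ _ _ _ (mulmxr P) (mulmxr P) x0
    (differentiableP dg) (@DiffDef _ _ _ _ _ _ _ (linear_differentiable _ Lc)
       (diff_lin _ Lc))).
  by rewrite /= jacobianE -mulmxA mulmxV // mulmx1.
have [r r0 fr] := strict_diff h2 (fs 1%N).
have d0 : \det ('J g x0) != 0 by rewrite -unitfE -unitmxE.
have Junit : \forall y \near x0, \det ('J g y) != 0.
  by have /smooth_continuous/cvgr_neq0 := smooth_det Js; exact.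
have [V [Vo Vx0 VU VJ Vr]] : exists V, [/\ open V, V x0, V `<=` U,
    forall y, V y -> 'J g y \in unitmx & V `<=` ball x0 r].
  exists (U `&` [set y | \det ('J g y) != 0]^° `&` (ball x0 r)^°); split.
  - by do 2?[apply: openI => //]; exact: open_interior.
  - by split; [split|exact: nbhsx_ballx].
  - by move=> y [[]].
  - by move=> y [[_ /interior_subset]]; rewrite unitmxE unitfE.
  - by move=> y [_ /interior_subset].
(* The map [f] is [g] normalized to have derivative the identity at [x0]. *)
have fV a b : V a -> V b -> `|f a - f b - (a - b)| <= 2^-1 * `|a - b|.
  by move=> /Vr xa /Vr xb; have := fr _ _ xa xb; rewrite fd.
have lip a b : V a -> V b -> `|a - b| <= 2 * `|f a - f b|.
  move=> Va Vb; have := fV _ _ Va Vb.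
  have : `|a - b| <= `|f a - f b - (a - b)| + `|f a - f b|.
    have := ler_normB (f a - f b - (a - b)) (f a - f b).
    by rewrite addrAC subrr add0r normrN.
  lra.
have [C C0 CP] := mulmx_bound P.
have lipg a b : V a -> V b -> `|a - b| <= 2 * C * `|g a - g b|.
  move=> Va Vb; apply: le_trans (lip _ _ Va Vb) _; rewrite -mulrA ler_pM2l //.
  by rewrite /f -mulmxBl; exact: CP.
have ginj a b : V a -> V b -> g a = g b -> a = b.
  move=> Va Vb E; have := lipg _ _ Va Vb; rewrite E subrr normr0 mulr0 normr_le0.
  by rewrite subr_eq0 => /eqP.
have gopen W : open W -> W `<=` V -> open (g @` W).
  move=> Wo WV; rewrite openE => _ [x Wx <-].
  have /nbhs_closedballP[e eW] : nbhs x W by exact: open_nbhs_nbhs.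
  have e2 : 0 < e%:num / 2 by [].
  have : nbhs (g x) [set y | `|y *m P - f x| < e%:num / 2].
    have := @continuous_linear_rV R n _ (mulmxr P) (g x).
    by move=> /cvgrPdist_lt /(_ _ e2); apply: filterS => y; rewrite distrC.
  apply: filterS => y /ltW yx.
  have [||a xa fa] := @near_id_onto _ f x e%:num (y *m P) _ _ yx => //.
    by move=> a b /eW/WV Va /eW/WV Vb; exact: fV.
  exists a; first exact: eW.
  have := congr1 (mulmx^~ ('J g x0)) fa.
  by rewrite /f -!mulmxA mulVmx // !mulmx1.
pose k y := choose_or 0 [set x | V x /\ g x = y].
have kP y : (g @` V) y -> V (k y) /\ g (k y) = y.
  rewrite /k /choose_or => -[x Vx gx]; case: pselect => [h|[]].
    exact: projT2 (cid h).
  by exists x.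
have kg x : V x -> k (g x) = x.
  move=> Vx; have [|Vk gk] := kP (g x); first by exists x.
  exact: ginj.
have gVo : open (g @` V) by exact: gopen.
exists V, k; split=> //; split=> //.
have klip y z : (g @` V) y -> (g @` V) z -> `|k y - k z| <= 2 * C * `|y - z|.
  move=> /kP [Vy gy] /kP [Vz gz].
  by have := lipg _ _ Vy Vz; rewrite gy gz.
have kdiff y : (g @` V) y ->
    differentiable k y /\ forall v, 'd k y v = v *m invmx ('J g (k y)).
  move=> gVy; have [Vx gx] := kP y gVy; set x := k y in Vx gx *.
  pose Q := invmx ('J g x); have [D D0 DQ] := mulmx_bound Q.
  have Lc := @continuous_linear_rV R n _ (mulmxr Q).
  apply: is_diffE; apply/(is_diffP _ _ Lc) => e e0.
  have dg := smooth_diff (gs x (VU x Vx)).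
  have /is_diffP /(_ (e / (D * (2 * C)))) : is_diff x g ('d g x).
    exact: differentiableP.
  have De : 0 < D * (2 * C) by rewrite !mulr_gt0.
  move=> /(_ (@continuous_linear_rV R n _ _) (divr_gt0 e0 De)) H.
  have gVn : nbhs y (g @` V) by exact: open_nbhs_nbhs.
  have /nbhs_ballP [d /= dp dH] := H.
  have dC : 0 < d / (2 * C) by rewrite divr_gt0 // mulr_gt0.
  have yd : nbhs y (ball y (d / (2 * C))) by exact: nbhsx_ballx.
  apply: filterS (filterI gVn yd) => z [gVz].
  rewrite -ball_normE /= => yz; have [Vz gz] := kP z gVz.
  have xz : ball x d (k z).
    rewrite -ball_normE /=; apply: le_lt_trans (klip _ _ gVy gVz) _.
    by rewrite mulrC -ltr_pdivlMr ?mulr_gt0.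
  have := dH _ xz.
  rewrite gz gx => Hz.
  have -> : k z - x - mulmxr Q (z - y) = - ((z - y - 'd g x (k z - x)) *m Q).
    have E : 'd g x (k z - x) *m Q = k z - x.
      exact: jacobian_invK (VJ _ Vx).
    by rewrite (mulmxBl (z - y)) E opprB.
  rewrite normrN; apply: le_trans (DQ _) _.
  rewrite -ler_pdivlMl //; apply: le_trans Hz _.
  rewrite -mulrA [leRHS]mulrA [D^-1 * e]mulrC -mulrA ler_pM2l // invfM -mulrA.
  rewrite ler_pM2l ?invr_gt0 // ler_pdivrMl ?mulr_gt0 //.
  exact: klip.
(* Bootstrapping: if [k] is [C^j] so is its derivative, by the formula [kdiff]. *)
apply/(smooth_onP _ gVo) => y gVy j; elim: j y gVy => [|j IH] y gVy /=.
  apply: filterS (open_nbhs_nbhs (conj gVo gVy)) => z gVz.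
  by apply: differentiable_continuous; have [] := kdiff z gVz.
have gVn := open_nbhs_nbhs (conj gVo gVy).
split=> [|v]; first by apply: filterS gVn => z /kdiff [].
have : Ck_at j (fun z => v *m invmx ('J g (k z))) y.
  apply: (@Ck_comp _ _ _ _ _ (fun x => v *m invmx ('J g x)) k); last exact: IH.
  have [Vx gx] := kP y gVy.
  suff /smooth_rV_mx : smooth_mx (k y) (fun x => v *m invmx ('J g x)) by exact.
  apply: smooth_mulmx; first by move=> i l; exact: smooth_cst.
  apply: smooth_invmx; first exact: VJ.
  exact: smooth_jacobian (gs _ (VU _ Vx)).
apply: near_eq_Ck; apply: filterS gVn => z /kdiff [_ dk].
exact/esym/dk.
Qed.
End InverseFunction.

(** * The lemma of Poincare *)

Section Poincare.
Variable R : realType.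

Lemma diff_sum (V : normedModType R) m (f : 'I_m -> V -> R) x v :
  (forall i, differentiable (f i) x) ->
  differentiable (fun y => \sum_i f i y) x /\
  'd (fun y => \sum_i f i y) x v = \sum_i 'd (f i) x v.
Proof.
move=> df; elim: m f df => [|m IH] f df.
  have -> : (fun y : V => \sum_(i < 0) f i y) = cst 0.
    by apply/funext => y; rewrite big_ord0.
  by split; [exact: differentiable_cst|rewrite diff_cst big_ord0].
have -> : (fun y : V => \sum_(i < m.+1) f i y) =
    f ord0 + (fun y => \sum_(i < m) f (lift ord0 i) y).
  by apply/funext => y; rewrite big_ord_recl.
have [d1 d2] := IH (fun i => f (lift ord0 i)) (fun i => df _).
split; first exact: differentiableD.
by rewrite big_ord_recl -d2 diffD.
Qed.

Lemma diff_mul (V : normedModType R) (f g : V -> R) x v :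
  differentiable f x -> differentiable g x ->
  differentiable (fun y => f y * g y) x /\
  'd (fun y => f y * g y) x v = f x * 'd g x v + g x * 'd f x v.
Proof.
move=> df dg; split; first exact: differentiableM.
by have /(congr1 (fun F => F v)) := diffM df dg.
Qed.

Lemma is_derive_line n m (f : 'rV[R]_n -> 'rV[R]_m) (x h : 'rV[R]_n) (s : R) :
  differentiable f (x + s *: h) -> forall j,
  is_derive s 1 (fun t : R => f (x + t *: h) 0 j) (('d f (x + s *: h) h) 0 j).
Proof.
move=> df j.
have dl : is_diff s (fun t : R => x + t *: h) ( *:%R ^~ h).
  have := is_diffD (is_diff_cst x s) (is_diff_scalel s h).
  by rewrite add0r.
have dj : differentiable (fun y => f y 0 j) (x + s *: h).
  apply: (@differentiable_comp _ _ _ _ f (fun v : 'rV[R]_m => v 0 j)) => //.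
  exact: differentiable_coord.
have [d dE] := is_diffE (@is_diff_comp _ _ _ _ (fun t : R => x + t *: h) _
  (fun y => f y 0 j) _ s dl (differentiableP dj)).
apply: DeriveDef; first exact: diff_derivable.
rewrite deriveE //; apply: (etrans (dE 1)).
by rewrite /= scale1r diff_coord.
Qed.

(** On each interval the mean value theorem writes the increment of [f] as a value
    of [df], which differs from the value at the left end by at most [K] times
    the mesh. *)
Lemma riemann_sum_bound (f df : R -> R) (K : R) N :
  (forall s : R, 0 <= s <= 1 -> is_derive s 1 f (df s)) ->
  (forall a c : R, 0 <= a -> a <= c -> c <= 1 -> `|df c - df a| <= K * (c - a)) ->
  `|\sum_(k < N.+1) N.+1%:R^-1 * df (k%:R / N.+1%:R) - (f 1 - f 0)|
     <= K / N.+1%:R.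
Proof.
move=> fd dfK; set M : R := N.+1%:R; have M0 : 0 < M by rewrite ltr0n.
have K0 : 0 <= K.
  have := dfK 0 1 (lexx _) ler01 (lexx _); rewrite subr0 mulr1.
  exact: le_trans.
have -> : f 1 - f 0 = \sum_(k < N.+1) (f (k.+1%:R / M) - f (k%:R / M)).
  rewrite -(big_mkord xpredT (fun k => f (k.+1%:R / M) - f (k%:R / M))).
  by rewrite (telescope_sumr (fun k => f (k%:R / M))) // mul0r divff ?gt_eqF.
rewrite -sumrB; apply: le_trans (ler_norm_sum _ _ _) _.
apply: (@le_trans _ _ (\sum_(k < N.+1) K / M / M)); last first.
  by rewrite sumr_const card_ord -mulr_natr mulfVK // gt_eqF.
apply: ler_sum => k _; set a := _ / M; set b := _ / M.
have ab : a < b by rewrite ltr_pM2r ?invr_gt0 // ltr_nat.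
have a0 : 0 <= a by rewrite divr_ge0 // ltW.
have b1 : b <= 1 by rewrite ler_pdivrMr // mul1r ler_nat.
have baM : b - a = M^-1 by rewrite -mulrBl -natrB // subSnn mul1r.
have [||c] := @MVT R f df a b ab.
- move=> t; rewrite in_itv /= => /andP[at_ tb]; apply: fd.
  by rewrite (le_trans a0 (ltW at_)) (le_trans (ltW tb) b1).
- apply: derivable_within_continuous => t; rewrite in_itv /= => /andP[at_ tb].
  have [|//] := fd t; by rewrite (le_trans a0 at_) (le_trans tb b1).
rewrite in_itv /= => /andP[ac cb] ->; rewrite baM mulrC -mulrBl normrM.
rewrite (gtr0_norm (x := M^-1)) ?invr_gt0 // ler_pM2r ?invr_gt0 //.
rewrite distrC; apply: le_trans (dfK _ _ a0 (ltW ac) (ltW (lt_le_trans cb b1))) _.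
by apply: ler_wpM2l => //; rewrite -baM lerD2r ltW.
Qed.

(** A one-form on [R^n] is written as a map [w] to row vectors, acting by [dotv]. *)
Definition dotv n (a b : 'rV[R]_n) : R := \sum_j a 0 j * b 0 j.

Lemma dotv_le n (a b : 'rV[R]_n) : `|dotv a b| <= n%:R * (`|a| * `|b|).
Proof.
apply: le_trans (ler_norm_sum _ _ _) _.
apply: (@le_trans _ _ (\sum_(j < n) `|a| * `|b|)).
  by apply: ler_sum => j _; rewrite normrM; apply: ler_pM => //; exact: rV_coord_le.
by rewrite big_const_ord iter_addr_0 mulr_natl lexx.
Qed.

Lemma dotvBl n (a b c : 'rV[R]_n) : dotv (a - b) c = dotv a c - dotv b c.
Proof. by rewrite /dotv -sumrB; apply: eq_bigr => j _; rewrite !mxE mulrBl. Qed.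

Lemma nbhs_setI (T : topologicalType) (x : T) (A B : set T) :
  nbhs x A -> nbhs x B -> nbhs x (A `&` B).
Proof. exact: filterI. Qed.

Lemma local_lipschitz n m (f : 'rV[R]_n -> 'rV[R]_m) x : Ck_at 1 f x ->
  exists K r, [/\ 0 < K, 0 < r &
    forall y z, ball x r y -> ball x r z -> `|f y - f z| <= K * `|y - z|].
Proof.
move=> f1; have [r r0 fr] := strict_diff ltr01 f1.
have [C C0 CP] := linear_lipschitz (@continuous_linear_rV R n _ ('d f x)).
exists (C + 1), r; split=> //; first by rewrite addr_gt0.
move=> y z yx zx; have := fr y z yx zx; have := CP (y - z).
have := ler_normD (f y - f z - 'd f x (y - z)) ('d f x (y - z)).
by rewrite addrNK; lra.
Qed.

Lemma dotvDl n (a b c : 'rV[R]_n) : dotv (a + b) c = dotv a c + dotv b c.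
Proof. by rewrite /dotv -big_split; apply: eq_bigr => j _; rewrite !mxE mulrDl. Qed.

Lemma dotvZl n k (a c : 'rV[R]_n) : dotv (k *: a) c = k * dotv a c.
Proof. by rewrite /dotv mulr_sumr; apply: eq_bigr => j _; rewrite !mxE mulrA. Qed.

Lemma dotv_suml n m (a : 'I_m -> 'rV[R]_n) c :
  dotv (\sum_k a k) c = \sum_k dotv (a k) c.
Proof.
rewrite /dotv exchange_big /=; apply: eq_bigr => j _.
by rewrite summxE mulr_suml.
Qed.

Lemma dotvC n (a b : 'rV[R]_n) : dotv a b = dotv b a.
Proof. by apply: eq_bigr => j _; rewrite mulrC. Qed.

Lemma diff_Zj n m (f : 'rV[R]_n -> 'rV[R]_m) x a v j :
  ('d f x (a *: v)) 0 j = a * ('d f x v) 0 j.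
Proof. by rewrite diff_Z mxE. Qed.

(** The derivative of the radial integrand [dotv (w (x0 + s h)) h], with
    [h = x - x0]. Closedness of [w] turns it into the derivative of
    [s |-> s w (x0 + s h)], whose integral from 0 to 1 is [w x]. *)
Lemma radial_diff n (w : 'rV[R]_n -> 'rV[R]_n) (x0 x : 'rV[R]_n) (s : R) :
  let xs := x0 + s *: (x - x0) in
  differentiable w xs ->
  (forall u v, dotv ('d w xs u) v = dotv ('d w xs v) u) ->
  let T y := dotv (w (x0 + s *: (y - x0))) (y - x0) in
  differentiable T x /\
  forall v, 'd T x v = dotv (w xs + s *: 'd w xs (x - x0)) v.
Proof.
move=> xs dw sym T.
pose B j (y : 'rV[R]_n) : R := (y - x0) 0 j.
pose A j (y : 'rV[R]_n) : R := w (x0 + s *: (y - x0)) 0 j.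
have dsh : is_diff x (fun y : 'rV[R]_n => y - x0) id.
  by have := is_diffB (is_diff_id x) (is_diff_cst x0 x); rewrite subr0.
have daff : is_diff x (fun y : 'rV[R]_n => x0 + s *: (y - x0)) ( *:%R s).
  have := is_diffD (is_diff_cst x0 x) (is_diffZ s dsh).
  by rewrite add0r.
have dB j v : differentiable (B j) x /\ 'd (B j) x v = v 0 j.
  have [dd dE] := is_diffE dsh.
  split; last by rewrite diff_coord // dE.
  apply: (@differentiable_comp _ _ _ _ (fun y : 'rV[R]_n => y - x0)
    (fun v : 'rV[R]_n => v 0 j)) => //.
  exact: differentiable_coord.
have [dcomp cE] := is_diffE (@is_diff_comp _ _ _ _
  (fun y : 'rV[R]_n => x0 + s *: (y - x0)) _ w _ x daff (differentiableP dw)).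
have dA j v : differentiable (A j) x /\ 'd (A j) x v = s * ('d w xs v) 0 j.
  have dcomp' : differentiable (fun y => w (x0 + s *: (y - x0))) x by [].
  split; last first.
    have cE' : 'd (fun y => w (x0 + s *: (y - x0))) x v = 'd w xs (s *: v) := cE v.
    exact: etrans (diff_coord v j dcomp') (etrans (congr1 (fun u : 'rV[R]_n => u 0 j) cE')
      (diff_Zj _ _ _ _ _)).
  apply: (@differentiable_comp _ _ _ _ (fun y : 'rV[R]_n => w (x0 + s *: (y - x0)))
    (fun v : 'rV[R]_n => v 0 j)) => //.
  exact: differentiable_coord.
have dAB j v : differentiable (fun y => A j y * B j y) x /\
    'd (fun y => A j y * B j y) x v =
      w xs 0 j * v 0 j + (x - x0) 0 j * (s * ('d w xs v) 0 j).
  have [da daE] := dA j v; have [db dbE] := dB j v.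
  have [dm dmE] := diff_mul v da db; split=> //.
  by apply: (etrans dmE); congr (_ * _ + _ * _).
have dT v := diff_sum v (fun j => (dAB j v).1).
split=> [|v]; first by have [] := dT 0.
apply: (etrans (dT v).2).
under eq_bigr do rewrite (dAB _ v).2.
rewrite big_split /= dotvDl; congr (_ + _).
rewrite dotvZl sym mulr_sumr; apply: eq_bigr => j _.
by rewrite mulrCA [(x - x0) 0 j * _]mulrC.
Qed.

Section RiemannSums.
Variables (n : nat) (w : 'rV[R]_n -> 'rV[R]_n) (x0 : 'rV[R]_n) (r K : R).
Hypotheses (r0 : 0 < r) (r1 : r <= 1) (K0 : 0 < K).
Hypothesis dw : forall y, ball x0 r y -> differentiable w y.
Hypothesis sym : forall y u v, ball x0 r y ->
  dotv ('d w y u) v = dotv ('d w y v) u.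
Hypothesis lipw : forall y z, ball x0 r y -> ball x0 r z ->
  `|w y - w z| <= K * `|y - z|.
Hypothesis bdw : forall y v, ball x0 r y -> `|'d w y v| <= K * `|v|.
Hypothesis lipdw : forall y z v, ball x0 r y -> ball x0 r z ->
  `|'d w y v - 'd w z v| <= K * `|v| * `|y - z|.

Let T (s : R) (x : 'rV[R]_n) := dotv (w (x0 + s *: (x - x0))) (x - x0).
(** Riemann sums of the primitive [x |-> \int_0^1 w (x0 + s (x - x0)) (x - x0) ds].
    Working with the sums avoids differentiating an integral depending on a
    parameter: each sum is differentiable, and its derivative is within [O(1/N)]
    of [w] by [riemann_sum_bound]. *)
Let G (N : nat) (x : 'rV[R]_n) : R :=
  \sum_(k < N.+1) N.+1%:R^-1 * T (k%:R / N.+1%:R) x.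

Let ray x (s : R) : ball x0 r x -> 0 <= s <= 1 -> ball x0 r (x0 + s *: (x - x0)).
Proof. by move=> xr s01; apply: ball_segment => //; exact: ballxx. Qed.

Let frac01 N (k : 'I_N.+1) : 0 <= (k%:R / N.+1%:R : R) <= 1.
Proof.
rewrite divr_ge0 //= ler_pdivrMr ?ltr0n // mul1r ler_nat.
by apply: ltnW; exact: ltn_ord.
Qed.

(** The derivative of [G N] is a Riemann sum for the derivative of
    [s |-> s w (x0 + s h)]; the constant [3 K] is a Lipschitz constant of the
    latter, with one [K] for each term of the product rule. *)
Let G_diff N x v : ball x0 r x -> differentiable (G N) x /\
  `|'d (G N) x v - dotv (w x) v| <= n%:R * (3 * K) / N.+1%:R * `|v|.
Proof.
move=> xr; pose h := x - x0; pose S (k : 'I_N.+1) : R := k%:R / N.+1%:R.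
pose grad s := w (x0 + s *: h) + s *: 'd w (x0 + s *: h) h.
have h1 : `|h| <= 1.
  by rewrite distrC; apply: le_trans r1; apply: ltW; move: xr; rewrite -ball_normE.
have dT (k : 'I_N.+1) : differentiable (T (S k)) x /\
    forall u, 'd (T (S k)) x u = dotv (grad (S k)) u.
  have xsr := ray xr (frac01 k).
  by apply: radial_diff => [|u u']; [exact: dw|exact: sym].
have dcT (k : 'I_N.+1) u : differentiable (fun y => N.+1%:R^-1 * T (S k) y) x /\
    'd (fun y => N.+1%:R^-1 * T (S k) y) x u = N.+1%:R^-1 * dotv (grad (S k)) u.
  have [d dE] := dT k; have [d' dE'] := is_diffE (is_diffZ N.+1%:R^-1 (differentiableP d)).
  split=> //; apply: etrans (dE' u) _.
  by rewrite -dE.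
have [dG dGE] := diff_sum v (fun k => (dcT k v).1).
split=> //.
have -> : 'd (G N) x v = dotv (\sum_(k < N.+1) N.+1%:R^-1 *: grad (S k)) v.
  apply: (etrans dGE); under eq_bigr do rewrite (dcT _ v).2.
  by rewrite dotv_suml; apply: eq_bigr => k _; rewrite dotvZl.
rewrite -dotvBl; apply: le_trans (dotv_le _ _) _.
rewrite -[leRHS]mulrA -mulrA ler_wpM2l // mulrA ler_wpM2r // .
apply: rV_norm_le => [|j]; first by rewrite divr_ge0 // mulr_ge0 // ltW.
have fd (s : R) : 0 <= s <= 1 ->
    is_derive s 1 (fun t : R => t * (w (x0 + t *: h)) 0 j) (grad s 0 j).
  move=> s01; have D := is_derive_line (dw (ray xr s01)) j.
  have -> : grad s 0 j = s * ('d w (x0 + s *: h) h) 0 j + w (x0 + s *: h) 0 j * 1.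
    by rewrite /grad !mxE mulr1 addrC.
  exact: (is_deriveM (is_derive_id s 1) D).
have := @riemann_sum_bound _ (fun s => grad s 0 j) (3 * K) N fd.
rewrite mul1r mul0r subr0 scale1r subrKC !mxE summxE.
under [in X in _ -> X]eq_bigr do rewrite mxE.
apply => a c a0 ac c1.
have a01 : 0 <= a <= 1 by rewrite a0 (le_trans ac c1).
have c01 : 0 <= c <= 1 by rewrite (le_trans a0 ac).
have ar := ray xr a01; have cr := ray xr c01.
have xac : `|(x0 + c *: h) - (x0 + a *: h)| <= c - a.
  rewrite opprD addrACA subrr add0r -scalerBl normrZ ger0_norm ?subr_ge0 //.
  by apply: ler_piMr => //; rewrite subr_ge0.
have gen (A B C D : 'rV[R]_n) : (A + c *: C) 0 j - (B + a *: D) 0 j =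
    (A - B) 0 j + (c - a) * C 0 j + a * (C - D) 0 j.
  by rewrite !mxE; ring.
have -> : grad c 0 j - grad a 0 j =
    (w (x0 + c *: h) - w (x0 + a *: h)) 0 j + (c - a) * ('d w (x0 + c *: h) h) 0 j
    + a * ('d w (x0 + c *: h) h - 'd w (x0 + a *: h) h) 0 j.
  exact: gen.
have E1 : `|(w (x0 + c *: h) - w (x0 + a *: h)) 0 j| <= K * (c - a).
  apply: le_trans (rV_coord_le _ _) _; apply: le_trans (lipw cr ar) _.
  by rewrite ler_pM2l.
have E2 : `|(c - a) * ('d w (x0 + c *: h) h) 0 j| <= K * (c - a).
  rewrite normrM ger0_norm ?subr_ge0 // mulrC ler_wpM2r ?subr_ge0 //.
  apply: le_trans (rV_coord_le _ _) _; apply: le_trans (bdw _ cr) _.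
  by rewrite ler_piMr // ltW.
have E3 : `|a * ('d w (x0 + c *: h) h - 'd w (x0 + a *: h) h) 0 j| <= K * (c - a).
  rewrite normrM ger0_norm //; apply: le_trans (_ : 1 * (K * (c - a)) <= _); last first.
    by rewrite mul1r.
  apply: ler_pM => //; first by case/andP: a01.
  apply: le_trans (rV_coord_le _ _) _; apply: le_trans (lipdw _ cr ar) _.
  apply: ler_pM => //; first by rewrite mulr_ge0 // ltW.
  by rewrite ler_piMr // ltW.
apply: le_trans (ler_normD _ _) _; apply: le_trans (lerD (ler_normD _ _) (lexx _)) _.
lra.
Qed.

Let C : R := n%:R * (3 * K).

Let C0 : 0 <= C. Proof. by rewrite mulr_ge0 // mulr_ge0 // ltW. Qed.

Let G_x0 N : G N x0 = 0.
Proof.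
apply: big1 => k _; rewrite /T subrr /dotv big1 ?mulr0 // => j _.
by rewrite mxE mulr0.
Qed.

Let G_incr N x y : ball x0 r x -> ball x0 r y ->
  `|G N y - G N x - dotv (w x) (y - x)|
    <= (C / N.+1%:R + n%:R * K * `|y - x|) * `|y - x|.
Proof.
move=> xr yr.
have seg (t : R) : 0 <= t <= 1 -> ball x0 r (x + t *: (y - x)).
  exact: ball_segment.
have [t /seg tr|c c01] := @mvt_line R n (G N) x (y - x).
  by have [] := G_diff N 0 tr.
have c01' : 0 <= c <= 1 by case/andP: c01 => *; rewrite !ltW.
rewrite subrKC => ->; set z := x + _ : 'rV[R]_n.
have zr : ball x0 r z by exact: seg.
have [_ h1] := G_diff N (y - x) zr.
have h2 : `|dotv (w z) (y - x) - dotv (w x) (y - x)| <= n%:R * K * `|y - x| * `|y - x|.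
  rewrite -dotvBl; apply: le_trans (dotv_le _ _) _; rewrite mulrA ler_wpM2r //.
  rewrite -mulrA ler_wpM2l //; apply: le_trans (lipw zr xr) _.
  rewrite ler_pM2l // /z addrAC subrr add0r normrZ.
  by case/andP: c01' => c0 c1; rewrite ger0_norm // ler_piMl.
apply: le_trans (ler_distD (dotv (w z) (y - x)) _ _) _.
by rewrite mulrDl; exact: lerD.
Qed.

Let G_cauchy N M x : ball x0 r x ->
  `|G N x - G M x| <= C / N.+1%:R + C / M.+1%:R.
Proof.
move=> xr.
have seg (t : R) : 0 <= t <= 1 -> ball x0 r (x0 + t *: (x - x0)).
  exact: ray.
have dB (z v : 'rV[R]_n) : ball x0 r z -> differentiable (fun y => G N y - G M y) z /\
    'd (fun y => G N y - G M y) z v = 'd (G N) z v - 'd (G M) z v.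
  move=> zr; have [d1 _] := G_diff N v zr; have [d2 _] := G_diff M v zr.
  split; first exact: differentiableB.
  by have /(congr1 (fun F => F v)) := diffB d1 d2.
have [t /seg tr|c c01] := @mvt_line R n (fun y => G N y - G M y) x0 (x - x0).
  by have [] := dB _ 0 tr.
have c01' : 0 <= c <= 1 by case/andP: c01 => *; rewrite !ltW.
have zr := seg c c01'.
rewrite subrKC !G_x0 subrr subr0 => ->.
have [_ dE] := dB _ (x - x0) zr; rewrite [X in `|X|]dE.
have [_ h1] := G_diff N (x - x0) zr; have [_ h2] := G_diff M (x - x0) zr.
apply: le_trans (ler_distD (dotv (w (x0 + c *: (x - x0))) (x - x0)) _ _) _.
have h1' : `|x - x0| <= 1.
  by rewrite distrC; apply: le_trans r1; apply: ltW; move: xr; rewrite -ball_normE.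
apply: lerD; last rewrite distrC.
  by apply: le_trans h1 _; rewrite ler_piMr // divr_ge0.
by apply: le_trans h2 _; rewrite ler_piMr // divr_ge0.
Qed.

Let small (e : R) : 0 < e -> \forall N \near \oo, C / N.+1%:R < e.
Proof.
move=> e0; have C1 : 0 < C + 1 by rewrite ltr_wpDl.
have e1 : 0 < e / (C + 1) by rewrite divr_gt0.
have := near_infty_natSinv_lt (PosNum e1); apply: filterS => N /= h.
apply: (@le_lt_trans _ _ ((C + 1) / N.+1%:R)).
  by rewrite ler_wpM2r // ler_wpDr.
by rewrite mulrC -ltr_pdivlMr.
Qed.

Lemma primitive_of_closed_ball : exists g : 'rV[R]_n -> R,
  forall x, ball x0 r x -> differentiable g x /\ forall v, 'd g x v = dotv (w x) v.
Proof.
pose g x := lim (G N x @[N --> \oo]).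
have gP x : ball x0 r x -> G N x @[N --> \oo] --> g x.
  move=> xr; apply: cauchy_cvg; apply: cauchy_exP => e e0.
  have e2 : 0 < e / 2 by rewrite divr_gt0.
  have [N0 _ N0P] := small e2.
  exists (G N0 x); exists N0 => // N /= N0N.
  rewrite -ball_normE /=; apply: le_lt_trans (G_cauchy N0 N xr) _.
  by rewrite (splitr e); apply: ltrD; apply: N0P => /=.
have g_incr x y : ball x0 r x -> ball x0 r y ->
    `|g y - g x - dotv (w x) (y - x)| <= n%:R * K * `|y - x| * `|y - x|.
  move=> xr yr; apply/ler_addgt0Pr => e e0.
  have e3 : 0 < e / 3 by rewrite divr_gt0.
  have D0 : 0 < `|y - x| + 1 by rewrite ltr_wpDl.
  have e4 : 0 < e / 3 / (`|y - x| + 1) by rewrite divr_gt0.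
  have [N [Nx Ny NC]] : exists N, [/\ `|g x - G N x| < e / 3,
      `|g y - G N y| < e / 3 & C / N.+1%:R < e / 3 / (`|y - x| + 1)].
    near \oo => N; exists N; split; near: N; last exact: small.
      by move/cvgrPdist_lt : (gP x xr) => /(_ _ e3).
    by move/cvgrPdist_lt : (gP y yr) => /(_ _ e3).
  have H := G_incr N xr yr.
  have H2 : C / N.+1%:R * `|y - x| <= e / 3.
    apply: (@le_trans _ _ (e / 3 / (`|y - x| + 1) * `|y - x|)).
      by rewrite ler_wpM2r // ltW.
    by rewrite mulrAC ler_pdivrMr // ler_pM2l // lerDl.
  have -> : g y - g x - dotv (w x) (y - x) =
     (g y - G N y) - (g x - G N x) + (G N y - G N x - dotv (w x) (y - x)) by ring.
  apply: le_trans (ler_normD _ _) _.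
  have := ler_normB (g y - G N y) (g x - G N x).
  move: H; rewrite mulrDl; set q1 := C / _ * _ in H2 *; set q2 := _ * K * _ * _.
  by move: H2 Nx Ny; lra.
exists g => x xr.
have Ll : linear (dotv (w x)).
  by move=> k u v; rewrite ![dotv (w x) _]dotvC dotvDl dotvZl.
pose LM := GRing.isLinear.Build _ _ _ _ _ Ll.
pose L : {linear 'rV[R]_n -> R} := HB.pack (dotv (w x)) LM.
have Lc := @continuous_linear_rV R n _ L.
apply: (@is_diffE _ _ _ g x L); apply/(is_diffP _ _ Lc) => e e0.
have xr' : nbhs x (ball x0 r).
  by apply: open_nbhs_nbhs; split=> //; exact: ball_open.
have M0 : 0 < n%:R * K + 1 by rewrite ltr_wpDl // mulr_ge0 // ltW.
have xe : nbhs x (ball x (e / (n%:R * K + 1))).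
  by apply: nbhsx_ballx; rewrite divr_gt0.
apply: filterS (filterI xr' xe) => y [yr].
rewrite -ball_normE /= distrC => xy; apply: le_trans (g_incr _ _ xr yr) _.
rewrite ler_wpM2r //; apply: (@le_trans _ _ ((n%:R * K + 1) * `|y - x|)).
  by rewrite ler_wpM2r // lerDl.
by rewrite mulrC -ler_pdivlMr // ltW.
Unshelve. all: by end_near. Qed.
End RiemannSums.

(** The primitive is the limit of the sums [G N], which are uniformly Cauchy
    together with their derivatives. The constants [r] and [K] come from the
    Lipschitz bounds on [w] and its derivative near [x0]. *)
Theorem poincare n (w : 'rV[R]_n -> 'rV[R]_n) x0 :
  smooth_at w x0 ->
  (\forall y \near x0, forall u v, dotv ('d w y u) v = dotv ('d w y v) u) ->
  exists g : 'rV[R]_n -> R, \forall y \near x0,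
    differentiable g y /\ forall v, 'd g y v = dotv (w y) v.
Proof.
move=> ws wsym; have wd := smooth_near_diff ws.
have [K1 [r1 [K10 r10 lip1]]] := local_lipschitz (ws 1%N).
have /choice [Kr KrP] : forall j : 'I_n, exists Kr : R * R, [/\ 0 < Kr.1, 0 < Kr.2 &
    forall y z, ball x0 Kr.2 y -> ball x0 Kr.2 z ->
    `|'d w y (delta_mx 0 j) - 'd w z (delta_mx 0 j)| <= Kr.1 * `|y - z|].
  move=> j; have [K [r [? ? ?]]] := local_lipschitz (smooth_deriv (delta_mx 0 j) ws 1%N).
  by exists (K, r).
have [C C0 CP] := linear_lipschitz (@continuous_linear_rV R n _ ('d w x0)).
pose K2 := \sum_j (Kr j).1.
have K20 : 0 <= K2 by apply: sumr_ge0 => j _; apply: ltW; case: (KrP j).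
pose K := K1 + K2 + C + 1.
have K0 : 0 < K by rewrite /K; lra.
have nball (r : R) : 0 < r -> nbhs x0 (ball x0 r) by exact: nbhsx_ballx.
have H1 := nbhs_setI (nbhs_setI wd wsym) (nbhs_setI (near_diff_close ltr01 (ws 1%N)) (nball r1 r10)).
have H2 : \forall y \near x0, forall j : 'I_n, ball x0 (Kr j).2 y.
  apply: (@filter_forall _ _ (fun (j : 'I_n) y => ball x0 (Kr j).2 y) (nbhs x0)) => j.
  by apply: nball; case: (KrP j).
have /nbhs_ballP [r' /= r'0 r'P] := nbhs_setI H1 H2.
pose r := Num.min r' 1.
have r0 : 0 < r by rewrite lt_min r'0 ltr01.
have rr' y : ball x0 r y -> ball x0 r' y.
  by apply: le_ball; rewrite ge_min lexx.
have [||||||g gP] := @primitive_of_closed_ball n w x0 r K r0 _ K0.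
- by rewrite ge_min lexx orbT.
- by move=> y /rr' /r'P [[[? _] _] _].
- by move=> y u v /rr' /r'P [[[_ ?] _] _].
- move=> y z /rr' /r'P [[_ [_ yr]] _] /rr' /r'P [[_ [_ zr]] _].
  apply: le_trans (lip1 _ _ yr zr) _; rewrite ler_wpM2r // /K; lra.
- move=> y v /rr' /r'P [[_ [H _]] _].
  have := H v; have := CP v; have := ler_normD ('d w y v - 'd w x0 v) ('d w x0 v).
  rewrite addrNK mul1r => h3 h2 h1.
  apply: le_trans h3 _; apply: le_trans (lerD h1 h2) _.
  by rewrite -[X in X + _]mul1r -mulrDl ler_wpM2r // /K; lra.
- move=> y z v /rr' /r'P [_ yr] /rr' /r'P [_ zr].
  have -> : 'd w y v - 'd w z v = \sum_j v 0 j *: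
      ('d w y (delta_mx 0 j) - 'd w z (delta_mx 0 j)).
    rewrite [X in X - _ = _]linear_rV [X in _ - X = _]linear_rV -sumrB.
    by apply: eq_bigr => j _; rewrite scalerBr.
  apply: le_trans (ler_norm_sum _ _ _) _.
  apply: (@le_trans _ _ (\sum_j (Kr j).1 * (`|v| * `|y - z|))).
    apply: ler_sum => j _; rewrite normrZ mulrCA; apply: ler_pM => //.
      exact: rV_coord_le.
    by have [_ _] := KrP j; apply.
  rewrite -mulr_suml -/K2 mulrA ler_wpM2r // ler_wpM2r // /K; lra.
by exists g; apply: filterS (nball r r0).
Qed.
End Poincare.

(** * Charts and neighbourhoods *)

Section ManifoldBasics.
Variable R : realType.

(** The conditions on which calculus depends; the tangent bundle and the
    quotients by deck maps inherit them. *)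
Definition pre_manifold n (M : mspace R n) :=
  [/\ forall c, atlas M c -> valid_chart c,
      forall p : M, exists2 c, atlas M c & cdom c p &
      forall c c', atlas M c -> atlas M c' -> compatible c c'].

Lemma manifold_pre n (M : mspace R n) : is_manifold M -> pre_manifold M.
Proof. by case. Qed.

Lemma valid_near T n (c : chart R T n) p : valid_chart c -> cdom c p ->
  \forall y \near c p, cdom c (cinv c y) /\ c (cinv c y) = y.
Proof.
move=> [cK co] cp; have : nbhs (c p) (crange c).
  by apply: open_nbhs_nbhs; split=> //; exists p.
by apply: filterS => _ [q cq <-]; rewrite cK.
Qed.

Lemma compat_near T n (c c' : chart R T n) p :
  valid_chart c -> compatible c c' -> cdom c p -> cdom c' p ->
  (\forall y \near c p, cdom c' (cinv c y)) /\ smooth_at (c' \o cinv c) (c p).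
Proof.
move=> [cK co] [Uo Us] cp c'p.
have Up : (c @` (cdom c `&` cdom c')) (c p) by exists p.
split; last by apply: (smooth_onP _ Uo).1 => //; exact: Us.
apply: filterS (open_nbhs_nbhs (conj Uo Up)) => _ [q [cq c'q] <-].
by rewrite cK.
Qed.

(** The chain rule in the form in which it is used in charts: the composite is
    only equal to [h] near [x], and [f x] is only propositionally equal to the
    point [y] at which [g] is known to be smooth. *)
Lemma smooth_comp_near n m p (g : 'rV[R]_m -> 'rV[R]_p) (f : 'rV[R]_n -> 'rV[R]_m)
    (h : 'rV[R]_n -> 'rV[R]_p) x y : f x = y ->
  smooth_at g y -> smooth_at f x -> {near x, (fun z => g (f z)) =1 h} ->
  smooth_at h x /\ forall v, 'd h x v = 'd g y ('d f x v).
Proof.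
move=> <- gs fs gf; have gfs := smooth_comp gs fs.
split; first exact: near_eq_smooth gf gfs.
move=> v; have [_ E] := near_eq_differentiable gf (smooth_diff gfs).
apply: (etrans (E v)).
by have /(congr1 (fun F => F v)) := diff_comp (smooth_diff fs) (smooth_diff gs).
Qed.

Section OneManifold.
Variables (n : nat) (M : mspace R n).
Hypothesis MP : pre_manifold M.
Implicit Types (p q : M) (c a : chart R M n).

Lemma chart_atP p : atlas M (chart_at p) /\ cdom (chart_at p) p.
Proof.
rewrite /chart_at /choose_or; case: pselect => [h|[]]; first exact: projT2 (cid h).
by have [_ /(_ p) [c ? ?] _] := MP; exists c.
Qed.

Lemma atlas_coord c : atlas M c -> coord_system c.
Proof.
by have [v _ k] := MP; move=> cM; split=> [|a aM]; [exact: v|split; exact: k].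
Qed.

Lemma chart_at_coord p : coord_system (chart_at p).
Proof. by apply: atlas_coord; case: (chart_atP p). Qed.

Lemma chart_at_dom p : cdom (chart_at p) p.
Proof. by case: (chart_atP p). Qed.

Lemma coordK c p : coord_system c -> cdom c p -> cinv c (c p) = p.
Proof. by move=> [[h _] _]; exact: h. Qed.

Lemma coord_near c p : coord_system c -> cdom c p ->
  \forall y \near c p, cdom c (cinv c y) /\ c (cinv c y) = y.
Proof. by move=> [v _]; exact: valid_near. Qed.

(** Two coordinate systems are only assumed compatible with the charts of the
    atlas; their compatibility with each other goes through an atlas chart at
    the point. *)
Lemma coord_trans c c' p : coord_system c -> coord_system c' ->
  cdom c p -> cdom c' p ->
  (\forall y \near c p, cdom c' (cinv c y)) /\ smooth_at (c' \o cinv c) (c p).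
Proof.
move=> [cv cC] [c'v c'C] cp c'p.
have [aM ap] := chart_atP p; set a := chart_at p in aM ap.
have av : valid_chart a by have [h _ _] := MP; exact: h.
have [ca1 ca2] := compat_near cv (cC a aM).2 cp ap.
have [ac1 ac2] := compat_near av (c'C a aM).1 ap c'p.
have cap : (a \o cinv c) (c p) = a p by rewrite /= cv.1.
have cont := smooth_continuous ca2; rewrite /prop_for /continuous_at cap in cont.
have cont' : \forall y \near c p, cdom c' (cinv a (a (cinv c y))) by exact: cont ac1.
have eqn : \forall y \near c p, cinv a (a (cinv c y)) = cinv c y.
  by apply: filterS ca1 => y; exact: av.1.
split.
  by apply: filterS (nbhs_setI cont' eqn) => y [] + E; rewrite E.
have [|] := @smooth_comp_near _ _ _ (c' \o cinv a) (a \o cinv c) (c' \o cinv c)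
  (c p) (a p) cap ac2 ca2; last by [].
by apply: filterS eqn => y E; rewrite /= E.
Qed.

(** The filter of neighbourhoods of a point, transported from [R^n] by the
    preferred chart. By [mnbhsP] any coordinate system gives the same filter. *)
Definition mnbhs p : set_system M :=
  [set A | \forall y \near chart_at p p, A (cinv (chart_at p) y)].

#[global] Instance mnbhs_filter p : ProperFilter (mnbhs p).
Proof.
split; first by move=> /nbhs_singleton.
split=> [|A B|A B AB]; rewrite /mnbhs /=.
- exact: near_all.
- exact: nbhs_setI.
- by apply: filterS => y; exact: AB.
Qed.

Lemma mnbhsP c p (A : set M) : coord_system c -> cdom c p ->
  mnbhs p A <-> \forall y \near c p, A (cinv c y).
Proof.
move=> cc cp; have ac := chart_at_coord p; have ap := chart_at_dom p.
have key c1 c2 : coord_system c1 -> coord_system c2 -> cdom c1 p -> cdom c2 p ->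
    (\forall y \near c1 p, A (cinv c1 y)) -> \forall y \near c2 p, A (cinv c2 y).
  move=> h1 h2 d1 d2 A1; have [t1 t2] := coord_trans h2 h1 d2 d1.
  have cap : (c1 \o cinv c2) (c2 p) = c1 p by rewrite /= coordK.
  have cont := smooth_continuous t2; rewrite /prop_for /continuous_at cap in cont.
  have cont' : \forall y \near c2 p, A (cinv c1 (c1 (cinv c2 y))) by exact: cont A1.
  by apply: filterS (nbhs_setI cont' t1) => y [+ d]; rewrite (coordK h1 d).
by split; exact: key.
Qed.

Lemma mnbhs_singleton p (A : set M) : mnbhs p A -> A p.
Proof. by move=> /nbhs_singleton; rewrite (coordK (chart_at_coord p)) //; exact: chart_at_dom. Qed.

Lemma mnbhs_dom c p : coord_system c -> cdom c p -> mnbhs p (cdom c).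
Proof.
move=> cc cp; apply/(mnbhsP _ cc cp).
by apply: filterS (coord_near cc cp) => y [].
Qed.

Lemma mopenP (U : set M) : mopen U <-> forall p, U p -> mnbhs p U.
Proof.
split=> [Uo p Up|h c cM].
  have [aM ap] := chart_atP p; have := Uo _ aM; set a := chart_at p in aM ap * => o.
  have : nbhs (a p) (a @` (U `&` cdom a)).
    by apply: open_nbhs_nbhs; split=> //; exists p.
  by apply: filterS => _ [q [Uq aq] <-]; rewrite -/a (coordK (atlas_coord aM)).
rewrite openE => _ [p [Up cp] <-].
have cc := atlas_coord cM.
have H := (mnbhsP _ cc cp).1 (h p Up).
apply: filterS (nbhs_setI H (coord_near cc cp)) => y [Uy [dy yE]].
by exists (cinv c y).
Qed.

(** The set of the points of which [A] is a neighbourhood is open. *)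
Lemma mnbhs_mopen p (A : set M) : mnbhs p A -> exists U, [/\ mopen U, U p & U `<=` A].
Proof.
move=> pA; pose U := [set q | mnbhs q A]; exists U; split=> //; last first.
  by move=> q; exact: mnbhs_singleton.
apply/mopenP => q; rewrite /U /=.
have qc := chart_at_coord q; have qd := chart_at_dom q.
rewrite {1}/mnbhs /= => qA; apply/(mnbhsP _ qc qd).
have /near_join H := nbhs_setI qA (coord_near qc qd).
apply: filterS (nbhs_setI H (coord_near qc qd)) => y [Hy [dy yE]].
apply/(mnbhsP _ qc dy); rewrite yE.
by apply: filterS Hy => z [].
Qed.

Lemma mopen_dom c : coord_system c -> mopen (cdom c).
Proof. by move=> cc; apply/mopenP => p; exact: mnbhs_dom. Qed.

Lemma mopenI (U V : set M) : mopen U -> mopen V -> mopen (U `&` V).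
Proof.
move=> /mopenP Uo /mopenP Vo; apply/mopenP => p [Up Vp].
by apply: filterI; [exact: Uo|exact: Vo].
Qed.

Lemma coord_image_open c (U : set M) : coord_system c -> mopen U -> U `<=` cdom c ->
  open (c @` U).
Proof.
move=> cc /mopenP Uo Uc; rewrite openE => _ [p Up <-].
have cp := Uc _ Up; have H := (mnbhsP _ cc cp).1 (Uo p Up).
apply: filterS (nbhs_setI H (coord_near cc cp)) => y [Uy [dy yE]].
by exists (cinv c y).
Qed.

End OneManifold.
End ManifoldBasics.

(** * Smooth maps *)

Section SmoothMaps.
Variable R : realType.

(** Smoothness at one point, tested in the preferred charts. By [msmP] any
    coordinate systems can be used instead, and by [smooth_mapP] smoothness at
    every point is smoothness. *)
Definition msm n d (M : mspace R n) (M' : mspace R d) (f : M -> M') (p : M) :=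
  mnbhs p (fun q => cdom (chart_at (f p)) (f q)) /\
  smooth_at (chart_at (f p) \o f \o cinv (chart_at p)) (chart_at p p).

Lemma mnbhsE n (M : mspace R n) (p : M) (A : set M) : mnbhs p A ->
  \forall y \near chart_at p p, A (cinv (chart_at p) y).
Proof. by []. Qed.

Section TwoManifolds.
Variables (n d : nat) (M : mspace R n) (M' : mspace R d).
Hypotheses (MP : pre_manifold M) (MP' : pre_manifold M').
Implicit Types (f g : M -> M') (p q : M).

Lemma msmP c c' f p : coord_system c -> coord_system c' -> cdom c p ->
  cdom c' (f p) ->
  msm f p <-> (\forall y \near c p, cdom c' (f (cinv c y))) /\
              smooth_at (c' \o f \o cinv c) (c p).
Proof.
move=> cc cc' cp c'p.
have key c1 c2 c1' c2' : coord_system c1 -> coord_system c2 ->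
    coord_system c1' -> coord_system c2' -> cdom c1 p -> cdom c2 p ->
    cdom c1' (f p) -> cdom c2' (f p) ->
    (\forall y \near c1 p, cdom c1' (f (cinv c1 y))) /\
      smooth_at (c1' \o f \o cinv c1) (c1 p) ->
    (\forall y \near c2 p, cdom c2' (f (cinv c2 y))) /\
      smooth_at (c2' \o f \o cinv c2) (c2 p).
  move=> h1 h2 h1' h2' d1 d2 d1' d2' [f1 s1].
  have [t1 t2] := coord_trans MP h2 h1 d2 d1.
  have [u1 u2] := coord_trans MP' h1' h2' d1' d2'.
  have c1p : (c1 \o cinv c2) (c2 p) = c1 p by rewrite /= coordK.
  have c1fp : (c1' \o f \o cinv c1) (c1 p) = c1' (f p) by rewrite /= coordK.
  have cont := smooth_continuous t2; rewrite /prop_for /continuous_at c1p in cont.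
  have cont1 := smooth_continuous s1; rewrite /prop_for /continuous_at c1fp in cont1.
  have A1 : \forall y \near c2 p, cdom c1' (f (cinv c2 y)).
    have : \forall y \near c2 p, cdom c1' (f (cinv c1 (c1 (cinv c2 y)))) by exact: cont f1.
    by move=> /nbhs_setI /(_ t1); apply: filterS => y [+ dy]; rewrite (coordK h1 dy).
  have A2 : \forall y \near c2 p, cdom c2' (f (cinv c2 y)).
    have : \forall y \near c1 p, cdom c2' (cinv c1' (c1' (f (cinv c1 y)))).
      exact: cont1 u1.
    move=> /cont H; have {}H : \forall y \near c2 p,
      cdom c2' (cinv c1' (c1' (f (cinv c1 (c1 (cinv c2 y)))))) by exact: H.
    apply: filterS (nbhs_setI H (nbhs_setI t1 A1)) => y [+ [dy dfy]].
    by rewrite (coordK h1 dy) (coordK h1' dfy).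
  split=> //.
  have gs := smooth_comp (f := c1 \o cinv c2) (g := c1' \o f \o cinv c1) (x := c2 p).
  rewrite c1p in gs; have {}gs := gs s1 t2.
  have c1fp' : (c1' \o f \o cinv c1) ((c1 \o cinv c2) (c2 p)) = c1' (f p) by rewrite c1p.
  have [|] := @smooth_comp_near _ _ _ _ (c2' \o cinv c1')
    (fun y => (c1' \o f \o cinv c1) ((c1 \o cinv c2) y)) (c2' \o f \o cinv c2)
    (c2 p) (c1' (f p)) c1fp' u2 gs; last by [].
  apply: filterS (nbhs_setI t1 A1) => y [dy dfy].
  by rewrite /= (coordK h1 dy) (coordK h1' dfy).
have a1 := chart_at_coord MP p; have a2 := chart_at_dom MP p.
have a1' := chart_at_coord MP' (f p); have a2' := chart_at_dom MP' (f p).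
by split; apply: key.
Qed.

Lemma msm_continuous f p A : msm f p -> mnbhs (f p) A -> mnbhs p (fun q => A (f q)).
Proof.
move=> [f1 f2]; rewrite /mnbhs /= => H.
have a1 := chart_at_coord MP p; have a2 := chart_at_dom MP p.
have a1' := chart_at_coord MP' (f p).
have cont := smooth_continuous f2.
rewrite /prop_for /continuous_at /= (coordK a1 a2) in cont.
have {}cont : \forall y \near chart_at p p,
  A (cinv (chart_at (f p)) (chart_at (f p) (f (cinv (chart_at p) y)))) by exact: cont H.
apply: filterS (nbhs_setI cont f1) => y [+ dy].
by rewrite (coordK a1' dy).
Qed.

Lemma near_eq_msm f g p : mnbhs p (fun q => f q = g q) -> msm f p ->
  msm g p /\ forall v, dmap g p v = dmap f p v.
Proof.
move=> fg [f1 f2]; have fgp := mnbhs_singleton MP fg.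
have fg' : \forall y \near chart_at p p,
  f (cinv (chart_at p) y) = g (cinv (chart_at p) y) by exact: fg.
rewrite /msm /dmap -fgp.
have E : {near chart_at p p, (chart_at (f p) \o f \o cinv (chart_at p)) =1
    (chart_at (f p) \o g \o cinv (chart_at p))}.
  by apply: filterS fg' => y /= ->.
split; first split.
- by apply: filterS (nbhs_setI f1 fg') => y [+ /= <-].
- exact: near_eq_smooth E f2.
- by have [] := near_eq_differentiable E (smooth_diff f2).
Qed.

Lemma smooth_map_on_msm (U : set M) f p : smooth_map_on U f -> U p -> msm f p.
Proof.
move=> fs Up; have [aM ap] := chart_atP MP p.
have [aM' ap'] := chart_atP MP' (f p).
have ac := atlas_coord MP aM.
have [Wo Ws] := fs _ _ aM aM'; set W := _ @` _ in Wo Ws.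
have Wp : W (chart_at p p) by exists p.
split; last by apply: (smooth_onP _ Wo).1 => //; exact: Ws.
apply: filterS (open_nbhs_nbhs (conj Wo Wp)) => _ [q [[_ aq] fq] <-] /=.
by rewrite (coordK ac).
Qed.

Lemma smooth_mapP f : smooth_map f <-> forall p, msm f p.
Proof.
split=> [fs p|fs c c' cM c'M]; first exact: smooth_map_on_msm fs _.
have cc := atlas_coord MP cM; have cc' := atlas_coord MP' c'M.
set W := _ @` _.
have Wo : open W.
  rewrite openE => _ [p [[_ cp] c'fp] <-].
  have [H _] := (msmP cc cc' cp c'fp).1 (fs p).
  apply: filterS (nbhs_setI H (coord_near cc cp)) => y [dfy [dy yE]].
  by exists (cinv c y).
split=> //; apply/(smooth_onP _ Wo) => _ [p [[_ cp] c'fp] <-].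
by have [_ H] := (msmP cc cc' cp c'fp).1 (fs p).
Qed.

(** Tangent vectors are stored by their components in the preferred chart. *)
Lemma dchart_id c p v : coord_system c -> cdom c p -> c = chart_at p -> dchart c p v = v.
Proof.
move=> cc cp cE; rewrite /dchart -cE.
have E : {near c p, id =1 (c \o cinv c)}.
  by apply: filterS (coord_near cc cp) => y [_ /= ->].
have [_ ->] := near_eq_differentiable E (smooth_diff (smooth_id _)).
by have [_ ->] := is_diffE (is_diff_id (c p)).
Qed.

Lemma dchart_comp c1 c2 p v : coord_system c1 -> coord_system c2 ->
  cdom c1 p -> cdom c2 p ->
  dchart c2 p v = 'd (c2 \o cinv c1) (c1 p) (dchart c1 p v).
Proof.
move=> h1 h2 d1 d2; have a1 := chart_at_coord MP p; have a2 := chart_at_dom MP p.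
have [t1 t2] := coord_trans MP a1 h1 a2 d1.
have [u1 u2] := coord_trans MP h1 h2 d1 d2.
have [|_ E] := @smooth_comp_near _ _ _ _ (c2 \o cinv c1) (c1 \o cinv (chart_at p))
  (c2 \o cinv (chart_at p)) (chart_at p p) (c1 p) (congr1 c1 (coordK a1 a2)) u2 t2.
  by apply: filterS t1 => y dy; rewrite /= (coordK h1 dy).
exact: (E v).
Qed.

Lemma dchartK c p v : coord_system c -> cdom c p -> coord_vec c (dchart c p v) p = v.
Proof.
move=> cc cp; have a1 := chart_at_coord MP p; have a2 := chart_at_dom MP p.
rewrite /coord_vec; apply: etrans (esym (dchart_comp v cc a1 cp a2)) _.
exact: dchart_id.
Qed.

Lemma coord_vecK c p v : coord_system c -> cdom c p -> dchart c p (coord_vec c v p) = v.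
Proof.
move=> cc cp; have a1 := chart_at_coord MP p; have a2 := chart_at_dom MP p.
have [t1 t2] := coord_trans MP cc a1 cp a2.
have [u1 u2] := coord_trans MP a1 cc a2 cp.
have [|_ E] := @smooth_comp_near _ _ _ _ (c \o cinv (chart_at p))
  (chart_at p \o cinv c) id (c p) (chart_at p p) (congr1 (chart_at p) (coordK cc cp)) u2 t2.
  apply: filterS (nbhs_setI t1 (coord_near cc cp)) => y [dy [_ yE]].
  by rewrite /= (coordK a1 dy).
rewrite /dchart /coord_vec; apply: etrans (esym (E v)) _.
by have [_ ->] := is_diffE (is_diff_id (c p)).
Qed.

End TwoManifolds.

Section Dmap.
Variables (n d : nat) (M : mspace R n) (M' : mspace R d).
Hypotheses (MP : pre_manifold M) (MP' : pre_manifold M').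

(** [dmap] is defined in the preferred charts; in other coordinates it is the
    derivative of the local expression, by the chain rule. *)
Lemma dmapE c c' (f : M -> M') p v : coord_system c -> coord_system c' ->
  cdom c p -> cdom c' (f p) -> msm f p ->
  'd (c' \o f \o cinv c) (c p) (dchart c p v) = dchart c' (f p) (dmap f p v).
Proof.
move=> cc cc' cp c'p fs.
have a1 := chart_at_coord MP p; have a2 := chart_at_dom MP p.
have a1' := chart_at_coord MP' (f p); have a2' := chart_at_dom MP' (f p).
have [t1 t2] := coord_trans MP a1 cc a2 cp.
have [u1 u2] := coord_trans MP' a1' cc' a2' c'p.
have [f1 f2] := fs; have [_ f3] := (msmP MP MP' cc cc' cp c'p).1 fs.
pose h := c' \o f \o cinv (chart_at p).
have [|_ E1] := @smooth_comp_near _ _ _ _ _ (c \o cinv (chart_at p)) h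
  (chart_at p p) (c p) (congr1 c (coordK a1 a2)) f3 t2.
  by apply: filterS t1 => y dy; rewrite /= (coordK cc dy).
have [|_ E2] := @smooth_comp_near _ _ _ _ (c' \o cinv (chart_at (f p))) _ h
  (chart_at p p) (chart_at (f p) (f p)) (congr1 (chart_at (f p) \o f) (coordK a1 a2)) u2 f2.
  by apply: filterS (mnbhsE f1) => y dy; rewrite /= (coordK a1' dy).
exact: etrans (esym (E1 v)) (E2 v).
Qed.

Lemma dmap_coord c c' (f : M -> M') p v : coord_system c -> coord_system c' ->
  cdom c p -> cdom c' (f p) -> msm f p ->
  dmap f p v = coord_vec c' ('d (c' \o f \o cinv c) (c p) (dchart c p v)) (f p).
Proof.
move=> cc cc' cp c'p fs; rewrite (dmapE _ cc cc') //.
by rewrite (dchartK MP').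
Qed.

Lemma dmapZ (f : M -> M') p a v : dmap f p (a *: v) = a *: dmap f p v.
Proof. exact: diff_Z. Qed.

Lemma dmapD (f : M -> M') p u v : dmap f p (u + v) = dmap f p u + dmap f p v.
Proof. exact: diff_D. Qed.

Lemma dmap_linear (f : M -> M') p : linear (dmap f p).
Proof. by move=> a u v; rewrite dmapD dmapZ. Qed.

Lemma dmapN (f : M -> M') p u : dmap f p (- u) = - dmap f p u.
Proof. by rewrite -scaleN1r dmapZ scaleN1r. Qed.

Lemma dmap0 (f : M -> M') p : dmap f p 0 = 0.
Proof. exact: diff_0. Qed.

Lemma dmapB (f : M -> M') p u v : dmap f p (u - v) = dmap f p u - dmap f p v.
Proof. by rewrite dmapD dmapN. Qed.

End Dmap.

Section Compose.
Variables (n d e : nat) (M : mspace R n) (M' : mspace R d) (M'' : mspace R e).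
Hypotheses (MP : pre_manifold M) (MP' : pre_manifold M') (MP'' : pre_manifold M'').

Lemma msm_comp (g : M' -> M'') (f : M -> M') p : msm f p -> msm g (f p) ->
  msm (g \o f) p /\ forall v, dmap (g \o f) p v = dmap g (f p) (dmap f p v).
Proof.
move=> fs gs; have [f1 f2] := fs; have [g1 g2] := gs.
have a1 := chart_at_coord MP p; have a2 := chart_at_dom MP p.
have a1' := chart_at_coord MP' (f p); have a2' := chart_at_dom MP' (f p).
have [|h1 h2] := @smooth_comp_near _ _ _ _ _ _
  (chart_at (g (f p)) \o (g \o f) \o cinv (chart_at p))
  (chart_at p p) (chart_at (f p) (f p)) (congr1 (chart_at (f p) \o f) (coordK a1 a2)) g2 f2.
  by apply: filterS (mnbhsE f1) => y dy; rewrite /= (coordK a1' dy).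
split=> //; split=> //.
exact: (msm_continuous MP MP' fs g1).
Qed.

End Compose.

Section Identity.
Variables (n : nat) (M : mspace R n).
Hypotheses (MP : pre_manifold M).

Lemma msm_id p : msm (@id M) p /\ forall v, dmap (@id M) p v = v.
Proof.
have a1 := chart_at_coord MP p; have a2 := chart_at_dom MP p.
have E : {near chart_at p p, id =1 (chart_at p \o cinv (chart_at p))}.
  by apply: filterS (coord_near a1 a2) => y [_ /= ->].
split; last by move=> v; exact: (dchart_id v a1 a2 erefl).
split; first exact: (mnbhs_dom MP a1 a2).
exact: near_eq_smooth E (smooth_id _).
Qed.

End Identity.

Section VectorSpace.
Variable m : nat.
Notation V := (rvspace R m).

Definition std_chart : chart R V m := @Chart R V m setT id id.

Lemma rvspace_pre : pre_manifold V.
Proof.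
have im (A : set 'rV[R]_m) : id @` A = A by rewrite image_id.
have r : crange std_chart = setT by rewrite /crange im.
split=> [c ->|p|c c' -> ->].
- by split=> //; change (open (crange std_chart)); rewrite r; exact: openT.
- by exists std_chart.
- rewrite /compatible /= im setTI; split; first exact: openT.
  by apply/(smooth_onP _ (@openT _)) => x _; exact: smooth_id.
Qed.

Lemma std_coord : coord_system std_chart.
Proof. by apply: (atlas_coord rvspace_pre). Qed.

Lemma rv_chart_at (p : V) : chart_at p = std_chart.
Proof. by have [] := chart_atP rvspace_pre p. Qed.

Lemma rv_mnbhs (p : V) (A : set V) : mnbhs p A <-> nbhs (p : 'rV[R]_m) A.
Proof. by rewrite (mnbhsP rvspace_pre A std_coord). Qed.

End VectorSpace.

End SmoothMaps.

(** * The tangent bundle *)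

Section TangentBundle.
Variable R : realType.

Lemma lsubmx_continuous n m (A : set 'rV[R]_n) :
  open A -> open [set y : 'rV[R]_(n + m) | A (lsubmx y)].
Proof.
by move=> Ao; apply: (@open_comp _ _ lsubmx) => // y _; exact: continuous_lsubmx.
Qed.

Section Bundle.
Variables (n : nat) (M : mspace R n).
Hypothesis MP : pre_manifold M.
Notation tc := (@tangent_chart R n M).

Lemma tc_lsub (c : chart R M n) (u : TM M) : lsubmx (tc c u) = c u.1.
Proof. by rewrite row_mxKl. Qed.

Lemma tc_rsub (c : chart R M n) (u : TM M) : rsubmx (tc c u) = dchart c u.1 u.2.
Proof. by rewrite row_mxKr. Qed.

Lemma tc_cinv (c : chart R M n) (y : 'rV[R]_(n + n)) p : coord_system c -> cdom c p ->
  lsubmx y = c p -> cinv (tc c) y = (p, coord_vec c (rsubmx y) p).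
Proof. by move=> cc cp yE; rewrite /= yE (coordK cc cp). Qed.

(** The image of a chart of the tangent bundle over [A] is a product with [R^n];
    this is what makes it open. *)
Lemma tc_image (c : chart R M n) (A : set M) : coord_system c ->
  tc c @` [set u | A u.1 /\ cdom c u.1] = [set y | (c @` (A `&` cdom c)) (lsubmx y)].
Proof.
move=> cc; apply/seteqP; split=> [_ [u [Au cu] <-]|y [p [Ap cp] yE]].
  by exists u.1 => //; rewrite tc_lsub.
exists (p, coord_vec c (rsubmx y) p) => //.
rewrite -[RHS]hsubmxK -yE /=.
by congr row_mx; exact: (coord_vecK MP _ cc cp).
Qed.

Lemma tc_valid (c : chart R M n) : coord_system c -> valid_chart (tc c).
Proof.
move=> cc; split=> [[p v] cp|].
  rewrite (tc_cinv cc cp) ?tc_lsub // tc_rsub /=.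
  by rewrite (dchartK MP _ cc cp).
have := tc_image setT cc.
have -> : [set u : TM M | setT u.1 /\ cdom c u.1] = cdom (tc c).
  by apply/seteqP; split=> u //= [].
rewrite /crange => ->; apply: lsubmx_continuous; rewrite setTI.
by have [[]] := cc.
Qed.

(** The transition map from [tangent_chart c] to [tangent_chart c'] is the
    tangent map of the transition from [c] to [c'], smooth by [smooth_tangent]. *)
Lemma TM_pre : pre_manifold (TM M).
Proof.
split=> [_ [c cM <-]|[p v]|_ _ [c cM <-] [c' c'M <-]].
- exact: tc_valid (atlas_coord MP cM).
- have [aM ap] := chart_atP MP p; exists (tc (chart_at p)) => //.
  by exists (chart_at p).
have cc := atlas_coord MP cM; have cc' := atlas_coord MP c'M.
have E : tc c @` (cdom (tc c) `&` cdom (tc c')) =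
    [set y | (c @` (cdom c' `&` cdom c)) (lsubmx y)].
  rewrite -tc_image //; congr (_ @` _).
  by apply/seteqP; split=> u /= [].
have [Uo Us] := cc.2 c' c'M; have [_ [Uo' _]] := cc.2 c' c'M.
rewrite /compatible /= E.
have Wo : open (c @` (cdom c' `&` cdom c)) by rewrite setIC.
have Wo' := @lsubmx_continuous n n _ Wo.
split=> //; apply/(smooth_onP _ Wo') => y [p [c'p cp] yE].
have [t1 t2] := coord_trans MP cc cc' cp c'p.
rewrite yE in t1 t2.
have h : smooth_at (fun z : 'rV[R]_(n + n) => row_mx ((c' \o cinv c) (lsubmx z))
    ('d (c' \o cinv c) (lsubmx z) (rsubmx z))) y.
  apply: smooth_row_mx; last exact: smooth_tangent.
  by apply: (@smooth_comp _ _ _ _ _ (c' \o cinv c)) => //; exact: smooth_lsubmx.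
apply: near_eq_smooth h.
have ny : nbhs y [set y | (c @` (cdom c' `&` cdom c)) (lsubmx y)].
  by apply: open_nbhs_nbhs; split=> //; exists p.
apply: filterS ny => z [q [c'q cq] zE].
rewrite [RHS]/= -/(cinv (tc c) z) -zE (coordK cc cq); congr row_mx.
  by rewrite /= (coordK cc cq).
apply: etrans; last exact: esym (dchart_comp MP _ cc cc' cq c'q).
by congr ('d _ _ _); exact: esym (coord_vecK MP _ cc cq).
Qed.

Lemma tc_coord (c : chart R M n) : atlas M c -> coord_system (tc c : chart R (TM M) _).
Proof. by move=> cM; apply: (atlas_coord TM_pre); exists c. Qed.

Lemma tproj_msm (u : TM M) : msm (@tproj R n M) u.
Proof.
have [aM ap] := chart_atP MP u.1; set a := chart_at u.1 in aM ap.
have ac := atlas_coord MP aM; have tac := tc_coord aM.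
have au : cdom (tc a) u by [].
apply/(msmP TM_pre MP tac ac au ap); split.
  by apply: filterS (coord_near tac au) => y [].
apply: near_eq_smooth (smooth_lsubmx _).
by apply: filterS (coord_near tac au) => y [dy /(congr1 lsubmx)]; rewrite tc_lsub.
Qed.

(** In tangent charts a vector field is the graph of its representation. *)
Lemma section_msm (U : set M) (Y : M -> 'rV[R]_n) p : mopen U -> U p ->
  smooth_field_on U Y -> msm (fun q => (q, Y q) : TM M) p.
Proof.
move=> Uo Up Ys; have [aM ap] := chart_atP MP p; set a := chart_at p in aM ap.
have ac := atlas_coord MP aM; have tac := tc_coord aM.
apply/(@msmP _ _ _ M (TM M) MP TM_pre a (tc a) (fun q => (q, Y q)) p ac tac ap ap); split.
  by apply: filterS (coord_near ac ap) => y [].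
have h : smooth_at (fun y => row_mx y (field_rep a Y y)) (a p).
  apply: smooth_row_mx; first exact: smooth_id.
  by apply: (smooth_onP _ (Uo a aM)).1; [exact: Ys|exists p].
apply: near_eq_smooth h; apply: filterS (coord_near ac ap) => y [dy yE] /=.
by rewrite yE.
Qed.

End Bundle.

Section TangentMap.
Variables (n d : nat) (M : mspace R n) (M' : mspace R d).
Hypotheses (MP : pre_manifold M) (MP' : pre_manifold M').

Lemma tmap_msm (f : M -> M') (u : TM M) : (forall p, msm f p) -> msm (tmap f) u.
Proof.
move=> fs; have TP := TM_pre MP; have TP' := TM_pre MP'.
have [aM ap] := chart_atP MP u.1; set a := chart_at u.1 in aM ap.
have [aM' ap'] := chart_atP MP' (f u.1); set a' := chart_at (f u.1) in aM' ap'.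
have ac := atlas_coord MP aM; have tac := tc_coord MP aM.
have ac' := atlas_coord MP' aM'; have tac' := tc_coord MP' aM'.
have au : cdom (tangent_chart a) u by [].
have au' : cdom (tangent_chart a') (tmap f u) by [].
have H1 := msm_continuous MP MP' (fs u.1) (mnbhs_dom MP' ac' ap').
have H : mnbhs u (fun w => cdom a' (f w.1)).
  exact: (msm_continuous TP MP (tproj_msm MP u) H1).
have {}H := (mnbhsP TP _ tac au).1 H.
apply/(msmP TP TP' tac tac' au au'); split=> //.
have [_ f2] := (msmP MP MP' ac ac' ap ap').1 (fs u.1).
pose phi := a' \o f \o cinv a.
have h : smooth_at (fun z : 'rV[R]_(n + n) => row_mx (phi (lsubmx z))
    ('d phi (lsubmx z) (rsubmx z))) (tangent_chart a u).
  have lE := tc_lsub a u.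
  apply: smooth_row_mx; last by apply: smooth_tangent; rewrite lE.
  by apply: (@smooth_comp _ _ _ _ _ phi); [rewrite lE|exact: smooth_lsubmx].
apply: near_eq_smooth h.
apply: filterS (nbhs_setI H (coord_near tac au)) => z [d'z [dz zE]].
set w := cinv (tangent_chart a) z in d'z dz zE.
have zl : lsubmx z = a w.1 by rewrite -zE tc_lsub.
have zr : rsubmx z = dchart a w.1 w.2 by rewrite -zE tc_rsub.
rewrite zl zr -[RHS]/(row_mx (a' (f w.1)) (dchart a' (f w.1) (dmap f w.1 w.2))).
congr row_mx; first by rewrite /phi /= (coordK ac).
exact: (dmapE MP MP' w.2 ac ac' dz d'z (fs w.1)).
Qed.

End TangentMap.

End TangentBundle.

(** * Frames of vector fields *)

Section Frames.
Variable R : realType.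

Section FieldBasics.
Variables (n : nat) (M : mspace R n).
Hypothesis MP : pre_manifold M.

Lemma mopenT : mopen (@setT M).
Proof. by apply/(mopenP MP) => p _; exact: filterT. Qed.

Lemma smooth_onW m (V : normedModType R) (U W : set 'rV[R]_m) (f : 'rV[R]_m -> V) :
  open U -> open W -> W `<=` U -> smooth_on U f -> smooth_on W f.
Proof.
move=> Uo Wo WU /(smooth_onP _ Uo) fs; apply/(smooth_onP _ Wo) => x /WU; exact: fs.
Qed.

Lemma smooth_field_onW (U W : set M) Y : mopen U -> mopen W -> W `<=` U ->
  smooth_field_on U Y -> smooth_field_on W Y.
Proof.
move=> Uo Wo WU Ys c cM; apply: smooth_onW (Ys c cM); [exact: Uo|exact: Wo|].
by apply: image_subset => p [/WU].
Qed.

Lemma smooth_fun_onP (U : set M) (f : M -> R) : mopen U ->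
  smooth_fun_on U f <-> forall c p, atlas M c -> U p -> cdom c p ->
    smooth_at (f \o cinv c) (c p).
Proof.
move=> Uo; split=> [fs c p cM Up cp|fs c cM].
  by apply: (smooth_onP _ (Uo c cM)).1; [exact: fs|exists p].
by apply/(smooth_onP _ (Uo c cM)) => _ [p [Up cp] <-]; exact: fs.
Qed.

Lemma smooth_field_onP (U : set M) Y : mopen U ->
  smooth_field_on U Y <-> forall c p, atlas M c -> U p -> cdom c p ->
    smooth_at (field_rep c Y) (c p).
Proof.
move=> Uo; split=> [fs c p cM Up cp|fs c cM].
  by apply: (smooth_onP _ (Uo c cM)).1; [exact: fs|exists p].
by apply/(smooth_onP _ (Uo c cM)) => _ [p [Up cp] <-]; exact: fs.
Qed.

Lemma msm_smooth_fun m (b : M -> rvspace R m) (U : set M) j : mopen U ->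
  (forall p, U p -> msm b p) -> smooth_fun_on U (fun p => (b p : 'rV[R]_m) 0 j).
Proof.
move=> Uo bs; apply/(smooth_fun_onP _ Uo) => c p cM Up cp.
have cc := atlas_coord MP cM.
have [_ h] := (msmP MP (rvspace_pre R m) cc (std_coord R m) cp I).1 (bs p Up).
exact: (smooth_coord _ _).1 h j.
Qed.

Lemma dmap_fun m (b : M -> rvspace R m) p v j : msm b p ->
  dfun (fun p => (b p : 'rV[R]_m) 0 j) p v = (dmap b p v) 0 j.
Proof.
move=> bs; have a1 := chart_at_coord MP p; have a2 := chart_at_dom MP p.
have [_ h] := (msmP MP (rvspace_pre R m) a1 (std_coord R m) a2 I).1 bs.
rewrite /dmap /dfun rv_chart_at.
exact: (diff_coord v j (smooth_diff h)).
Qed.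

(** The coordinate change at [p] from the preferred chart to [c], as a matrix. *)
Definition dchart_mx (c : chart R M n) (p : M) : 'M[R]_n :=
  lin1_mx ('d (c \o cinv (chart_at p)) (chart_at p p)).

Lemma dchart_mxE c p v : dchart c p v = v *m dchart_mx c p.
Proof. by rewrite mul_rV_lin1. Qed.

Lemma dchart_mx_unit c p : coord_system c -> cdom c p -> dchart_mx c p \in unitmx.
Proof.
move=> cc cp.
have : dchart_mx c p *m lin1_mx ('d (chart_at p \o cinv c) (c p)) = 1%:M.
  apply/row_matrixP => i; rewrite row_mul row1 rowE -dchart_mxE mul_rV_lin1.
  exact: (dchartK MP _ cc cp).
move=> E; exact: (mulmx1_unit E).1.
Qed.

End FieldBasics.

Variables (n : nat) (M : dfspace R n).
Hypothesis MP : pre_manifold M.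
Variable X : 'I_n -> M -> 'rV[R]_n.
Hypothesis Xs : forall i, smooth_field_on setT (X i).
Hypothesis Xu : forall p, \matrix_i X i p \in unitmx.

Definition frame_mx p : 'M[R]_n := \matrix_i X i p.

(** The fibre coordinate of the trivialization of the tangent bundle by the frame. *)
Definition frame_coord (u : TM M) : rvspace R n := u.2 *m invmx (frame_mx u.1).

Definition frame_rep (c : chart R M n) y : 'M[R]_n := \matrix_i field_rep c (X i) y.

Lemma frame_sum (t : 'rV[R]_n) p : \sum_i t 0 i *: X i p = t *m frame_mx p.
Proof. by rewrite mulmx_sum_row; apply: eq_bigr => i _; rewrite rowK. Qed.

Lemma translationE t (u : TM M) : translation X t u = (u.1, u.2 + t *m frame_mx u.1).
Proof. by rewrite /translation frame_sum. Qed.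

Lemma frame_coordK (u : TM M) : frame_coord u *m frame_mx u.1 = u.2.
Proof. by rewrite /frame_coord mulmxKV // ?Xu. Qed.

Lemma frame_coord_mul p (b : 'rV[R]_n) : frame_coord ((p, b *m frame_mx p) : TM M) = b.
Proof. by rewrite /frame_coord /= mulmxK // Xu. Qed.

Lemma frame_coord_translation t u : frame_coord (translation X t u) = frame_coord u + t.
Proof. by rewrite translationE /frame_coord /= mulmxDl mulmxK ?Xu. Qed.

Lemma translation_comp s t u : translation X s (translation X t u) = translation X (t + s) u.
Proof. by rewrite !translationE /= mulmxDl addrA. Qed.

Lemma translation0 u : translation X 0 u = u.
Proof. by rewrite translationE mul0mx addr0; case: u. Qed.

Lemma frame_repE (c : chart R M n) q : coord_system c -> cdom c q ->
  frame_rep c (c q) = frame_mx q *m dchart_mx c q.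
Proof.
move=> cc cq; apply/row_matrixP => i.
rewrite rowK row_mul rowK -dchart_mxE /field_rep.
by rewrite (coordK cc cq).
Qed.

Lemma frame_rep_unit (c : chart R M n) q : coord_system c -> cdom c q ->
  frame_rep c (c q) \in unitmx.
Proof.
by move=> cc cq; rewrite frame_repE // unitmx_mul Xu dchart_mx_unit.
Qed.

Lemma frame_rep_smooth (c : chart R M n) q : atlas M c -> cdom c q ->
  smooth_mx (c q) (frame_rep c).
Proof.
move=> cM cq i j; under [X in smooth_at X]eq_fun do rewrite mxE.
by apply: (smooth_coord _ _).1; apply: (smooth_field_onP _ (mopenT MP)).1.
Qed.

Lemma frame_comb_field (U : set M) (b : M -> rvspace R n) : mopen U ->
  (forall p, U p -> msm b p) -> smooth_field_on U (fun q => b q *m frame_mx q).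
Proof.
move=> Uo bs; apply/(smooth_field_onP _ Uo) => c p cM Up cp.
have cc := atlas_coord MP cM.
have [_ h] := (msmP MP (rvspace_pre R n) cc (std_coord R n) cp I).1 (bs p Up).
have H : smooth_mx (c p) (fun y => (b (cinv c y) : 'rV[R]_n) *m frame_rep c y).
  apply: smooth_mulmx; last exact: frame_rep_smooth.
  exact: (smooth_rV_mx _ _).1 h.
have {}H := (smooth_rV_mx _ _).2 H.
apply: near_eq_smooth H; apply: filterS (coord_near cc cp) => y [dy yE].
rewrite /field_rep dchart_mxE -mulmxA; congr (_ *m _).
by rewrite -{1}yE frame_repE.
Qed.

(** In a tangent chart the frame coordinates are the components of the vector
    times the inverse of [frame_rep], which is smooth by the formula of Cramer. *)
Lemma frame_coord_msm (u : TM M) : msm frame_coord u.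
Proof.
have TP := TM_pre MP.
have [aM ap] := chart_atP MP u.1; set a := chart_at u.1 in aM ap.
have ac := atlas_coord MP aM; have tac := tc_coord MP aM.
have au : cdom (tangent_chart a) u by [].
apply/(msmP TP (rvspace_pre R n) tac (std_coord R n) au I); split; first exact: near_all.
have lE := tc_lsub a u.
have H : smooth_mx (tangent_chart a u)
    (fun y : 'rV[R]_(n + n) => rsubmx y *m invmx (frame_rep a (lsubmx y))).
  apply: smooth_mulmx; first exact: (smooth_rV_mx _ _).1 (smooth_rsubmx _).
  apply: smooth_invmx; first by rewrite lE frame_rep_unit.
  move=> i j; apply: (@smooth_compR _ _ _ _ (fun y => frame_rep a y i j) lsubmx).
    by rewrite lE; exact: frame_rep_smooth.
  exact: smooth_lsubmx.
have {}H := (smooth_rV_mx _ _).2 H.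
apply: near_eq_smooth H; apply: filterS (coord_near tac au) => z [dz zE].
set w := cinv (tangent_chart a) z in dz zE.
have zl : lsubmx z = a w.1 by rewrite -zE tc_lsub.
have zr : rsubmx z = dchart a w.1 w.2 by rewrite -zE tc_rsub.
rewrite zl zr -[RHS]/(frame_coord w) dchart_mxE -(frame_coordK w) -(mulmxA (frame_coord w)) -frame_repE //.
by rewrite mulmxK // frame_rep_unit.
Qed.

Lemma translation_msm t (u : TM M) : msm (translation X t : TM M -> TM M) u.
Proof.
have TP := TM_pre MP.
have [aM ap] := chart_atP MP u.1; set a := chart_at u.1 in aM ap.
have ac := atlas_coord MP aM; have tac := tc_coord MP aM.
have au : cdom (tangent_chart a) u by [].
have au' : cdom (tangent_chart a) (translation X t u) by [].
apply/(msmP TP TP tac tac au au'); split.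
  by apply: filterS (coord_near tac au) => y [].
have lE := tc_lsub a u.
have h : smooth_at (fun z : 'rV[R]_(n + n) => row_mx (lsubmx z)
    (rsubmx z + t *m frame_rep a (lsubmx z))) (tangent_chart a u).
  apply: smooth_row_mx; first exact: smooth_lsubmx.
  apply: smooth_add; first exact: smooth_rsubmx.
  apply/smooth_rV_mx; apply: smooth_mulmx; first by move=> i j; exact: smooth_cst.
  move=> i j; apply: (@smooth_compR _ _ _ _ (fun y => frame_rep a y i j) lsubmx).
    by rewrite lE; exact: frame_rep_smooth.
  exact: smooth_lsubmx.
apply: near_eq_smooth h; apply: filterS (coord_near tac au) => z [dz zE].
set w := cinv (tangent_chart a) z in dz zE.
have zl : lsubmx z = a w.1 by rewrite -zE tc_lsub.
have zr : rsubmx z = dchart a w.1 w.2 by rewrite -zE tc_rsub.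
rewrite zl zr -[RHS]/(tangent_chart a (translation X t w)) translationE.
congr row_mx; rewrite frame_repE //.
apply: etrans (esym (dchart_mxE _ _ _)).
by rewrite dchart_mxE mulmxDl mulmxA.
Qed.

Lemma fibre_msm (u : TM M) (t : rvspace R n) :
  msm (fun s : rvspace R n => translation X s u : TM M) t.
Proof.
have TP := TM_pre MP.
have [aM ap] := chart_atP MP u.1; set a := chart_at u.1 in aM ap.
have ac := atlas_coord MP aM; have tac := tc_coord MP aM.
have au' : cdom (tangent_chart a) (translation X t u) by [].
apply/(@msmP _ _ _ (rvspace R n) (TM M) (rvspace_pre R n) TP (std_chart R n)
  (tangent_chart a) (fun s => translation X s u) t (std_coord R n) tac I au'); split.
  exact: near_all.
have h : smooth_at (fun s : 'rV[R]_n => row_mx (a u.1)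
    (dchart a u.1 u.2 + s *m (frame_mx u.1 *m dchart_mx a u.1))) (t : 'rV[R]_n).
  apply: smooth_row_mx; first exact: smooth_cst.
  apply: smooth_add; first exact: smooth_cst.
  exact: (@smooth_linear _ _ _ _ (mulmxr (frame_mx u.1 *m dchart_mx a u.1))).
apply: near_eq_smooth h; apply: near_all => s.
rewrite -[RHS]/(tangent_chart a (translation X s u)) translationE.
congr row_mx; apply: etrans (esym (dchart_mxE _ _ _)).
by rewrite dchart_mxE mulmxDl mulmxA.
Qed.

End Frames.

(** * Splitting of the tangent spaces of the tangent bundle *)

Section DmapRV.
Variable R : realType.

Section Cst.
Variables (n d : nat) (M : mspace R n) (M' : mspace R d).
Hypotheses (MP : pre_manifold M) (MP' : pre_manifold M').

Lemma msm_cst (a : M') (p : M) : msm (fun _ : M => a) p /\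
  forall v, dmap (fun _ : M => a) p v = 0.
Proof.
have [_ E] := is_diffE (is_diff_cst (chart_at a a) (chart_at p p)).
split; last by move=> v; exact: (E v).
split; last exact: smooth_cst.
by apply: near_all => y; exact: chart_at_dom.
Qed.

Lemma dmap_eq (f g : M -> M') p v : f =1 g -> dmap f p v = dmap g p v.
Proof. by move=> /funext ->. Qed.

End Cst.

Section ToVector.
Variables (n m : nat) (M : mspace R n).
Hypotheses (MP : pre_manifold M).

Lemma dmap_rv (b : M -> rvspace R m) p v :
  dmap b p v = 'd ((b : M -> 'rV[R]_m) \o cinv (chart_at p)) (chart_at p p) v.
Proof. by rewrite /dmap rv_chart_at. Qed.

Lemma msm_rv (b : M -> rvspace R m) p :
  msm b p <-> smooth_at ((b : M -> 'rV[R]_m) \o cinv (chart_at p)) (chart_at p p).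
Proof.
rewrite /msm rv_chart_at; split=> [[]//|h]; split=> //.
exact: near_all.
Qed.

End ToVector.

Lemma dmap_shift m (t : 'rV[R]_m) (s : rvspace R m) :
  msm (fun s : rvspace R m => (s + t : rvspace R m)) s /\
  forall v, dmap (fun s : rvspace R m => (s + t : rvspace R m)) s v = v.
Proof.
split; first by apply/msm_rv; rewrite rv_chart_at;
  apply: smooth_add; [exact: smooth_id|exact: smooth_cst].
move=> v; rewrite dmap_rv rv_chart_at.
have h : is_diff (s : 'rV[R]_m) (fun s : 'rV[R]_m => s + t) id.
  by have := is_diffD (is_diff_id (s : 'rV[R]_m)) (is_diff_cst t _); rewrite addr0.
by have [_ ->] := is_diffE h.
Qed.

(** The product rule for combinations of vector valued maps with variable
    coefficients. *)
Lemma dmap_lincomb n m k (M : mspace R n) (MP : pre_manifold M)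
    (al : M -> rvspace R k) (be : 'I_k -> M -> rvspace R m) p :
  msm al p -> (forall i, msm (be i) p) ->
  let ga q : rvspace R m := \sum_i (al q : 'rV[R]_k) 0 i *: (be i q : 'rV[R]_m) in
  msm ga p /\ forall v, dmap ga p v =
    \sum_i (dmap al p v) 0 i *: (be i p : 'rV[R]_m)
    + \sum_i (al p : 'rV[R]_k) 0 i *: dmap (be i) p v.
Proof.
move=> /msm_rv als bes ga.
set c := chart_at p in als; have cK := coordK (chart_at_coord MP p) (chart_at_dom MP p).
have besc i : smooth_at ((be i : M -> 'rV[R]_m) \o cinv c) (c p) by apply/msm_rv.
have gas : smooth_at ((ga : M -> 'rV[R]_m) \o cinv c) (c p).
  apply: smooth_sum => i _; apply: smooth_scale; last exact: besc.
  exact: (smooth_coord _ _).1 als i.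
split; first exact/msm_rv.
move=> v; apply/rowP => j; rewrite dmap_rv -/c.
apply: (etrans (esym (diff_coord v j (smooth_diff gas)))).
pose A i (y : 'rV[R]_n) : R := (al (cinv c y) : 'rV[R]_k) 0 i.
pose B i (y : 'rV[R]_n) : R := (be i (cinv c y) : 'rV[R]_m) 0 j.
have dA i : differentiable (A i) (c p) := smooth_diff ((smooth_coord _ _).1 als i).
have dB i : differentiable (B i) (c p) := smooth_diff ((smooth_coord _ _).1 (besc i) j).
have dAB i := diff_mul v (dA i) (dB i).
have [_ E] := diff_sum v (fun i => (dAB i).1).
have -> : (fun y => ((ga : M -> 'rV[R]_m) \o cinv c) y 0 j) =
    fun y => \sum_i A i y * B i y.
  by apply/funext => y /=; rewrite summxE; apply: eq_bigr => i _; rewrite mxE.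
apply: (etrans E); under eq_bigr do rewrite (dAB _).2.
rewrite big_split /= addrC mxE !summxE; congr (_ + _); apply: eq_bigr => i _.
  rewrite mxE dmap_rv -/c /B cK mulrC; congr (_ * _).
  exact: (diff_coord v i (smooth_diff als)).
rewrite mxE dmap_rv -/c /A cK; congr (_ * _).
exact: (diff_coord v j (smooth_diff (besc i))).
Qed.

End DmapRV.

Section DombrowskiStructure.
Variable R : realType.
Variables (n : nat) (M : dfspace R n).
Hypothesis MP : pre_manifold M.
Variable X : 'I_n -> M -> 'rV[R]_n.
Hypothesis Xs : forall i, smooth_field_on setT (X i).
Hypothesis Xu : forall p, \matrix_i X i p \in unitmx.

Let TP := TM_pre MP.
Let VP := rvspace_pre R n.

(** By [connectorE] below, this is the vertical part of [A] expressed in a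
    parallel frame. *)
Definition dframe (u : TM M) (A : 'rV[R]_(n + n)) : 'rV[R]_n := dmap (frame_coord X) u A.

(** The fields with constant coefficients in the frame, as sections; their
    derivatives are the horizontal vectors when the frame is parallel. *)
Definition psection (b : 'rV[R]_n) : M -> TM M := fun q => (q, b *m frame_mx X q).

Lemma comb_section_msm (U : set M) (b : M -> rvspace R n) p : mopen U -> U p ->
  (forall p, U p -> msm b p) ->
  msm (fun q => (q, (b q : 'rV[R]_n) *m frame_mx X q) : TM M) p.
Proof.
move=> Uo Up bs; apply: (@section_msm _ _ _ MP U (fun q => (b q : 'rV[R]_n) *m frame_mx X q)) => //.
exact: frame_comb_field.
Qed.

Lemma psection_msm b p : msm (psection b) p.
Proof.
apply: (@comb_section_msm setT (fun _ => b)) => //; first exact: mopenT.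
by move=> q _; exact: (msm_cst VP (b : rvspace R n) q).1.
Qed.

Lemma hor_section (Y : M -> 'rV[R]_n) p v : msm (fun q => (q, Y q) : TM M) p ->
  hor (p, Y p) (dmap (fun q => (q, Y q) : TM M) p v) = v.
Proof.
move=> Ys; rewrite /hor.
have [_ E] := msm_comp MP TP Ys (tproj_msm MP (p, Y p)).
rewrite -E; exact: (msm_id MP p).2.
Qed.

Lemma dframe_section (Y : M -> 'rV[R]_n) p v : msm (fun q => (q, Y q) : TM M) p ->
  dframe (p, Y p) (dmap (fun q => (q, Y q) : TM M) p v) =
  dmap (fun q => frame_coord X ((q, Y q) : TM M)) p v.
Proof.
move=> Ys; rewrite /dframe.
by have [_ E] := msm_comp MP TP Ys (frame_coord_msm MP Xs Xu (p, Y p)); rewrite -E.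
Qed.

Lemma hor_section_at (u : TM M) (Y : M -> 'rV[R]_n) v :
  msm (fun q => (q, Y q) : TM M) u.1 -> Y u.1 = u.2 ->
  hor u (dmap (fun q => (q, Y q) : TM M) u.1 v) = v.
Proof. by case: u => p w /= Ys <-; exact: hor_section. Qed.

Lemma dframe_section_at (u : TM M) (Y : M -> 'rV[R]_n) v :
  msm (fun q => (q, Y q) : TM M) u.1 -> Y u.1 = u.2 ->
  dframe u (dmap (fun q => (q, Y q) : TM M) u.1 v) =
  dmap (fun q => frame_coord X ((q, Y q) : TM M)) u.1 v.
Proof. by case: u => p w /= Ys <-; exact: dframe_section. Qed.

Lemma hor_psection u v : hor u (dmap (psection (frame_coord X u)) u.1 v) = v.
Proof. by apply: hor_section_at; [exact: psection_msm|exact: frame_coordK]. Qed.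

Lemma dframe_psection u v : dframe u (dmap (psection (frame_coord X u)) u.1 v) = 0.
Proof.
apply: etrans.
  by apply: dframe_section_at; [exact: psection_msm|exact: frame_coordK].
rewrite (@dmap_eq _ _ _ _ _ _ (fun _ => frame_coord X u)).
  exact: (msm_cst VP (frame_coord X u) u.1).2.
by move=> q; rewrite frame_coord_mul.
Qed.

(** The tangent vector at [u] to the curve of translates of [u]. *)
Definition vertical (u : TM M) (w : 'rV[R]_n) : 'rV[R]_(n + n) :=
  dmap (fun s : rvspace R n => translation X s u : TM M) (0 : 'rV[R]_n) w.

Lemma hor_vertical u w : hor u (vertical u w) = 0.
Proof.
rewrite /hor /vertical.
have [_ E] := msm_comp VP TP (fibre_msm MP X u (0 : 'rV[R]_n))
  (tproj_msm MP (translation X 0 u)).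
have := E w; rewrite translation0 => <-.
rewrite (@dmap_eq _ _ _ _ _ _ (fun _ => u.1)) //.
exact: (@msm_cst _ _ _ (rvspace R n) M MP u.1 (0 : 'rV[R]_n)).2.
Qed.

Lemma dframe_vertical u w : dframe u (vertical u w) = w.
Proof.
rewrite /dframe /vertical.
have [_ E] := msm_comp VP TP (fibre_msm MP X u (0 : 'rV[R]_n))
  (frame_coord_msm MP Xs Xu (translation X 0 u)).
have := E w; rewrite translation0 => <-.
rewrite (@dmap_eq _ _ _ _ _ _ (fun s : rvspace R n =>
    (s : 'rV[R]_n) + (frame_coord X u : 'rV[R]_n) : rvspace R n)).
  exact: (dmap_shift (frame_coord X u) (0 : 'rV[R]_n)).2.
by move=> s; rewrite /= frame_coord_translation // addrC.
Qed.

(** A section with constant coefficients through [u] reaches every horizontal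
    part with vanishing [dframe], and translations reach every [dframe] with
    vanishing horizontal part. *)
Lemma hor_dframe_onto u v w : exists A, hor u A = v /\ dframe u A = w.
Proof.
exists (dmap (psection (frame_coord X u)) u.1 v + vertical u w).
have hD A B : hor u (A + B) = hor u A + hor u B by exact: dmapD.
have dD A B : dframe u (A + B) = dframe u A + dframe u B by exact: dmapD.
rewrite hD dD hor_psection dframe_psection hor_vertical dframe_vertical.
by rewrite addr0 add0r.
Qed.

(** Both spaces have dimension [2 n], so injectivity follows from surjectivity. *)
Lemma hor_dframe_inj u A B : hor u A = hor u B -> dframe u A = dframe u B -> A = B.
Proof.
have Ll : linear (fun A : 'rV[R]_(n + n) => row_mx (hor u A) (dframe u A)).
  move=> a C D; rewrite /hor /dframe !dmapD !dmapZ.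
  by rewrite scale_row_mx add_row_mx.
pose LM := GRing.isLinear.Build _ _ _ _ _ Ll.
pose L : {linear 'rV[R]_(n + n) -> 'rV[R]_(n + n)} := HB.pack (fun A => row_mx (hor u A) (dframe u A)) LM.
have /choice [Q QP] : forall i : 'I_(n + n), exists A, L A = delta_mx 0 i.
  move=> i.
  have [C [hC dC]] := hor_dframe_onto u (lsubmx (delta_mx 0 i)) (rsubmx (delta_mx 0 i)).
  by exists C; rewrite /L /= hC dC hsubmxK.
have E : (\matrix_i Q i) *m lin1_mx L = 1%:M.
  by apply/row_matrixP => i; rewrite row_mul rowK mul_rV_lin1 QP row1.
have [_ U] := mulmx1_unit E.
move=> hAB dAB; have : A *m lin1_mx L = B *m lin1_mx L.
  by rewrite !mul_rV_lin1 /L /= hAB dAB.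
by move=> /(congr1 (mulmx^~ (invmx (lin1_mx L)))); rewrite !mulmxK.
Qed.

End DombrowskiStructure.

(** * Connections and the connector *)

Section Connector.
Variable R : realType.

Section FieldAlgebra.
Variables (n : nat) (M : mspace R n).
Hypothesis MP : pre_manifold M.

Lemma smooth_field_add (U : set M) Y Z : mopen U ->
  smooth_field_on U Y -> smooth_field_on U Z ->
  smooth_field_on U (fun q => Y q + Z q).
Proof.
move=> Uo /(smooth_field_onP _ Uo) Ys /(smooth_field_onP _ Uo) Zs.
apply/(smooth_field_onP _ Uo) => c p cM Up cp.
apply: near_eq_smooth (smooth_add (Ys c p cM Up cp) (Zs c p cM Up cp)).
by apply: near_all => y; rewrite /field_rep !dchart_mxE mulmxDl.
Qed.

Lemma smooth_field_scale (U : set M) f Y : mopen U ->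
  smooth_fun_on U f -> smooth_field_on U Y ->
  smooth_field_on U (fun q => f q *: Y q).
Proof.
move=> Uo /(smooth_fun_onP _ Uo) fs /(smooth_field_onP _ Uo) Ys.
apply/(smooth_field_onP _ Uo) => c p cM Up cp.
apply: near_eq_smooth (smooth_scale (fs c p cM Up cp) (Ys c p cM Up cp)).
by apply: near_all => y; rewrite /field_rep !dchart_mxE scalemxAl.
Qed.

Lemma smooth_field0 (U : set M) : mopen U -> smooth_field_on U (fun _ : M => 0).
Proof.
move=> Uo; apply/(smooth_field_onP _ Uo) => c p cM Up cp.
apply: near_eq_smooth (smooth_cst _ (0 : 'rV[R]_n)).
by apply: near_all => y; rewrite /field_rep dchart_mxE mul0mx.
Qed.

Section Conn.
Variable D : connection M.
Hypothesis Dc : is_connection D.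

Lemma conn0 (U : set M) p v : mopen U -> U p -> D p v (fun _ => 0) = 0.
Proof.
move=> Uo Up; have [_ Dadd _ _] := Dc Uo; have s0 := smooth_field0 Uo.
have := Dadd p v _ _ Up s0 s0; rewrite addr0 => /(congr1 (fun w => w - D p v (fun=> 0))).
by rewrite subrr addrK => <-.
Qed.

Lemma conn_lincomb (U : set M) k (b : 'I_k -> M -> R) (Y : 'I_k -> M -> 'rV[R]_n) p v :
  mopen U -> U p -> (forall i, smooth_fun_on U (b i)) ->
  (forall i, smooth_field_on U (Y i)) ->
  smooth_field_on U (fun q => \sum_i b i q *: Y i q) /\
  D p v (fun q => \sum_i b i q *: Y i q) =
    \sum_i (dfun (b i) p v *: Y i p + b i p *: D p v (Y i)).
Proof.
move=> Uo Up; elim: k b Y => [|k IH] b Y bs Ys.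
  have -> : (fun q => \sum_(i < 0) b i q *: Y i q) = fun=> 0.
    by apply/funext => q; rewrite big_ord0.
  by split; [exact: smooth_field0|rewrite big_ord0; exact: conn0 Uo Up].
have -> : (fun q => \sum_(i < k.+1) b i q *: Y i q) = fun q =>
    b ord0 q *: Y ord0 q + \sum_(i < k) b (lift ord0 i) q *: Y (lift ord0 i) q.
  by apply/funext => q; rewrite big_ord_recl.
have [h1 h2] := IH (fun i => b (lift ord0 i)) (fun i => Y (lift ord0 i))
  (fun i => bs _) (fun i => Ys _).
have h0 := smooth_field_scale Uo (bs ord0) (Ys ord0).
split; first exact: smooth_field_add.
have [_ Dadd Dleib _] := Dc Uo.
by rewrite big_ord_recl -h2 Dadd // Dleib.
Qed.

(** The indicator function of [U] is smooth on [U], where it is constant; by the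
    Leibniz rule multiplication by it does not change the derivative at [p],
    while it makes [Y] and [Z] equal everywhere. *)
Lemma conn_local (U : set M) Y Z p v : mopen U -> U p ->
  smooth_field_on U Y -> smooth_field_on U Z -> (forall q, U q -> Y q = Z q) ->
  D p v Y = D p v Z.
Proof.
move=> Uo Up Ys Zs YZ; pose one q : R := if pselect (U q) then 1 else 0.
have oneU q : U q -> one q = 1 by rewrite /one; case: pselect.
have one0 q : ~ U q -> one q = 0 by rewrite /one; case: pselect.
have os : smooth_fun_on U one.
  apply/(smooth_fun_onP _ Uo) => c q cM Uq cq; have cc := atlas_coord MP cM.
  apply: near_eq_smooth (smooth_cst _ (1 : R)).
  have qU : mnbhs q U by exact: (mopenP MP U).1.
  apply: filterS ((mnbhsP MP U cc cq).1 qU) => y Uy /=; by rewrite oneU.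
have d1 : dfun one p v = 0.
  have qU : mnbhs p U by exact: (mopenP MP U).1.
  have E : {near chart_at p p, (cst 1 : _ -> R) =1 (one \o cinv (chart_at p))}.
    by apply: filterS (mnbhsE qU) => y Uy /=; rewrite oneU.
  have [_ E1] := near_eq_differentiable E (differentiable_cst _ _).
  have [_ E2] := is_diffE (is_diff_cst (1 : R) (chart_at p p)).
  exact: etrans (E1 v) (E2 v).
have [_ _ Dleib _] := Dc Uo.
have key W : smooth_field_on U W -> D p v (fun q => one q *: W q) = D p v W.
  by move=> Ws; rewrite Dleib // d1 scale0r add0r oneU // scale1r.
rewrite -(key _ Ys) -(key _ Zs); congr (D p v _); apply/funext => q.
have [Uq|nUq] := pselect (U q); first by rewrite YZ.
by rewrite one0 // !scale0r.
Qed.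

End Conn.
End FieldAlgebra.

Variables (n : nat) (M : dfspace R n).
Hypothesis MP : pre_manifold M.
Hypothesis Dc : is_connection (df_conn M).
Variable X : 'I_n -> M -> 'rV[R]_n.
Hypothesis Xp : forall i, parallel_field (X i).
Hypothesis Xu : forall p, \matrix_i X i p \in unitmx.

Let TP := TM_pre MP.
Let VP := rvspace_pre R n.
Let Xs i : smooth_field_on setT (X i) := (Xp i).1.

Lemma field_frame (Y : M -> 'rV[R]_n) q :
  Y q = \sum_i (frame_coord X ((q, Y q) : TM M)) 0 i *: X i q.
Proof. by rewrite frame_sum frame_coordK. Qed.

Lemma field_coord_msm (U : set M) (Y : M -> 'rV[R]_n) p : mopen U -> U p ->
  smooth_field_on U Y -> msm (fun q => frame_coord X ((q, Y q) : TM M)) p.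
Proof.
move=> Uo Up Ys; have s := section_msm MP Uo Up Ys.
by have [] := msm_comp MP TP s (frame_coord_msm MP Xs Xu (p, Y p)).
Qed.

(** Expand [Y] in the frame and apply the Leibniz rule: the fields of the frame
    are parallel, so only the derivatives of the coefficients remain. *)
Lemma conn_frame (U : set M) (Y : M -> 'rV[R]_n) p v : mopen U -> U p ->
  smooth_field_on U Y ->
  df_conn M p v Y = dmap (fun q => frame_coord X ((q, Y q) : TM M)) p v *m frame_mx X p.
Proof.
move=> Uo Up Ys; pose b q : rvspace R n := frame_coord X ((q, Y q) : TM M).
have bs q : U q -> msm b q by move=> Uq; exact: (field_coord_msm Uo Uq Ys).
have bsf i := msm_smooth_fun MP i Uo bs.
have XsU i : smooth_field_on U (X i).
  by apply: (smooth_field_onW (mopenT MP)).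
have [_ E] := @conn_lincomb _ _ _ Dc U n (fun i q => (b q : 'rV[R]_n) 0 i) X p v Uo Up bsf XsU.
have -> : Y = fun q => \sum_i (b q : 'rV[R]_n) 0 i *: X i q.
  by apply/funext => q; exact: field_frame.
apply: (etrans E).
have -> : (fun q => frame_coord X ((q, \sum_i (b q : 'rV[R]_n) 0 i *: X i q) : TM M)) = b.
  by apply/funext => q; rewrite frame_sum frame_coord_mul.
rewrite -frame_sum; apply: eq_bigr => i _.
rewrite (Xp i).2 scaler0 addr0; congr (_ *: _).
exact: (dmap_fun MP v i (bs p Up)).
Qed.

Lemma frame_connector : is_connector (df_conn M)
  (fun u A => dframe X u A *m frame_mx X u.1).
Proof.
split=> [u a A B|U Y p v Uo Up Ys].
  by rewrite /dframe dmapD dmapZ mulmxDl -scalemxAl.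
rewrite (conn_frame _ Uo Up Ys) /=; congr (_ *m _).
by apply: dframe_section => //; exact: section_msm Uo Up Ys.
Qed.

(** Coefficients with prescribed value at [p] and prescribed derivative in one
    coordinate direction: affine functions of one coordinate of a chart. *)
Lemma local_field p (b w : 'rV[R]_n) (i : 'I_n) :
  exists (U : set M) (be : M -> rvspace R n),
    [/\ mopen U, U p, forall q, U q -> msm be q, be p = b &
        dmap be p (delta_mx 0 i) = w].
Proof.
have [aM ap] := chart_atP MP p; have ac := chart_at_coord MP p.
set a := chart_at p in aM ap ac.
pose g (y : 'rV[R]_n) : 'rV[R]_n := b + (y 0 i - a p 0 i) *: w.
exists (cdom a), (fun q => g (a q)).
have gs y : smooth_at g y.
  apply: smooth_add; first exact: smooth_cst.
  apply: smooth_scale; last exact: smooth_cst.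
  apply: smooth_add; last exact: smooth_cst.
  exact: (smooth_coord _ _).1 (smooth_id _) i.
have E q : cdom a q -> {near a q, g =1 (fun q => g (a q)) \o cinv a}.
  by move=> aq; apply: filterS (coord_near ac aq) => y [_ yE]; rewrite /= yE.
split=> //; first exact: mopen_dom.
- move=> q aq; apply/(@msmP _ _ _ _ (rvspace R n) MP VP a (std_chart R n)
    (fun q => g (a q)) q ac (std_coord R n) aq I); split; first exact: near_all.
  exact: near_eq_smooth (E q aq) (gs _).
- by rewrite /g subrr scale0r addr0.
rewrite dmap_rv -/a.
have [_ ->] := near_eq_differentiable (E p ap) (smooth_diff (gs _)).
have c1 : differentiable (fun y : 'rV[R]_n => y 0 i - a p 0 i : R) (a p).
  by apply: differentiableB; [exact: differentiable_coord|exact: differentiable_cst].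
have cE : 'd (fun y : 'rV[R]_n => y 0 i - a p 0 i : R) (a p) (delta_mx 0 i) = 1.
  have /(congr1 (fun F => F (delta_mx 0 i))) := @diffB _ _ _
    (fun y : 'rV[R]_n => y 0 i : R) (cst (a p 0 i)) (a p)
    (differentiable_coord _ _ _) (differentiable_cst _ _).
  move=> h; apply: (etrans h); rewrite /= diff_cst /= subr0.
  have idE := (is_diffE (is_diff_id (a p))).2 (delta_mx 0 i).
  apply: (etrans (diff_coord (f := id) _ i (smooth_diff (smooth_id _)))).
  apply: (etrans (congr1 (fun u : 'rV[R]_n => u 0 i) idE)).
  by rewrite mxE !eqxx.
have h0 : is_diff (a p) (fun y : 'rV[R]_n => (y 0 i - a p 0 i) *: w)
    (fun v => 'd (fun y : 'rV[R]_n => y 0 i - a p 0 i : R) (a p) v *: w).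
  by apply: DiffDef; [exact: differentiableZl|exact: diffZl].
have [_ hE] := is_diffE (is_diffD (is_diff_cst b (a p)) h0).
apply: (etrans (hE _)); apply: (etrans (add0r _)).
by apply: (etrans (congr1 (fun z : R => z *: w) cE)); rewrite scale1r.
Qed.

(** The derivatives of sections do not form a linear space, but they span: [A] is
    the sum of the derivative [A1] of the section [Z] with constant coefficients
    through [u], in the direction of the horizontal part of [A], and of a
    difference [P - Q] of derivatives of two sections [Y] and [Z] in the same
    direction, [Y] being chosen with derivative of its coefficients [dframe A].
    A connector is determined on each of these by its definition. The index [i]
    only serves to have a nonzero direction; when [n = 0] there is nothing to
    prove. *)
Lemma connector_unique K u A : is_connector (df_conn M) K ->
  K u A = dframe X u A *m frame_mx X u.1.
Proof.
move=> KP; apply/rowP => i; have [Klin Ksec] := KP.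
have [K0lin K0sec] := frame_connector.
pose K0 (u : TM M) A := dframe X u A *m frame_mx X u.1.
have agree (U : set M) Z v : mopen U -> U u.1 -> smooth_field_on U Z -> Z u.1 = u.2 ->
    K u (dmap (fun q => (q, Z q) : TM M) u.1 v) = K0 u (dmap (fun q => (q, Z q) : TM M) u.1 v).
  move=> Uo Uu Zs Zu; have uE : u = (u.1, Z u.1) by rewrite Zu; case: (u).
  by rewrite {1 3}uE (Ksec U) // /K0 (K0sec U).
have [U [be [Uo Up bes bep bew]]] := local_field u.1 (frame_coord X u) (dframe X u A) i.
pose Y q := (be q : 'rV[R]_n) *m frame_mx X q.
have Ys : smooth_field_on U Y by exact: frame_comb_field.
pose Z q := frame_coord X u *m frame_mx X q.
have Zs : smooth_field_on setT Z.
  apply: (@frame_comb_field _ _ _ MP _ Xs setT (fun _ => frame_coord X u)).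
    exact: mopenT.
  by move=> q _; exact: (msm_cst VP _ _).1.
have Yu : Y u.1 = u.2 by rewrite /Y bep frame_coordK.
have Zu : Z u.1 = u.2 by exact: frame_coordK.
have Ysec := section_msm MP Uo Up Ys.
have Zsec := section_msm MP (mopenT MP) (I : setT u.1) Zs.
pose P := dmap (fun q => (q, Y q) : TM M) u.1 (delta_mx 0 i).
pose Q := dmap (fun q => (q, Z q) : TM M) u.1 (delta_mx 0 i).
pose A1 := dmap (fun q => (q, Z q) : TM M) u.1 (hor u A).
have dZ v : dframe X u (dmap (fun q => (q, Z q) : TM M) u.1 v) = 0.
  exact: (dframe_psection MP Xs Xu).
have hA1 : hor u A1 = hor u A by exact: hor_section_at.
have hP : hor u P = delta_mx 0 i by exact: hor_section_at.
have hQ : hor u Q = delta_mx 0 i by exact: hor_section_at.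
have dA1 : dframe X u A1 = 0 by exact: dZ.
have dQ : dframe X u Q = 0 by exact: dZ.
have dP : dframe X u P = dframe X u A.
  apply: etrans (dframe_section_at MP Xs Xu _ Ysec Yu) _.
  by rewrite -bew; apply: dmap_eq => q; rewrite frame_coord_mul.
have kA1 : K u A1 = K0 u A1 by apply: (agree setT) => //; exact: mopenT.
have kQ : K u Q = K0 u Q by apply: (agree setT) => //; exact: mopenT.
have kP : K u P = K0 u P by exact: (agree U).
clearbody A1 P Q.
have AE : A = 1 *: A1 + (-1 *: Q + P).
  have hl a B C : hor u (a *: B + C) = a *: hor u B + hor u C.
    by rewrite /hor dmapD dmapZ.
  have dl a B C : dframe X u (a *: B + C) = a *: dframe X u B + dframe X u C.
    by rewrite /dframe dmapD dmapZ.
  apply: (@hor_dframe_inj _ _ _ MP _ Xs Xu u); [rewrite !hl|rewrite !dl].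
    have gen (x y : 'rV[R]_n) : x = 1 *: x + (-1 *: y + y).
      by rewrite scale1r scaleN1r addNr addr0.
    by rewrite hA1 hP hQ; exact: gen.
  have gen (x : 'rV[R]_n) : x = 1 *: 0 + (-1 *: 0 + x).
    by rewrite !scaler0 !add0r.
  by rewrite dA1 dP dQ; exact: gen.
have K0l a B C : K0 u (a *: B + C) = a *: K0 u B + K0 u C by exact: K0lin.
have -> : K u A = K0 u A by rewrite AE !Klin kA1 kQ kP !K0l.
by [].
Qed.

Lemma connectorE u A : connector (df_conn M) u A = dframe X u A *m frame_mx X u.1.
Proof.
apply: connector_unique; rewrite /connector /choose_or.
case: pselect => [h|[]]; first exact: projT2 (cid h).
by exists (fun u A => dframe X u A *m frame_mx X u.1); exact: frame_connector.
Qed.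

Lemma ver_dframe (u : TM M) A B : ver u A = ver u B -> dframe X u A = dframe X u B.
Proof.
rewrite /ver !connectorE => /(congr1 (mulmx^~ (invmx (frame_mx X u.1)))).
by rewrite !mulmxK ?Xu.
Qed.

Lemma hor_ver_inj (u : TM M) A B : hor u A = hor u B -> ver u A = ver u B -> A = B.
Proof. by move=> h /ver_dframe; exact: (hor_dframe_inj MP Xs Xu). Qed.

Lemma hor_ver_onto (u : TM M) v w : exists A, hor u A = v /\ ver u A = w.
Proof.
have [A [hA dA]] := hor_dframe_onto MP Xs Xu u v (w *m invmx (frame_mx X u.1)).
by exists A; rewrite /ver connectorE dA mulmxKV ?Xu.
Qed.

(** The splitting into horizontal and vertical parts is bijective, so the vector
    that defines [TM_J] exists. *)
Lemma TM_JP (u : TM M) A : hor u (TM_J u A) = - ver u A /\ ver u (TM_J u A) = hor u A.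
Proof.
rewrite /TM_J /choose_or; case: pselect => [h|[]]; first exact: projT2 (cid h).
by have [B ?] := hor_ver_onto u (- ver u A) (hor u A); exists B.
Qed.

Lemma ver_linear (u : TM M) a A B : ver u (a *: A + B) = a *: ver u A + ver u B.
Proof. by rewrite /ver !connectorE /dframe dmapD dmapZ mulmxDl -scalemxAl. Qed.

Lemma hor_translation t (u : TM M) A :
  hor (translation X t u) (dmap (translation X t : TM M -> TM M) u A) = hor u A.
Proof.
rewrite /hor; have [_ E] := msm_comp TP TP (translation_msm MP Xs t u)
  (tproj_msm MP (translation X t u)).
by rewrite -E.
Qed.

(** A translation adds a constant to the frame coordinates, hence does not change
    their derivative. With [hor_translation], translations preserve the complex
    structure and the metric. *)
Lemma ver_translation t (u : TM M) A :
  ver (translation X t u) (dmap (translation X t : TM M -> TM M) u A) = ver u A.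
Proof.
rewrite /ver !connectorE /=; congr (_ *m _); rewrite /dframe.
have [_ E] := msm_comp TP TP (translation_msm MP Xs t u)
  (frame_coord_msm MP Xs Xu (translation X t u)).
rewrite -E.
rewrite (@dmap_eq _ _ _ _ _ _ ((fun s : rvspace R n => ((s : 'rV[R]_n) + t : rvspace R n))
  \o frame_coord X)).
  have [h1 h2] := dmap_shift t (frame_coord X u).
  have [_ ->] := msm_comp TP VP (frame_coord_msm MP Xs Xu u) h1.
  exact: h2.
by move=> w; rewrite /= frame_coord_translation.
Qed.

Lemma TM_J_translation t (u : TM M) A :
  dmap (translation X t : TM M -> TM M) u (TM_J u A) =
  TM_J (translation X t u) (dmap (translation X t : TM M -> TM M) u A).
Proof.
have [h1 v1] := TM_JP u A.
have [h2 v2] := TM_JP (translation X t u) (dmap (translation X t : TM M -> TM M) u A).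
apply: (@hor_ver_inj (translation X t u)).
  by rewrite h2 hor_translation ver_translation h1.
by rewrite v2 hor_translation ver_translation v1.
Qed.

Lemma TM_metric_translation t (u : TM M) A B :
  TM_metric (translation X t u) (dmap (translation X t : TM M -> TM M) u A)
    (dmap (translation X t : TM M -> TM M) u B) = TM_metric u A B.
Proof. by rewrite /TM_metric !hor_translation !ver_translation. Qed.

End Connector.

(** * Quotient manifolds *)

Section Quotients.
Variable R : realType.

Section Generic.
Variables (n : nat) (M : mspace R n) (Q : Type) (q : M -> Q).
Hypothesis MP : pre_manifold M.
Hypothesis deck : forall u u', q u = q u' ->
  exists g : M -> M, [/\ g u = u', forall w, msm g w & forall w, q (g w) = q w].
Hypothesis linj : forall u, exists U : set M, [/\ mopen U, U u &
  forall v w, U v -> U w -> q v = q w -> v = w].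
Hypothesis surj : forall x, exists u, q u = x.

Let QM := quotient_mspace q.

(** A chart of the quotient around [q u]: restrict a chart of [M] to an open set
    on which [q] is injective, and lift points to it. *)
Lemma quotient_chart (u : M) : exists (a : chart R M n) (U : set M) (c : chart R QM n),
  [/\ atlas M a, mopen U, U `<=` cdom a, U u &
  [/\ atlas QM c, cdom c = q @` U & forall w, U w -> c (q w) = a w /\ cinv c (a w) = q w]].
Proof.
have [aM au] := chart_atP MP u; set a := chart_at u in aM au.
have ac := atlas_coord MP aM.
have [U0 [U0o U0u U0inj]] := linj u.
pose U := U0 `&` cdom a.
have Uo : mopen U by apply: mopenI => //; exact: mopen_dom.
have Uinj v w : U v -> U w -> q v = q w -> v = w.
  by move=> [U0v _] [U0w _]; exact: U0inj.
pose lft x := choose_or u [set w | U w /\ q w = x].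
have lftP w : U w -> lft (q w) = w.
  move=> Uw; rewrite /lft /choose_or; case: pselect => [h|[]]; last by exists w.
  by have [Uw' qw'] := projT2 (cid h); exact: Uinj.
pose c : chart R QM n := @Chart R Q n (q @` U) (fun x => a (lft x)) (fun y => q (cinv a y)).
have cP w : U w -> c (q w) = a w /\ cinv c (a w) = q w.
  by move=> Uw; rewrite /= lftP // (coordK ac) //; case: Uw.
exists a, U, c; split=> //; first by move=> w [].
by split=> //; exists a, U; split=> // w [].
Qed.

Lemma quotient_valid (c : chart R QM n) : atlas QM c -> valid_chart c.
Proof.
move=> [a [U [aM Uo Ua Uinj [cU cP]]]]; split=> [x|].
  by rewrite cU => -[w Uw <-]; have [-> ->] := cP w Uw.
have -> : crange c = a @` (U `&` cdom a); last exact: Uo.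
rewrite /crange cU; apply/seteqP; split=> [_ [_ [w Uw <-] <-]|_ [w [Uw aw] <-]].
  by exists w; [split=> //; exact: Ua|have [->] := cP w Uw].
by exists (q w); [exists w|have [->] := cP w Uw].
Qed.

(** The transition map between two charts of the quotient is, near each point, the
    expression in the charts of [M] of a deck map relating the two lifts. *)
Lemma quotient_compat (c c' : chart R QM n) : atlas QM c -> atlas QM c' -> compatible c c'.
Proof.
move=> [a [U [aM Uo Ua Uinj [cU cP]]]] [a' [U' [a'M U'o U'a' U'inj [c'U' c'P]]]].
have ac := atlas_coord MP aM; have ac' := atlas_coord MP a'M.
have loc x : cdom c x -> cdom c' x -> exists u (g : M -> M), [/\ U u, q u = x, U' (g u),
    (forall w, msm g w) /\ (forall w, q (g w) = q w) &
    \forall y \near c x, [/\ U (cinv a y), a (cinv a y) = y & U' (g (cinv a y))]].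
  rewrite cU c'U' => -[u Uu <-] [u' Uu' qu].
  have [g [gu gs gq]] := deck (esym qu); exists u, g; split=> //; first by rewrite gu.
  have [-> _] := cP u Uu.
  have nU := (mnbhsP MP _ ac (Ua _ Uu)).1 ((mopenP MP U).1 Uo u Uu).
  have nU' : mnbhs u (fun w => U' (g w)).
    by apply: (msm_continuous MP MP (gs u)); rewrite gu; exact: (mopenP MP U').1.
  have {}nU' := (mnbhsP MP _ ac (Ua _ Uu)).1 nU'.
  apply: filterS (nbhs_setI nU (nbhs_setI nU' (coord_near ac (Ua _ Uu)))) => y.
  by move=> [? [? [_ ?]]].
rewrite /compatible; set W := _ @` _.
have Wo : open W.
  rewrite openE => _ [x [cx c'x] <-].
  have [u [g [Uu qu U'gu [gs gq] H]]] := loc x cx c'x.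
  apply: filterS H => y [Uy yE U'y].
  have [cy cy'] := cP _ Uy; exists (q (cinv a y)); last by rewrite cy.
  by rewrite cU c'U'; split; [exists (cinv a y)|exists (g (cinv a y))].
split=> //; apply/(smooth_onP _ Wo) => _ [x [cx c'x] <-].
have [u [g [Uu qu U'gu [gs gq] H]]] := loc x cx c'x.
have cxE : c x = a u by rewrite -qu; have [] := cP u Uu.
have [_ h] := (msmP MP MP ac ac' (Ua _ Uu) (U'a' _ U'gu)).1 (gs u).
rewrite -cxE in h; apply: near_eq_smooth h; apply: filterS H => y [Uy yE U'y] /=.
have [_] := cP _ Uy; rewrite yE => ->.
by have [<- _] := c'P _ U'y; rewrite gq.
Qed.

Lemma quotient_pre : pre_manifold QM.
Proof.
split; [exact: quotient_valid| |exact: quotient_compat].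
move=> x; have [u qu] := surj x.
have [a [U [c [aM Uo Ua Uu [cM cU cP]]]]] := quotient_chart u.
by exists c => //; rewrite cU -qu; exists u.
Qed.

(** In the charts of [quotient_chart] the projection is the identity; its derivative
    is therefore bijective. *)
Lemma quotient_msm u : msm (q : M -> QM) u /\
  (injective (dmap (q : M -> QM) u) /\ forall w, exists v, dmap (q : M -> QM) u v = w).
Proof.
have [a [U [c [aM Uo Ua Uu [cM cU cP]]]]] := quotient_chart u.
have QP := quotient_pre; have ac := atlas_coord MP aM; have cc := atlas_coord QP cM.
have au := Ua _ Uu; have cu : cdom c (q u) by rewrite cU; exists u.
have nU := (mnbhsP MP _ ac au).1 ((mopenP MP U).1 Uo u Uu).
have E : {near a u, id =1 c \o (q : M -> QM) \o cinv a}.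
  apply: filterS (nbhs_setI nU (coord_near ac au)) => y [Uy [_ yE]] /=.
  by have [-> _] := cP _ Uy.
have qs : msm (q : M -> QM) u.
  apply/(@msmP _ _ _ M QM MP QP a c q u ac cc au cu); split.
    by apply: filterS nU => y Uy; rewrite cU; exists (cinv a y).
  exact: near_eq_smooth E (smooth_id _).
have dE v : dchart c (q u : QM) (dmap (q : M -> QM) u v) = dchart a u v.
  apply: etrans (esym (dmapE MP QP v ac cc au cu qs)) _.
  have [_ E1] := near_eq_differentiable E (smooth_diff (smooth_id _)).
  exact: etrans (E1 (dchart a u v)) ((is_diffE (is_diff_id (a u))).2 (dchart a u v)).
split=> //; split=> [v w vw|w].
  by rewrite -(dchartK MP v ac au) -(dchartK MP w ac au) -!dE vw.
exists (coord_vec a (dchart c (q u : QM) w) u).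
have := dE (coord_vec a (dchart c (q u : QM) w) u).
rewrite (coord_vecK MP _ ac au) => h.
by rewrite -[LHS](dchartK QP _ cc cu) h (dchartK QP _ cc cu).
Qed.

Lemma quotient_descend d (N : mspace R d) (NP : pre_manifold N) (f : QM -> N) u :
  msm (f \o (q : M -> QM)) u -> msm f (q u).
Proof.
have [a [U [c [aM Uo Ua Uu [cM cU cP]]]]] := quotient_chart u.
have QP := quotient_pre; have ac := atlas_coord MP aM; have cc := atlas_coord QP cM.
have au := Ua _ Uu; have cu : cdom c (q u) by rewrite cU; exists u.
have b1 := chart_at_coord NP (f (q u)); have b2 := chart_at_dom NP (f (q u)).
have nU := (mnbhsP MP _ ac au).1 ((mopenP MP U).1 Uo u Uu).
have cuE : c (q u) = a u by have [] := cP u Uu.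
have E : \forall y \near a u, q (cinv a y) = cinv c y.
  apply: filterS (nbhs_setI nU (coord_near ac au)) => y [Uy [_ yE]].
  by rewrite -{2}yE; have [_ ->] := cP _ Uy.
move=> /(msmP MP NP ac b1 au b2) [h1 h2].
apply/(msmP QP NP cc b1 cu b2); rewrite cuE; split.
  by apply: filterS (nbhs_setI h1 E) => y [+ yE]; rewrite /= yE.
by apply: near_eq_smooth h2; apply: filterS E => y yE; rewrite /= yE.
Qed.

End Generic.
End Quotients.

(** * Tori and orbit spaces of parallel lattices *)

Section Lattices.
Variable R : realType.

Lemma half_half : 2^-1 + 2^-1 = 1 :> R.
Proof. by rewrite -[2^-1]mul1r -splitr. Qed.

Lemma int_lattice_coord n (k : 'rV[R]_n) j : k \in @int_lattice R n -> k 0 j \is a Num.int.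
Proof. by move=> /mxOverP; exact. Qed.

Lemma int_latticeP n (k : 'rV[R]_n) :
  (forall j, k 0 j \is a Num.int) -> k \in @int_lattice R n.
Proof. by move=> h; apply/mxOverP => i j; rewrite ord1. Qed.

(** The integral translations act properly discontinuously: in the next lemmas
    two points of a ball of radius 1/2 which are congruent are equal. *)
Lemma int_lattice_small n (k : 'rV[R]_n) : k \in @int_lattice R n -> `|k| < 1 -> k = 0.
Proof.
move=> kZ k1; apply/rowP => j; rewrite mxE.
have /intrP [m mE] := int_lattice_coord j kZ.
have := le_lt_trans (rV_coord_le k j) k1.
rewrite mE -intr_norm -[1]/(1%:~R) ltr_int => m1.
suff -> : m = 0 by [].
by apply/eqP; rewrite -absz_eq0; move: m1; rewrite -abszE; case: (absz m).
Qed.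

Lemma torus_pi_eq n (s t : 'rV[R]_n) :
  torus_pi s = torus_pi t <-> s - t \in @int_lattice R n.
Proof. by rewrite /torus_pi Quotient.idealrBE; split=> [/eqP|/eqP]. Qed.

Lemma torus_piD n (s t : 'rV[R]_n) : torus_pi (s + t) = torus_pi s + torus_pi t.
Proof. by rewrite /torus_pi piE. Qed.

Lemma torus_pi0 n : torus_pi (0 : 'rV[R]_n) = 0.
Proof. by apply: (addIr (torus_pi 0)); rewrite -torus_piD !add0r. Qed.

Lemma torus_pi_surj n (a : torus R n) : exists t, torus_pi t = a.
Proof. by exists (repr a); rewrite /torus_pi reprK. Qed.

Lemma torus_repr n (t : 'rV[R]_n) : t - repr (torus_pi t) \in @int_lattice R n.
Proof. by apply/torus_pi_eq; rewrite {2}/torus_pi reprK. Qed.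

Section TorusManifold.
Variable n : nat.

Let VP := rvspace_pre R n.

Lemma torus_deck (u u' : rvspace R n) : torus_pi (u : 'rV[R]_n) = torus_pi u' ->
  exists g : rvspace R n -> rvspace R n,
    [/\ g u = u', forall w, msm g w & forall w, torus_pi (g w : 'rV[R]_n) = torus_pi w].
Proof.
move=> /torus_pi_eq uZ; exists (fun w : rvspace R n => (w : 'rV[R]_n) + ((u' : 'rV[R]_n) - u)).
split=> [|w|w]; first exact: subrKC.
  exact: (dmap_shift _ _).1.
apply/torus_pi_eq; rewrite addrAC subrr add0r -opprB.
by rewrite rpredN.
Qed.

Lemma torus_linj (u : rvspace R n) : exists U : set (rvspace R n),
  [/\ mopen U, U u & forall v w : rvspace R n, U v -> U w ->
      torus_pi (v : 'rV[R]_n) = torus_pi w -> v = w].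
Proof.
exists (ball (u : 'rV[R]_n) 2^-1); split.
- apply/(mopenP VP) => p up; apply/rv_mnbhs.
  by apply: open_nbhs_nbhs; split=> //; exact: ball_open.
- by apply: ballxx; rewrite invr_gt0.
move=> v w uv uw /torus_pi_eq vwZ.
apply/eqP; rewrite -subr_eq0; apply/eqP; apply: int_lattice_small vwZ _.
have := ball_triangle (ball_sym uv) uw.
by rewrite half_half -ball_normE.
Qed.

Lemma torus_pre : pre_manifold (torus_mspace R n).
Proof. exact: (quotient_pre VP torus_deck torus_linj (@torus_pi_surj n)). Qed.

End TorusManifold.

End Lattices.

Section OrbitSpace.
Variable R : realType.
Variables (n : nat) (M : dfspace R n).
Hypothesis MP : pre_manifold M.
Hypothesis Dc : is_connection (df_conn M).
Variable X : 'I_n -> M -> 'rV[R]_n.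
Hypothesis Xp : forall i, parallel_field (X i).
Hypothesis Xu : forall p, \matrix_i X i p \in unitmx.

Let TP := TM_pre MP.
Let VP := rvspace_pre R n.
Let Xs i : smooth_field_on setT (X i) := (Xp i).1.

Lemma qL_eq (u u' : TM M) : qL X u = qL X u' <->
  exists2 k, k \in @int_lattice R n & u' = translation X k u.
Proof.
split=> [/(congr1 sval) /= E|[k kZ ->]].
  have : [set g u' | g in Gamma X] u'.
    exists (translation X 0); last exact: translation0.
    by exists 0 => //=; rewrite rpred0.
  by rewrite -E => -[_ [k kZ <-] <-]; exists k.
rewrite /qL.
have E : [set g u | g in Gamma X] = [set g (translation X k u) | g in Gamma X].
  apply/seteqP; split=> _ [_ [j jZ <-] <-].
    exists (translation X (j - k)).
      by exists (j - k) => //=; rewrite rpredB.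
    by rewrite translation_comp addrC subrK.
  exists (translation X (k + j)); first by exists (k + j) => //=; rewrite rpredD.
  by rewrite translation_comp.
exact: eq_exist.
Qed.

Lemma qL_translation k (u : TM M) : k \in @int_lattice R n ->
  qL X (translation X k u) = qL X u.
Proof. by move=> kZ; apply/esym/qL_eq; exists k. Qed.

Lemma qL_deck (u u' : TM M) : qL X u = qL X u' -> exists g : TM M -> TM M,
  [/\ g u = u', forall w, msm g w & forall w, qL X (g w) = qL X w].
Proof.
move=> /qL_eq [k kZ ->]; exists (translation X k); split=> // w.
  exact: translation_msm.
exact: qL_translation.
Qed.

Lemma qL_linj (u : TM M) : exists U : set (TM M), [/\ mopen U, U u &
  forall v w, U v -> U w -> qL X v = qL X w -> v = w].
Proof.
pose B := ball (frame_coord X u : 'rV[R]_n) (2^-1 : R).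
exists (fun w => B (frame_coord X w)); split.
- apply/(mopenP TP) => p up.
  apply: (msm_continuous TP VP (frame_coord_msm MP Xs Xu p)); apply/rv_mnbhs.
  by apply: open_nbhs_nbhs; split=> //; exact: ball_open.
- by apply: ballxx; rewrite invr_gt0.
move=> v w uv uw /qL_eq [k kZ wE].
have k1 : `|k| < 1.
  have := ball_triangle (ball_sym uv) uw.
  rewrite -ball_normE /= wE frame_coord_translation // opprD addrA subrr add0r normrN.
  by rewrite half_half.
by rewrite wE (int_lattice_small kZ k1) translation0.
Qed.

Lemma qL_surj (x : ML_type X) : exists u, qL X u = x.
Proof. by case: x => O [u uE]; exists u; apply: eq_exist; rewrite uE. Qed.

Lemma ML_pre : pre_manifold (ML X).
Proof. exact: (quotient_pre TP qL_deck qL_linj qL_surj). Qed.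

Lemma qL_msm u : msm (qL X : TM M -> ML X) u /\
  (injective (dmap (qL X : TM M -> ML X) u) /\
   forall w, exists v, dmap (qL X : TM M -> ML X) u v = w).
Proof. exact: (quotient_msm TP qL_deck qL_linj qL_surj). Qed.

Lemma dqL_translation k (u : TM M) A : k \in @int_lattice R n ->
  dqL X (translation X k u) (dmap (translation X k : TM M -> TM M) u A) = dqL X u A.
Proof.
move=> kZ; rewrite /dqL.
have [_ E] := msm_comp TP TP (translation_msm MP Xs k u) (qL_msm (translation X k u)).1.
rewrite -E; apply: (@dmap_eq _ _ _ _ (ML X)) => w.
exact: qL_translation.
Qed.

(** Two lifts of one tangent vector of the orbit space differ by an integral
    translation. As the structure of the tangent bundle is invariant under
    translations, this makes the quotient structure independent of the lifts
    ([ML_metricE], [ML_JE]). *)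
Lemma dqL_fibre (u u' : TM M) A A' : qL X u' = qL X u -> dqL X u' A' = dqL X u A ->
  exists2 k, k \in @int_lattice R n & u' = translation X k u /\
    A' = dmap (translation X k : TM M -> TM M) u A.
Proof.
move=> qE E; have /qL_eq [k kZ uE] : qL X u = qL X u' by exact: esym qE.
subst u'; exists k; first exact: kZ.
split; first exact: erefl.
have [_ [inj _]] := qL_msm (translation X k u).
by apply: inj; rewrite -[RHS]/(dqL X _ _) dqL_translation.
Qed.

Lemma ML_metricE (u : TM M) A B :
  ML_metric (qL X u : ML_mspace X) (dqL X u A) (dqL X u B) = TM_metric u A B.
Proof.
rewrite /ML_metric /choose_or; case: pselect => [h|[]]; last by exists (TM_metric u A B), u, A, B.
have [u' [A' [B' [qu dA dB ->]]]] := projT2 (cid h).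
have [k kZ [uE AE]] := dqL_fibre qu dA; subst u'.
have [_ [inj _]] := qL_msm (translation X k u).
have BE : B' = dmap (translation X k : TM M -> TM M) u B.
  have e := etrans dB (esym (@dqL_translation k u B kZ)).
  by apply: inj; exact: e.
rewrite AE BE; exact: (TM_metric_translation MP Dc Xp Xu).
Qed.

Lemma ML_JE (u : TM M) A : ML_J (qL X u : ML_mspace X) (dqL X u A) = dqL X u (TM_J u A).
Proof.
rewrite /ML_J /choose_or; case: pselect => [h|[]]; last by exists (dqL X u (TM_J u A)), u, A.
have [u' [A' [qu dA ->]]] := projT2 (cid h).
have [k kZ [uE ->]] := dqL_fibre qu dA; subst u'.
apply: etrans _ (@dqL_translation k u (TM_J u A) kZ).
congr (dqL X _ _); exact: esym (TM_J_translation MP Dc Xp Xu k u A).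
Qed.

Lemma ML_actionE t (u : TM M) :
  ML_action (torus_pi t) (qL X u : ML X) = qL X (translation X t u).
Proof.
rewrite /ML_action.
have /qL_eq [k kZ ->] : qL X u = qL X (ML_lift (qL X u : ML X)).
  rewrite /ML_lift; case: cid => v /= vE; rewrite /qL; apply: eq_exist; exact: vE.
rewrite translation_comp; apply/esym/qL_eq.
exists (k + repr (torus_pi t) - t); last by rewrite translation_comp [t + _]addrC subrK.
rewrite -addrA rpredD //.
by rewrite -opprB rpredN; exact: torus_repr.
Qed.

End OrbitSpace.

(** * Compatible coverings and the tangent lift of a map *)

Section Coverings.
Variable R : realType.

Record frame_of n (M : dfspace R n) (X : 'I_n -> M -> 'rV[R]_n) : Prop := FrameOf {
  frame_parallel : forall i, parallel_field (X i);
  frame_unit : forall p, \matrix_i X i p \in unitmx }.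

(** All that is used about a compatible covering, without reference to the orbit
    space through which it is defined. *)
Record kahler_covering n (M : dfspace R n) (X : 'I_n -> M -> 'rV[R]_n)
    (N : kspace R n) (Phi : torus R n -> N -> N) (tau : TM M -> N) : Prop := KahlerCovering {
  cov_msm : forall u, msm tau u;
  cov_J : forall u A, k_J N (tau u) (dmap tau u A) = dmap tau u (TM_J u A);
  cov_metric : forall u A B,
    k_metric N (tau u) (dmap tau u A) (dmap tau u B) = TM_metric u A B;
  cov_inj : forall u A, dmap tau u A = 0 -> A = 0;
  cov_onto : forall u w, exists A, dmap tau u A = w;
  cov_free : forall u, free_points Phi (tau u);
  cov_surj : forall x, free_points Phi x -> exists u, tau u = x;
  cov_fibre : forall u u', tau u = tau u' <->
    exists2 k, k \in @int_lattice R n & u' = translation X k u;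
  cov_equiv : forall t u, tau (translation X t u) = Phi (torus_pi t) (tau u) }.

Lemma linear_inj_onto m (L : 'rV[R]_m -> 'rV[R]_m) : linear L ->
  (forall v, L v = 0 -> v = 0) -> forall w, exists v, L v = w.
Proof.
move=> Ll inj w; pose LM := GRing.isLinear.Build _ _ _ _ _ Ll.
pose LL : {linear 'rV[R]_m -> 'rV[R]_m} := HB.pack L LM.
have U : lin1_mx LL \in unitmx.
  rewrite -row_free_unit -kermx_eq0; apply/eqP/row_matrixP => i.
  rewrite row0; apply: inj; rewrite -[L _]/(LL _) -mul_rV_lin1 -row_mul.
  by rewrite mulmx_ker row0.
exists (w *m invmx (lin1_mx LL)).
by rewrite -[L _]/(LL _) -mul_rV_lin1 mulmxKV.
Qed.

Lemma TM_metric_eq0 n (M : dfspace R n) (u : TM M) A :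
  is_riemannian (df_metric M) -> TM_metric u A A = 0 -> hor u A = 0 /\ ver u A = 0.
Proof.
move=> [hlin hsym hpos _].
have h0 p : df_metric M p 0 0 = 0.
  by have := hlin p (-1) 0 0 0; rewrite scaler0 addr0 mulN1r addNr.
have hge p v : 0 <= df_metric M p v v.
  by have [->|/hpos/ltW//] := eqVneq v 0; rewrite h0.
have heq p v : df_metric M p v v = 0 -> v = 0.
  by move=> E; have [//|v0] := eqVneq v 0; have := hpos p v v0; rewrite E ltxx.
rewrite /TM_metric => /eqP; rewrite paddr_eq0 // => /andP[/eqP a /eqP b].
by split; [exact: heq a|exact: heq b].
Qed.

(** Everything is transported from the orbit space by the isomorphism [F]. That
    the derivative of [tau] is injective, hence bijective, follows from its being
    isometric. *)
Lemma compatible_covering_kahler n (M : dfspace R n) (N : kspace R n)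
    (Phi : torus R n -> N -> N) (tau : TM M -> N) :
  dually_flat M -> is_manifold N -> compatible_covering Phi tau ->
  exists2 X, frame_of X & kahler_covering X Phi tau.
Proof.
move=> [Mman Mriem Dc _ _] Nman [L [X [F [[[Xp Xu _] [Fs [G [_ Ffree GF FG]]] [_ Fhol] Fiso Fact] tauE]]]].
have MP := manifold_pre Mman; have NP := manifold_pre Nman.
have QP := ML_pre MP Xp Xu.
have Fm x : msm F x by exact: (smooth_mapP QP NP F).1 Fs x.
have qm u := (qL_msm MP Xp Xu u).1.
have tm u : msm (F \o (qL X : TM M -> ML X)) u /\ forall A,
    dmap (F \o (qL X : TM M -> ML X)) u A = dmap F (qL X u : ML X) (dqL X u A).
  exact: (msm_comp (TM_pre MP) QP (qm u) (Fm _)).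
have metE u A B : k_metric N (F (qL X u : ML X)) (dmap F (qL X u : ML X) (dqL X u A))
    (dmap F (qL X u : ML X) (dqL X u B)) = TM_metric u A B.
  by rewrite Fiso; exact: ML_metricE.
have inj u A : dmap (F \o (qL X : TM M -> ML X)) u A = 0 -> A = 0.
  move=> A0.
  have : TM_metric u A A = TM_metric u 0 0.
    rewrite -!metE -!(tm u).2 A0; congr (k_metric N _ _ _); by rewrite dmap0.
  have z : TM_metric u 0 0 = 0.
    have hz : hor u 0 = 0 by exact: dmap0.
    have vz : ver u 0 = 0.
      have := ver_linear MP Dc Xp Xu u (-1) 0 0.
      by rewrite scaler0 addr0 scaleN1r addNr.
    have [hlin _ _ _] := Mriem.
    rewrite /TM_metric hz vz; have := hlin u.1 (-1) 0 0 0.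
    by rewrite scaler0 addr0 mulN1r addNr => ->; rewrite addr0.
  rewrite z => /(TM_metric_eq0 Mriem) [hA vA].
  apply: (@hor_ver_inj _ _ _ MP Dc _ Xp Xu u); rewrite ?hA ?vA.
    by rewrite /hor dmap0.
  have := ver_linear MP Dc Xp Xu u (-1) 0 0.
  by rewrite scaler0 addr0 scaleN1r addNr.
exists X; first by split.
rewrite tauE; split.
- by move=> u; case: (tm u).
- move=> u A; rewrite !(tm u).2 -(ML_JE MP Dc Xp Xu u A).
  exact: esym (Fhol _ _).
- by move=> u A B; rewrite !(tm u).2; exact: metE.
- exact: inj.
- by move=> u; apply: linear_inj_onto; [exact: dmap_linear|exact: inj].
- by move=> u; exact: Ffree.
- move=> x /FG Fx; have [u qu] := qL_surj (G x : ML_type X).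
  by exists u; rewrite /= qu.
- move=> u u'; rewrite -(qL_eq X); split=> [/= /(congr1 G)|/= ->//].
  by rewrite !GF.
- move=> t u /=; rewrite -Fact; congr (F _).
  exact: esym (ML_actionE X t u).
Qed.

End Coverings.

Section TangentLift.
Variable R : realType.
Variables (n d : nat) (M : dfspace R n) (M' : dfspace R d).
Hypotheses (MP : pre_manifold M) (MP' : pre_manifold M').
Hypotheses (Dc : is_connection (df_conn M)) (Dc' : is_connection (df_conn M')).
Variables (X : 'I_n -> M -> 'rV[R]_n) (X' : 'I_d -> M' -> 'rV[R]_d).
Hypotheses (XF : frame_of X) (XF' : frame_of X').
Variable f : M -> M'.
Hypothesis fs : forall p, msm f p.

Let TP := TM_pre MP.
Let TP' := TM_pre MP'.
Let Xp := frame_parallel XF.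
Let Xu := frame_unit XF.
Let Xp' := frame_parallel XF'.
Let Xu' := frame_unit XF'.
Let Xs i : smooth_field_on setT (X i) := (Xp i).1.
Let Xs' i : smooth_field_on setT (X' i) := (Xp' i).1.

(** The rows of the matrix of [df] in the two parallel frames. *)
Definition frame_diff (i : 'I_n) (p : M) : rvspace R d :=
  frame_coord X' (tmap f ((p, X i p) : TM M)).

Lemma frame_diffE i p : dmap f p (X i p) = (frame_diff i p : 'rV[R]_d) *m frame_mx X' (f p).
Proof.
exact: esym (frame_coordK Xu' (tmap f ((p, X i p) : TM M))).
Qed.

Lemma dmap_frame p (a : 'rV[R]_n) :
  dmap f p (a *m frame_mx X p) =
  (\sum_i a 0 i *: (frame_diff i p : 'rV[R]_d)) *m frame_mx X' (f p).
Proof.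
have dl u v : dmap f p (u + v) = dmap f p u + dmap f p v by exact: dmapD.
rewrite -frame_sum mulmx_suml.
rewrite (big_morph (dmap f p) dl (dmap0 f p)).
by apply: eq_bigr => i _; rewrite dmapZ frame_diffE scalemxAl.
Qed.

Lemma frame_coord_tmap (u : TM M) : frame_coord X' (tmap f u) =
  \sum_i (frame_coord X u) 0 i *: (frame_diff i u.1 : 'rV[R]_d).
Proof.
rewrite {1}/frame_coord /= -{1}(frame_coordK Xu u) dmap_frame.
by rewrite mulmxK ?Xu'.
Qed.

Lemma frame_diff_msm i p : msm (frame_diff i) p.
Proof.
have s := section_msm MP (mopenT MP) (I : setT p) (Xs i).
have [h _] := msm_comp MP TP s (tmap_msm MP MP' ((p, X i p) : TM M) fs).
have [h' _] := msm_comp MP TP' h (frame_coord_msm MP' Xs' Xu' (tmap f ((p, X i p) : TM M))).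
exact: h'.
Qed.

Lemma hor_tmap (u : TM M) A : hor (tmap f u) (dmap (tmap f) u A) = dmap f u.1 (hor u A).
Proof.
rewrite /hor.
have [_ E1] := msm_comp TP TP' (tmap_msm MP MP' u fs) (tproj_msm MP' (tmap f u)).
have [_ E2] := msm_comp TP MP (tproj_msm MP u) (fs u.1).
exact: etrans (esym (E1 A)) (E2 A).
Qed.

(** Differentiate the identity [frame_coord_tmap], a product of the coordinates of
    [u] and of the matrix of [df], which depends on the foot point only. *)
Lemma dframe_tmap (u : TM M) A : dframe X' (tmap f u) (dmap (tmap f) u A) =
  \sum_i (dframe X u A) 0 i *: (frame_diff i u.1 : 'rV[R]_d) +
  \sum_i (frame_coord X u : 'rV[R]_n) 0 i *: dmap (frame_diff i) u.1 (hor u A).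
Proof.
have [_ E1] := msm_comp TP TP' (tmap_msm MP MP' u fs)
  (frame_coord_msm MP' Xs' Xu' (tmap f u)).
have bs i := msm_comp TP MP (tproj_msm MP u) (frame_diff_msm i u.1).
have [_ E2] := dmap_lincomb TP (frame_coord_msm MP Xs Xu u) (fun i => (bs i).1).
apply: etrans (esym (E1 A)) _.
rewrite (@dmap_eq _ _ _ _ _ _ (fun w : TM M => (\sum_i (frame_coord X w : 'rV[R]_n) 0 i *:
    ((frame_diff i \o @tproj R n M) w : 'rV[R]_d) : rvspace R d))); last first.
  by move=> w; exact: frame_coord_tmap.
apply: etrans (E2 A) _; congr (_ + _).
by apply: eq_bigr => i _; congr (_ *: _); exact: (bs i).2.
Qed.

(** The failure of the tangent lift to respect vertical parts. It vanishes for all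
    [u] and [v] if and only if the matrix of [df] is locally constant. *)
Definition second_form (u : TM M) (v : 'rV[R]_n) : 'rV[R]_d :=
  (\sum_i (frame_coord X u : 'rV[R]_n) 0 i *: dmap (frame_diff i) u.1 v)
    *m frame_mx X' (f u.1).

Lemma ver_tmap (u : TM M) A : ver (tmap f u) (dmap (tmap f) u A) =
  dmap f u.1 (ver u A) + second_form u (hor u A).
Proof.
rewrite /ver (connectorE MP' Dc' Xp' Xu') dframe_tmap mulmxDl; congr (_ + _).
by rewrite (connectorE MP Dc Xp Xu) dmap_frame.
Qed.

(** Compare horizontal and vertical parts of both sides. If [tmap f] is holomorphic
    at [u = X i p], a vector with horizontal part [v] and vertical part 0 gives
    [second_form u v = 0], which is the derivative of the [i]-th row. *)
Lemma tmap_holomorphic :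
  (forall u A, dmap (tmap f) u (TM_J u A) = TM_J (tmap f u) (dmap (tmap f) u A)) <->
  (forall i p v, dmap (frame_diff i) p v = 0).
Proof.
split=> [H i p v|H u A].
  pose u : TM M := (p, X i p).
  have [A [hA vA]] := hor_ver_onto MP Dc Xp Xu u v 0.
  have := congr1 (hor (tmap f u)) (H u A).
  rewrite hor_tmap (TM_JP MP' Dc' Xp' Xu' _ _).1 ver_tmap.
  rewrite (TM_JP MP Dc Xp Xu _ _).1 vA hA oppr0 dmap0 add0r => /esym/eqP.
  rewrite oppr_eq0 => /eqP /(congr1 (mulmx^~ (invmx (frame_mx X' (f u.1))))).
  rewrite mul0mx /second_form mulmxK ?Xu' //.
  have uE : frame_coord X u = delta_mx 0 i.
    rewrite /frame_coord /= -[X i p](rowK (fun i => X i p)) rowE mulmxK ?Xu //.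
  rewrite uE (bigD1 i) //= mxE !eqxx scale1r big1 ?addr0 // => j ji.
  by rewrite mxE (negbTE ji) andbF scale0r.
have S0 (w : TM M) v : second_form w v = 0.
  by rewrite /second_form big1 ?mul0mx // => i _; rewrite H scaler0.
apply: (@hor_ver_inj _ _ _ MP' Dc' _ Xp' Xu' (tmap f u)).
  rewrite hor_tmap (TM_JP MP' Dc' Xp' Xu' _ _).1 ver_tmap (TM_JP MP Dc Xp Xu _ _).1.
  by rewrite S0 addr0 dmapN.
rewrite ver_tmap (TM_JP MP' Dc' Xp' Xu' _ _).2 hor_tmap (TM_JP MP Dc Xp Xu _ _).2.
by rewrite S0 addr0.
Qed.

Lemma tmap_isometric :
  (forall i p v, dmap (frame_diff i) p v = 0) ->
  isometric (df_metric M) (df_metric M') f ->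
  forall u A B, TM_metric (tmap f u) (dmap (tmap f) u A) (dmap (tmap f) u B)
    = TM_metric u A B.
Proof.
move=> H iso u A B.
have S0 v : second_form u v = 0.
  by rewrite /second_form big1 ?mul0mx // => i _; rewrite H scaler0.
by rewrite /TM_metric !hor_tmap !ver_tmap !S0 !addr0 /= !iso.
Qed.

(** Test on vertical vectors, where the second form does not intervene. *)
Lemma isometric_of_tmap : is_riemannian (df_metric M) -> is_riemannian (df_metric M') ->
  (forall u A B, TM_metric (tmap f u) (dmap (tmap f) u A) (dmap (tmap f) u B)
    = TM_metric u A B) ->
  isometric (df_metric M) (df_metric M') f.
Proof.
move=> [hlin _ _ _] [hlin' _ _ _] H p v w; pose u : TM M := (p, 0).
have h0 x : df_metric M p 0 x = 0.
  by have := hlin p (-1) 0 0 x; rewrite scaler0 addr0 mulN1r addNr.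
have h0' x : df_metric M' (f p) 0 x = 0.
  by have := hlin' (f p) (-1) 0 0 x; rewrite scaler0 addr0 mulN1r addNr.
have [A [hA vA]] := hor_ver_onto MP Dc Xp Xu u 0 v.
have [B [hB vB]] := hor_ver_onto MP Dc Xp Xu u 0 w.
have S0 : second_form u 0 = 0.
  by rewrite /second_form big1 ?mul0mx // => i _; rewrite dmap0 scaler0.
have := H u A B.
by rewrite /TM_metric !hor_tmap !ver_tmap hA hB vA vB !S0 !addr0 !dmap0 /= h0 h0' !add0r.
Qed.

End TangentLift.

(** * Closed subgroups of a vector space *)

Section TorsionPoints.
Variable R : realType.

(** The pigeonhole principle: among [N + 2] multiples of [b] two have fractional
    parts in the same interval of length [1 / (N + 1)]. *)
Lemma dirichlet (b : R) N : exists (q : nat) (m : int),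
  (0 < q)%N /\ `|b *+ q - m%:~R| < N.+1%:R^-1.
Proof.
pose M : R := N.+1%:R; have M0 : 0 < M by rewrite ltr0n.
pose fr (k : nat) : R := b *+ k - (Num.floor (b *+ k))%:~R.
have fr01 k : 0 <= fr k < 1.
  by have /andP[h1 h2] := floor_itv (b *+ k); rewrite subr_ge0 h1 ltrBlDl; move: h2; rewrite intrD.
have cellP k : (Num.truncn (M * fr k) < N.+1)%N.
  have /andP[h1 h2] := fr01 k.
  rewrite truncn_lt_nat ?mulr_ge0 // ?ltW // -/M.
  by rewrite -[ltRHS]mulr1 ltr_pM2l.
pose cell (k : 'I_N.+2) : 'I_N.+1 := Ordinal (cellP k).
have /injectivePn [k [l kl cE]] : ~~ injectiveb cell.
  by apply/negP => /injectiveP /leq_card; rewrite !card_ord ltnn.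
wlog lk : k l kl cE / (l < k)%N.
  move=> H; have := kl; rewrite -val_eqE neq_ltn => /orP[h|h].
    by apply: (H l k); rewrite // eq_sym.
  exact: (H k l).
exists (k - l)%N, (Num.floor (b *+ k) - Num.floor (b *+ l)).
rewrite subn_gt0; split=> //.
have -> : b *+ (k - l) - (Num.floor (b *+ k) - Num.floor (b *+ l))%:~R = fr k - fr l.
  rewrite mulrnBr ?(ltnW lk) // intrB /fr.
  move: (b *+ k) (b *+ l) => x y; lra.
have /(congr1 val) /= tE := cE.
have /andP[k1 k2] : (Num.truncn (M * fr k))%:R <= M * fr k < (Num.truncn (M * fr k)).+1%:R.
  by apply: truncn_itv; apply: mulr_ge0; [exact: ltW|case/andP: (fr01 k)].
have /andP[l1 l2] : (Num.truncn (M * fr l))%:R <= M * fr l < (Num.truncn (M * fr l)).+1%:R.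
  by apply: truncn_itv; apply: mulr_ge0; [exact: ltW|case/andP: (fr01 l)].
rewrite -(ltr_pM2l M0) divff ?gt_eqF // -[X in X * `|_|](gtr0_norm M0) -normrM mulrBr.
move: k1 k2 l1 l2; rewrite tE -!natr1 => *; rewrite ltr_norml; apply/andP; split; lra.
Qed.

(** Either some multiple of [b] is an integer, or [B] contains arbitrarily small
    positive numbers by [dirichlet], and then their multiples approximate any
    number, for instance 1/2. *)
Lemma subgroup_dichotomy (B : set R) (b : R) :
  (forall x y, B x -> B y -> B (x - y)) -> (forall m : int, B m%:~R) ->
  B b -> b \isn't a Num.int ->
  (exists c q, [/\ B c, c \isn't a Num.int, (0 < q)%N & c *+ q \is a Num.int]) \/
  (forall e, 0 < e -> exists2 c, B c & `|c - 2^-1| < e).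
Proof.
move=> Bsub Bint Bb bZ.
have B0 : B 0 by have := Bint 0.
have BN x : B x -> B (- x) by move=> Bx; rewrite -sub0r; exact: Bsub.
have BD x y : B x -> B y -> B (x + y) by move=> Bx /BN By; rewrite -[y]opprK; exact: Bsub.
have Bn x k : B x -> B (x *+ k).
  by move=> Bx; elim: k => [|k IH]; rewrite ?mulr0n // mulrSr; exact: BD.
case: (pselect (exists q, (0 < q)%N /\ b *+ q \is a Num.int)) => [[q [q0 bq]]|nrat].
  by left; exists b, q.
right=> e e0.
pose N := Num.truncn e^-1.
have Ne : N.+1%:R^-1 < e.
  by rewrite -[ltRHS]invrK ltf_pV2 ?posrE ?invr_gt0 ?ltr0n // truncnS_gt.
have [q [m [q0 qm]]] := dirichlet b N.
pose c := b *+ q - m%:~R.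
have Bc : B c by apply: Bsub => //; exact: Bn.
have c0 : c != 0.
  apply/negP => /eqP c0; apply: nrat; exists q; split=> //.
  by have /eqP := c0; rewrite subr_eq0 => /eqP ->; apply: intr_int.
pose d := `|c|; have d0 : 0 < d by rewrite normr_gt0.
have Bd : B d.
  rewrite /d; have [c_ge0|/ltW c_le0] := leP 0 c; first by rewrite (ger0_norm c_ge0).
  by rewrite (ler0_norm c_le0); exact: BN.
have dlt : d < e by exact: lt_trans qm Ne.
pose k := Num.truncn (2^-1 / d).
exists (d *+ k); first exact: Bn.
have /andP[h1 h2] : k%:R <= 2^-1 / d < k.+1%:R.
  by apply: truncn_itv; rewrite divr_ge0 // ltW.
move: h1 h2; rewrite ler_pdivlMr // ltr_pdivrMr // -[k.+1%:R]natr1 mulrDl mul1r mulr_natl => h1 h2.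
rewrite ltr_norml; apply/andP; split; lra.
Qed.

(** A closed subgroup containing the integral vectors and another vector contains
    a rational vector which is not integral. Induct on the number [j] of first
    coordinates of [b] which may fail to be integers. If the induction hypothesis
    does not apply, an element of [A] whose coordinates from the [j]-th on are
    integers is itself integral ([star]). Consider then the values of the [j]-th
    coordinate on the elements of [A] whose further coordinates are integers.
    Either some value is rational and not an integer, and [star] applies to a
    multiple of such an element; or the values approximate 1/2, and by
    compactness some element has this coordinate equal to 1/2, so that [star]
    applies to its double. *)
Lemma closed_subgroup_torsion n (A : set 'rV[R]_n) (a : 'rV[R]_n) :
  (forall x y, A x -> A y -> A (x - y)) -> {in @int_lattice R n, forall k, A k} ->
  closed A -> A a -> a \notin @int_lattice R n ->
  exists t q, [/\ A t, t \notin @int_lattice R n, (0 < q)%N &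
    t *+ q \in @int_lattice R n].
Proof.
move=> Asub Aint Acl Aa aZ.
have A0 : A 0 by apply: Aint; exact: rpred0.
have AN x : A x -> A (- x) by move=> Ax; rewrite -sub0r; exact: Asub.
have AD x y : A x -> A y -> A (x + y) by move=> Ax /AN Ay; rewrite -[y]opprK; exact: Asub.
have An x k : A x -> A (x *+ k).
  by move=> Ax; elim: k => [|k IH]; rewrite ?mulr0n // mulrSr; exact: AD.
suff key j : forall b, A b -> b \notin @int_lattice R n ->
    (forall i : 'I_n, (j <= i)%N -> b 0 i \is a Num.int) ->
    exists t q, [/\ A t, t \notin @int_lattice R n, (0 < q)%N &
      t *+ q \in @int_lattice R n].
  by apply: (key n a) => // i; rewrite leqNgt ltn_ord.
elim: j => [|j IH] b Ab bZ bi.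
  by case/negP: bZ; apply: int_latticeP => i; exact: bi.
have [jn|nj] := ltnP j n; last first.
  by apply: (IH b) => // i ji; have := leq_trans nj ji; rewrite leqNgt ltn_ord.
pose jo := Ordinal jn.
case: (pselect (exists b', [/\ A b', b' \notin @int_lattice R n &
    forall i : 'I_n, (j <= i)%N -> b' 0 i \is a Num.int])) => [[b' [? ? ?]]|none].
  exact: (IH b').
have star x : A x -> (forall i : 'I_n, (j <= i)%N -> x 0 i \is a Num.int) ->
    x \in @int_lattice R n.
  by move=> Ax xi; apply/negPn/negP => xZ; apply: none; exists x.
have jle (i : 'I_n) : (j <= i)%N -> i = jo \/ (j < i)%N.
  by rewrite leq_eqVlt => /orP[/eqP h|]; [left; exact: val_inj|right].
pose B : set R := [set r | exists2 x, A x & x 0 jo = r /\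
  forall i : 'I_n, (j < i)%N -> x 0 i \is a Num.int].
have [||||[c [q [[x Ax [xc xi]] cZ q0 cq]]]|half] := @subgroup_dichotomy B (b 0 jo).
- move=> _ _ [x Ax [<- xi]] [y Ay [<- yi]]; exists (x - y); first exact: Asub.
  by split=> [|i ji]; rewrite !mxE // rpredB ?xi ?yi.
- move=> m; exists (m%:~R *: delta_mx 0 jo).
    by apply: Aint; apply: int_latticeP => i; rewrite !mxE rpredM ?intr_int // natr_int.
  split=> [|i ji]; rewrite !mxE ?eqxx ?mulr1 //.
  by rewrite rpredM ?intr_int // natr_int.
- by exists b.
- apply/negP => bj; case/negP: bZ; apply: star => // i /jle [->//|]; exact: bi.
- exists x, q; split=> //.
    by apply/negP => /(int_lattice_coord jo); rewrite xc (negbTE cZ).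
  apply: star; first exact: An.
  move=> i /jle [->|ji]; first by rewrite mulmxnE xc.
  by rewrite mulmxnE rpredMn // xi.
(* The first coordinates can be reduced modulo 1, the next ones to 0. *)
pose Ki (i : 'I_n) : set R :=
  if (i <= j)%N then `[(0 : R), 1]%classic else `[(0 : R), 0]%classic.
pose K0 : set 'rV[R]_n := [set v : 'rV[R]_n | forall i, Ki i (v ord0 i)].
have K0c : compact K0.
  by apply: rV_compact => i; rewrite /Ki; case: ifP => _; exact: segment_compact.
pose K := K0 `&` A.
have Kc : compact K by exact: compact_closedI.
have Kapp e : 0 < e -> exists2 x, K x & `|x 0 jo - 2^-1| < e.
  move=> e0; pose e' := Num.min e (4^-1).
  have e'0 : 0 < e' by rewrite lt_min e0 invr_gt0 ltr0n.
  have [c [x Ax [xc xi]] ce'] := half e' e'0.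
  have [ce c4] : `|c - 2^-1| < e /\ `|c - 2^-1| < 4^-1.
    by move: ce'; rewrite lt_min => /andP[].
  have c01 : 0 <= c < 1.
    by move: c4; rewrite ltr_norml => /andP[? ?]; apply/andP; split; lra.
  pose y : 'rV[R]_n := \row_i (x 0 i - (Num.floor (x 0 i))%:~R).
  have yj : y 0 jo = c.
    by rewrite mxE xc (floor_def (m := 0)) ?subr0 // add0r.
  exists y; last by rewrite yj.
  split.
    move=> i; rewrite /Ki; case: ifP => ij; rewrite mxE /= in_itv /=.
      have /andP[h1 h2] := floor_itv (x 0 i); rewrite subr_ge0 h1 lerBlDl.
      by move: h2; rewrite intrD => /ltW.
    have /xi /intrP [m ->] : (j < i)%N by rewrite ltnNge ij.
    by rewrite intrKfloor subrr lexx.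
  have -> : y = x - \row_i (Num.floor (x 0 i))%:~R.
    by apply/rowP => i; rewrite !mxE.
  by apply: Asub => //; apply: Aint; apply: int_latticeP => i; rewrite mxE intr_int.
have Kne : K !=set0 by have [x Kx _] := Kapp 1 ltr01; exists x.
have [|x Kx xmin] := @EVT_min_rV R n (fun x => `|x 0 jo - 2^-1|) K Kne Kc.
  apply: continuous_subspaceT => x.
  apply: (@continuous_comp _ _ _ (fun x : 'rV[R]_n => x 0 jo - 2^-1 : R) (fun r : R => `|r|)).
    apply: (@continuousB _ _ _ (fun x : 'rV[R]_n => x 0 jo : R) (fun _ => 2^-1)).
      exact: coord_continuous.
    exact: cst_continuous.
  exact: norm_continuous.
have [K0x Ax] : K x by rewrite inE in Kx.
have xj : x 0 jo = 2^-1.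
  apply/eqP; rewrite -subr_eq0 -normr_eq0; apply/negPn/negP => xj.
  have : 0 < `|x 0 jo - 2^-1| by rewrite lt0r xj normr_ge0.
  move=> /Kapp [y Ky]; apply/negP; rewrite -leNgt; apply: xmin; by rewrite inE.
exists x, 2%N; split=> //.
  apply/negP => /(int_lattice_coord jo); rewrite xj => /intrP [m mE].
  have : (2%:~R * m%:~R : R) = 1%:~R by rewrite -mE mulfV // pnatr_eq0.
  rewrite -intrM => /intr_inj; case: m {mE} => m; lia.
apply: star; first exact: An.
move=> i /jle [->|ji].
  by rewrite mulmxnE xj mulr2n half_half rpred1.
have := K0x i; rewrite /Ki leqNgt ji /= in_itv /= => /andP[h1 h2].
by rewrite mulmxnE (le_anti (introT andP (conj h2 h1))) mul0rn rpred0.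
Qed.

End TorsionPoints.

(** * Density of the free points *)

Section Density.
Variable R : realType.

(** Disjoint neighbourhoods of the two values pull back to a neighbourhood of [x]. *)
Lemma eq_closed n d (N : mspace R n) (N' : mspace R d) (f g : N -> N') x :
  pre_manifold N -> pre_manifold N' -> hausdorff_mspace N' ->
  msm f x -> msm g x -> f x <> g x -> mnbhs x (fun y => f y <> g y).
Proof.
move=> NP NP' NH fs gs /NH [U [V [Uo Vo Ufx Vgx UV]]].
have fU := msm_continuous NP NP' fs ((mopenP NP' U).1 Uo _ Ufx).
have gV := msm_continuous NP NP' gs ((mopenP NP' V).1 Vo _ Vgx).
apply: filterS (filterI fU gV) => y [Uy Vy] E.
have : (U `&` V) (f y) by split=> //; rewrite E.
by rewrite UV.
Qed.

Section FiniteOrder.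
Variables (n : nat) (N : mspace R n).
Hypothesis NP : pre_manifold N.
Hypothesis NH : hausdorff_mspace N.

Lemma iter_msm (phi : N -> N) k : (forall x, msm phi x) -> forall x, msm (iter k phi) x.
Proof.
move=> ps; elim: k => [|k IH] x; first by have [] := msm_id NP x.
by have [] := msm_comp NP NP (IH x) (ps (iter k phi x)).
Qed.

(** The interior [I] of the fixed set of a diffeomorphism [phi] of finite order is
    closed. At a point [x] adherent to [I], [phi] fixes [x] and, by continuity,
    all its iterates have derivative the identity at [x]. In a chart, the sum
    [psi] of the iterates over one period satisfies [psi \o phi = psi] and has
    derivative a nonzero multiple of the identity at [x]; hence [psi] is
    injective near [x] and [phi] is the identity there. *)
Lemma finite_order_fix (phi : N -> N) p : (forall x, msm phi x) ->
  (forall x, iter p.+1 phi x = x) ->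
  let I := [set x | mnbhs x (fun y => phi y = y)] in mopen I /\ mopen (~` I).
Proof.
move=> ps pid I; split; apply/(mopenP NP) => x.
  move=> Ix; have [U [Uo Ux UI]] := mnbhs_mopen NP Ix.
  apply: filterS ((mopenP NP U).1 Uo x Ux) => y Uy.
  by apply: filterS ((mopenP NP U).1 Uo y Uy).
move=> nIx; apply: contrapT => nI; apply: nIx.
have adh A : mnbhs x A -> exists2 y, A y & I y.
  move=> xA; apply: contrapT => h; apply: nI; apply: filterS xA => y Ay Iy.
  by apply: h; exists y.
have px : phi x = x.
  apply: contrapT => pxx.
  have [y py Iy] := adh _ (eq_closed NP NP NH (ps x) (msm_id NP x).1 pxx).
  exact: py (mnbhs_singleton NP Iy).
have itx k : iter k phi x = x by exact: iter_fix.
have ac := chart_at_coord NP x; have ap := chart_at_dom NP x.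
set a := chart_at x in ac ap.
pose F k := a \o iter k phi \o cinv a.
have Fk k : (\forall y \near a x, cdom a (iter k phi (cinv a y))) /\ smooth_at (F k) (a x).
  apply: (msmP NP NP ac ac ap _).1; first by rewrite itx.
  exact: iter_msm.
have dF k v : 'd (F k) (a x) v = v.
  apply: contrapT => dv.
  have dc := smooth_continuous (smooth_deriv v (Fk k).2).
  have nv : \forall y \near a x, 'd (F k) y v != v.
    have : 'd (F k) (a x) v - v != 0 by rewrite subr_eq0; apply/eqP.
    move=> d0; have dc' : {for a x, continuous (fun y => 'd (F k) y v - v)}.
      by apply: (@continuousB _ _ _ (fun y => 'd (F k) y v)) => //; exact: cst_continuous.
    have /cvgr_neq0 /(_ d0) := dc'.
    by apply: filterS => y; rewrite subr_eq0.
  have xn : mnbhs x (fun y => cdom a y /\ 'd (F k) (a y) v != v).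
    apply/(mnbhsP NP _ ac ap).
    apply: filterS (nbhs_setI nv (coord_near ac ap)) => y [+ [dy yE]].
    by rewrite yE.
  have [y [ay dy] Iy] := adh _ xn; case/negP: dy; apply/eqP.
  have E : {near a y, id =1 F k}.
    have H := (mnbhsP NP _ ac ay).1 Iy.
    apply: filterS (nbhs_setI H (coord_near ac ay)) => z [pz [_ zE]].
    by rewrite /F /= iter_fix.
  have [_ E1] := near_eq_differentiable E (smooth_diff (smooth_id _)).
  exact: etrans (E1 v) ((is_diffE (is_diff_id (a y))).2 v).
pose psi y := \sum_(k < p.+1) F k y.
have psis : smooth_at psi (a x) by apply: smooth_sum => k _; exact: (Fk k).2.
have dpsi v : 'd psi (a x) v = v *+ p.+1.
  have h j : ('d psi (a x) v) 0 j = (v *+ p.+1) 0 j.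
    apply: etrans (esym (diff_coord v j (smooth_diff psis))) _.
    have dj k : differentiable (fun y => F k y 0 j) (a x).
      exact: smooth_diff ((smooth_coord _ _).1 (Fk k).2 j).
    have [_ E] := diff_sum v (fun k : 'I_p.+1 => dj k).
    have -> : (fun y => psi y 0 j) = fun y => \sum_(k < p.+1) F k y 0 j.
      by apply/funext => y; rewrite /psi summxE.
    apply: etrans E _; rewrite mulmxnE.
    under eq_bigr => k _ do rewrite (etrans (diff_coord v j (smooth_diff (Fk k).2))
      (congr1 (fun w : 'rV[R]_n => w 0 j) (dF k v))).
    by rewrite sumr_const card_ord.
  by apply/rowP.
have h2 : (0 : R) < 2^-1 by rewrite invr_gt0.
have [r r0 rP] := strict_diff h2 (psis 1%N).
have F1c : \forall y \near a x, ball (a x) r (F 1%N y).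
  have c1 := smooth_continuous (Fk 1%N).2.
  have F1x : F 1%N (a x) = a x by rewrite /F /= (coordK ac) // px.
  rewrite /prop_for /continuous_at F1x in c1.
  by apply: c1; exact: nbhsx_ballx.
have dom : \forall y \near a x, forall k : 'I_p.+2, cdom a (iter k phi (cinv a y)).
  exact: (@filter_forall _ _ (fun (k : 'I_p.+2) y => cdom a (iter k phi (cinv a y)))
    (nbhs (a x)) _ (fun k => (Fk k).1)).
apply/(mnbhsP NP _ ac ap).
apply: filterS (nbhs_setI (nbhs_setI F1c (nbhsx_ballx (a x) r r0))
  (nbhs_setI dom (coord_near ac ap))) => y [[F1y yr] [dy [ay yE]]].
set w := cinv a y in dy ay yE *.
have aw : cdom a (phi w) by exact: (dy (@Ordinal p.+2 1 isT)).
have psiE : psi (F 1%N y) = psi y.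
  rewrite /psi /F /= -/w (coordK ac aw).
  under eq_bigr => k _ do rewrite -iterSr.
  rewrite big_ord_recr [RHS]big_ord_recl /= addrC; congr (_ + _).
  by congr (a _); exact: pid.
have := rP _ _ F1y yr; rewrite psiE subrr sub0r normrN dpsi normrMn => H.
have z0 : `|F 1%N y - y| = 0.
  apply/eqP; rewrite eq_le normr_ge0 andbT.
  have : `|F 1%N y - y| <= 2^-1 * `|F 1%N y - y|.
    apply: le_trans H; rewrite mulrS lerDl mulrn_wge0 //.
  by lra.
have /eqP : F 1%N y = y by apply/eqP; rewrite -subr_eq0 -normr_eq0 z0.
rewrite /F /= -/w => /eqP E.
by rewrite -[LHS](coordK ac aw) E.
Qed.

End FiniteOrder.

Section TorusAction.
Variables (n : nat) (N : kspace R n) (Phi : torus R n -> N -> N).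
Hypothesis Nman : is_manifold N.
Hypothesis Nconn : connected_mspace N.
Hypothesis Phiact : torus_action Phi.
Hypothesis Phieff : effective_action Phi.
Hypothesis Phis : forall a x, msm (Phi a) x.

Let NP := manifold_pre Nman.
Let NH : hausdorff_mspace N. Proof. by case: Nman. Qed.

Lemma action_continuous (t : 'rV[R]_n) x (A : set N) :
  mnbhs (Phi (torus_pi t) x) A -> \forall s \near t, A (Phi (torus_pi s) x).
Proof.
move=> hA; have [_ _ Psm] := Phiact.
have TPn := torus_pre R n; have VP := rvspace_pre R n.
have [cM cd] := chart_atP TPn (torus_pi t); set c := chart_at _ in cM cd.
have [c2M c2d] := chart_atP NP x; set c2 := chart_at x in c2M c2d.
have [c'M c'd] := chart_atP NP (Phi (torus_pi t) x); set c' := chart_at _ in c'M c'd.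
have cc := atlas_coord TPn cM; have cc2 := atlas_coord NP c2M.
have cc' := atlas_coord NP c'M.
have eM : atlas (prod_mspace (torus_mspace R n) N) (prod_chart c c2) by exists c, c2.
have := Psm _ _ eM c'M; set W := _ @` _ => -[Wo Ws].
pose g (s : 'rV[R]_n) := row_mx (c (torus_pi s)) (c2 x).
have [pis _] := quotient_msm VP (@torus_deck R n) (@torus_linj R n) (@torus_pi_surj R n)
  (t : rvspace R n).
have [p1 p2] := (@msmP _ _ _ (rvspace R n) (torus_mspace R n) VP TPn (std_chart R n) c
  (@torus_pi R n) t (std_coord R n) cc I cd).1 pis.
have gs : smooth_at g t by apply: smooth_row_mx; [exact: p2|exact: smooth_cst].
have Wgt : W (g t) by exists (torus_pi t, x).
have gW : \forall s \near t, W (g s).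
  by apply: (smooth_continuous gs); exact: open_nbhs_nbhs.
have ginv s : cdom c (torus_pi s) -> cinv (prod_chart c c2) (g s) = (torus_pi s, x).
  by move=> ds; rewrite /= /g row_mxKl row_mxKr (coordK cc ds) (coordK cc2 c2d).
have hs : smooth_at (fun s => (c' \o (fun y => Phi y.1 y.2) \o cinv (prod_chart c c2)) (g s)) t.
  by apply: smooth_comp gs; apply: (smooth_onP _ Wo).1.
have hA' := (mnbhsP NP _ cc' c'd).1 hA.
have gt : (c' \o (fun y => Phi y.1 y.2) \o cinv (prod_chart c c2)) (g t) = c' (Phi (torus_pi t) x).
  by rewrite /= -/(cinv (prod_chart c c2) (g t)) /g row_mxKl row_mxKr (coordK cc cd) (coordK cc2 c2d).
have hc2 := smooth_continuous hs; rewrite /prop_for /continuous_at gt in hc2.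
have key : \forall s \near t, A (cinv c'
   ((c' \o (fun y => Phi y.1 y.2) \o cinv (prod_chart c c2)) (g s))) by exact: hc2 hA'.
apply: filterS (nbhs_setI key (nbhs_setI p1 gW)) => s [As [ds [[b y] [[_ [db dy]] d'] gE]]].
have E1 : (torus_pi s, x) = (b, y).
  rewrite -(ginv s ds) -gE /= row_mxKl row_mxKr.
  by rewrite (coordK cc db) (coordK cc2 dy).
move: As; rewrite -[X in c' \o _ \o X]/(cinv (prod_chart c c2)) /=.
rewrite /g row_mxKl row_mxKr (coordK cc ds) (coordK cc2 c2d).
by move: d'; rewrite -E1 /= => d'; rewrite (coordK cc' d').
Qed.

(** The stabilizer lifts to a closed subgroup of [R^n] containing the integral
    vectors. *)
Lemma nonfree_torsion x : ~ free_points Phi x -> exists t q,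
  [/\ Phi (torus_pi t) x = x, torus_pi t <> 0, (0 < q)%N &
      t *+ q \in @int_lattice R n].
Proof.
move=> nf; have [Phi0 PhiD _] := Phiact.
have [a [ax a0]] : exists a, Phi a x = x /\ a <> 0.
  apply: contrapT => h; apply: nf => a ax; apply: contrapT => a0; apply: h.
  by exists a.
have [t0 t0E] := torus_pi_surj a.
pose A : set 'rV[R]_n := [set t | Phi (torus_pi t) x = x].
have pi0 k : k \in @int_lattice R n -> torus_pi k = 0.
  have <- : torus_pi 0 = 0 :> torus R n by exact: torus_pi0.
  by move=> kZ; apply/torus_pi_eq; rewrite subr0.
have [|||||t [q [At tZ q0 tq]]] := @closed_subgroup_torsion R n A t0.
- move=> s t As At; rewrite /A /= -[in RHS]As -{1}At.
  by rewrite -PhiD -torus_piD subrK.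
- by move=> k kZ; rewrite /A /= pi0.
- rewrite closedE => t nt; apply: contrapT => tA; apply: nt.
  have [U [V [Uo Vo Ut Vx UV]]] := NH tA.
  apply: filterS (action_continuous ((mopenP NP U).1 Uo _ Ut)) => s Us As.
  have : (U `&` V) x by split=> //; move: Us; rewrite As.
  by rewrite UV.
- by rewrite /A /= t0E.
- by apply/negP => /pi0; rewrite t0E.
exists t, q; split=> //.
have <- : torus_pi 0 = 0 :> torus R n by exact: torus_pi0.
by move=> /torus_pi_eq; rewrite subr0 (negbTE tZ).
Qed.

(** Otherwise the interior of the fixed set, being open and closed, is everything,
    against effectiveness. *)
Lemma torsion_fix_empty (t : 'rV[R]_n) q : (0 < q)%N -> t *+ q \in @int_lattice R n ->
  torus_pi t <> 0 -> forall x, ~ mnbhs x (fun y => Phi (torus_pi t) y = y).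
Proof.
move=> q0 tq t0 x Ix; have [Phi0 PhiD _] := Phiact.
have itE k y : iter k (Phi (torus_pi t)) y = Phi (torus_pi (t *+ k)) y.
  elim: k y => [|k IH] y /=.
    by rewrite mulr0n (_ : torus_pi 0 = 0) // torus_pi0.
  by rewrite IH -PhiD -torus_piD -mulrS.
have itq y : iter q.-1.+1 (Phi (torus_pi t)) y = y.
  rewrite prednK // itE (_ : torus_pi (t *+ q) = 0) //.
  have <- : torus_pi 0 = 0 :> torus R n by exact: torus_pi0.
  by apply/torus_pi_eq; rewrite subr0.
have [Io Ico] := finite_order_fix NP NH (Phis (torus_pi t)) itq.
have [_ /(_ _ Io Ico) [E|E]] := Nconn.
  have : [set x | mnbhs x (fun y => Phi (torus_pi t) y = y)] x by [].
  by rewrite E.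
apply: t0; apply: Phieff => y.
have : [set x | mnbhs x (fun y => Phi (torus_pi t) y = y)] y by rewrite E.
exact: mnbhs_singleton.
Qed.

(** If no point near [x] is free, a small closed ball in a chart is covered by the
    countably many fixed sets of torsion elements, closed and without interior
    points: this contradicts the theorem of Baire. *)
Theorem free_points_dense x (A : set N) : mnbhs x A ->
  exists2 y, A y & free_points Phi y.
Proof.
move=> xA; apply: contrapT => nex.
have nf y : A y -> ~ free_points Phi y by move=> Ay fy; apply: nex; exists y.
have ac := chart_at_coord NP x; have ap := chart_at_dom NP x.
set a := chart_at x in ac ap.
have H := (mnbhsP NP _ ac ap).1 xA.
have /nbhs_ballP [r /= r0 rP] := nbhs_setI H (coord_near ac ap).
have r2 : 0 < r / 2 by rewrite divr_gt0.
pose B := closed_ball (a x) (r / 2).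
have BP y : B y -> [/\ A (cinv a y), cdom a (cinv a y) & a (cinv a y) = y].
  rewrite /B closed_ballE // /closed_ball_ /= => yB.
  have [|? [? ?]] := rP y; last by split.
  rewrite -ball_normE /=; apply: le_lt_trans yB _.
  by rewrite ltr_pdivrMr // ltr_pMr // ltr1n.
pose good (qt : nat * 'rV[R]_n) := [/\ (0 < qt.1)%N, qt.2 *+ qt.1 \in @int_lattice R n &
  torus_pi qt.2 <> 0].
(* Torsion elements are enumerated by pairs of a denominator and an integral vector. *)
pose dec (qk : nat * 'rV[int]_n) : nat * 'rV[R]_n :=
  (qk.1, qk.1%:R^-1 *: map_mx intr qk.2).
pose C i : set 'rV[R]_(n + n) := [set y | B y /\ exists qk, [/\ unpickle i = Some qk,
  good (dec qk) & Phi (torus_pi (dec qk).2) (cinv a y) = cinv a y]].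
have OC i : open (~` C i) /\ dense (~` C i).
  split.
    rewrite openE => y nC.
    have [By|nBy] := pselect (B y); last first.
      have : nbhs y (~` B).
        apply: open_nbhs_nbhs; split=> //; apply: closed_openC.
        exact: closed_ball_closed.
      by apply: filterS => z nBz [Bz _].
    have [Ay ay yE] := BP y By.
    case E : (unpickle i : option (nat * 'rV[int]_n)) => [qk|]; last first.
      by apply: (@near_all _ y (~` C i)) => z [_ [qk [E' _ _]]]; rewrite E in E'.
    have [fy|nfy] := pselect (good (dec qk) /\
        Phi (torus_pi (dec qk).2) (cinv a y) = cinv a y).
      by case: nC; split=> //; exists qk; case: fy.
    have [gd|ngd] := pselect (good (dec qk)); last first.
      by apply: (@near_all _ y (~` C i)) => z [_ [qk' [E' g' _]]]; move: E'; rewrite E => -[E']; rewrite E' in ngd.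
    have ne : Phi (torus_pi (dec qk).2) (cinv a y) <> id (cinv a y) by move=> h; apply: nfy.
    have := eq_closed NP NP NH (Phis _ _) (msm_id NP (cinv a y)).1 ne.
    move=> /(mnbhsP NP _ ac ay); rewrite yE.
    apply: filterS => z nz [_ [qk' [E' _ fz]]]; apply: nz.
    by move: E'; rewrite E => -[->].
  move=> D [y Dy] Do; apply: contrapT => h.
  have DC z : D z -> C i z.
    by move=> Dz; apply: contrapT => nCz; apply: h; exists z.
  have [By [qk [E [q0 tq t0] fy]]] := DC y Dy.
  have [Ay ay yE] := BP y By.
  apply: (torsion_fix_empty q0 tq t0 (x := cinv a y)).
  apply/(mnbhsP NP _ ac ay); rewrite yE.
  apply: filterS (open_nbhs_nbhs (conj Do Dy)) => z /DC [_ [qk' [E' _ fz]]].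
  by move: E'; rewrite E => -[->].
have := @Baire R 'rV[R]_(n + n) (fun i => ~` C i) OC.
have B0 : ball (a x) (r / 2) !=set0 by exists (a x); exact: ballxx.
move=> /(_ _ B0 (@ball_open _ _ (a x) (r / 2))) [y [yb yC]].
have By : B y by apply: subset_closed_ball.
have [Ay ay yE] := BP y By.
have [t [q [tx t0 q0 tq]]] := nonfree_torsion (nf _ Ay).
have /choice [k kP] : forall j : 'I_n, exists m : int, (t *+ q) 0 j = m%:~R.
  by move=> j; have /intrP := int_lattice_coord j tq.
pose qk : nat * 'rV[int]_n := (q, \row_j k j).
have dE : dec qk = (q, t).
  rewrite /dec /=; congr (_, _); apply/rowP => j.
  rewrite !mxE -kP mulmxnE -[t 0 j *+ q]mulr_natl mulrA mulVf ?mul1r //.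
  by rewrite pnatr_eq0 -lt0n.
apply: (yC (pickle qk) I); split=> //; exists qk; rewrite pickleK dE; split=> //.
Qed.

End TorusAction.
End Density.

(** * Affine coordinates and affine maps *)

Section SmoothOfDerivative.
Variable R : realType.

(** Used for a primitive, whose derivative is smooth by construction. *)
Lemma smooth_of_deriv n (V : normedModType R) (g : 'rV[R]_n -> V)
    (dg : 'rV[R]_n -> 'rV[R]_n -> V) x :
  (forall v, smooth_at (fun y => dg y v) x) ->
  (\forall y \near x, differentiable g y /\ forall v, 'd g y v = dg y v) ->
  smooth_at g x.
Proof.
move=> dgs gd; have S k : Ck_at k.+1 g x.
  split=> [|v]; first by apply: filterS gd => y [].
  apply: near_eq_Ck (dgs v k); apply: filterS gd => y [_ E]; exact/esym.
by case=> [|k]; [exact: CkW (S 0%N)|exact: S].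
Qed.

Lemma diff_linear_comp n m (V : normedModType R) (L : 'rV[R]_m -> V)
    (f : 'rV[R]_n -> 'rV[R]_m) x v : linear L -> differentiable f x ->
  'd (fun y => L (f y)) x v = L ('d f x v).
Proof.
move=> Ll df; pose LM := GRing.isLinear.Build _ _ _ _ _ Ll.
pose LL : {linear 'rV[R]_m -> V} := HB.pack L LM.
have Lc : continuous LL by exact: continuous_linear_rV.
rewrite -[fun y => _]/(LL \o f) diff_comp //; last exact: linear_differentiable.
by rewrite /= (diff_lin _ Lc).
Qed.

Lemma diff_linear_add n m (L : 'rV[R]_n -> 'rV[R]_m) (f : 'rV[R]_n -> 'rV[R]_m) x :
  linear L -> differentiable f x ->
  differentiable (fun y => L y + f y) x /\
  forall v, 'd (fun y => L y + f y) x v = L v + 'd f x v.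
Proof.
move=> Ll df; have [di iE] := is_diffE (is_diff_id (x : 'rV[R]_n)).
have dL : differentiable L x by apply: smooth_diff; exact: smooth_linfun.
split=> [|v]; first exact: differentiableD.
have E : 'd (fun y => L y + f y) x = 'd L x \+ 'd f x :> (_ -> _) by exact: diffD.
apply: etrans (congr1 (fun T : 'rV[R]_n -> 'rV[R]_m => T v) E) _.
congr (_ + _); apply: etrans (diff_linear_comp v Ll di) _; congr (L _); exact: iE.
Qed.

End SmoothOfDerivative.

Section CoordinateSystems.
Variable R : realType.
Variables (n : nat) (M : mspace R n).
Hypothesis MP : pre_manifold M.
Let VP := rvspace_pre R n.

(** To be a coordinate system it is enough to be a smooth map with a smooth
    inverse. *)
Lemma coord_of_msm (c : chart R M n) : valid_chart c -> mopen (cdom c) ->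
  (forall p, cdom c p -> msm (c : M -> rvspace R n) p) ->
  (forall y, crange c y -> msm (cinv c : rvspace R n -> M) y) ->
  coord_system c.
Proof.
move=> cv co cs is_; split=> // a aA; have ac := atlas_coord MP aA.

have oa := mopen_dom MP ac.
have cao : open (c @` (cdom c `&` cdom a)).
  rewrite openE => _ [p [cp ap] <-].
  have py : crange c (c p) by exists p.
  have E := cv.1 _ cp.
  have H : mnbhs (c p : rvspace R n) (fun y => cdom a (cinv c y)).
    apply: (msm_continuous VP MP (is_ _ py)); rewrite E.
    exact: mnbhs_dom.
  move/rv_mnbhs : H => H.
  apply: filterS (nbhs_setI H (open_nbhs_nbhs (conj cv.2 py))) => y [ay [q cq qy]].
  exists q => //; split=> //.
  by have := ay; rewrite -qy cv.1.
split; split.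
- by apply: (coord_image_open MP ac (mopenI MP oa co)) => q [].
- apply/smooth_onP; first by apply: (coord_image_open MP ac (mopenI MP oa co)) => q [].
  move=> _ [q [aq cq] <-].
  have [_] := (msmP MP VP (c := a) (c' := std_chart R n) ac (std_coord R n) aq I).1 (cs q cq).
  by [].
- exact: cao.
- apply/smooth_onP => // _ [p [cp ap] <-].
  have py : crange c (c p) by exists p.
  have E := cv.1 _ cp.
  have ap' : cdom a (cinv c (c p)) by rewrite E.
  have [_] := (msmP VP MP (c := std_chart R n) (c' := a) (std_coord R n) ac I ap').1 (is_ _ py).
  by [].
Qed.

Lemma coord_vec_rep (a c : chart R M n) v q : coord_system a -> coord_system c ->
  cdom a q -> cdom c q ->
  \forall y \near c q, field_rep c (coord_vec a v) y =
    'd (c \o cinv a) (a (cinv c y)) v.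
Proof.
move=> ac cc aq cq; have [H _] := coord_trans MP cc ac cq aq.
move: (nbhs_setI H (coord_near cc cq)); apply: filterS => y [ay [cy _]].
rewrite /field_rep.
have E := dchart_comp MP (coord_vec a v (cinv c y)) ac cc ay cy.
apply: (etrans E); congr ('d _ _ _); exact: coord_vecK.
Qed.

Lemma coord_vec_smooth (a : chart R M n) v : coord_system a ->
  smooth_field_on (cdom a) (coord_vec a v).
Proof.
move=> ac; apply/(smooth_field_onP _ (mopen_dom MP ac)) => c q cA aq cq.
have cc := atlas_coord MP cA.
have E := coord_vec_rep v ac cc aq cq.
apply: near_eq_smooth (_ : smooth_at (fun y => 'd (c \o cinv a) (a (cinv c y)) v) _).
  by apply: filterS E => y; exact: esym.
have [_ s1] := coord_trans MP cc ac cq aq.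
have [_ s2] := coord_trans MP ac cc aq cq.
have := smooth_deriv v s2; have qE := coordK cc cq.
rewrite -{1}qE => s3.
exact: (smooth_comp (g := fun z => 'd (c \o cinv a) z v) (f := a \o cinv c) s3 s1).
Qed.

(** The two terms of the bracket are the mixed second derivatives of the change
    of coordinates from [a] to the preferred chart. *)
Lemma coord_vec_bracket (a : chart R M n) u v q : coord_system a -> cdom a q ->
  lie_bracket (coord_vec a u) (coord_vec a v) q = 0.
Proof.
move=> ac aq; rewrite /lie_bracket; set c := chart_at q.
have cc : coord_system c := chart_at_coord MP q.
have cq : cdom c q := chart_at_dom MP q.
have qE := coordK cc cq.
have [_ s1] := coord_trans MP cc ac cq aq.
have [_ s2] := coord_trans MP ac cc aq cq.
have D w w' : 'd (field_rep c (coord_vec a w)) (c q) (coord_vec a w' q) =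
    'd (fun z => 'd (c \o cinv a) z w) (a q) w'.
  have E := coord_vec_rep w ac cc aq cq.
  have s3 := smooth_deriv w s2.
  have aqE : (a \o cinv c) (c q) = a q by rewrite /= qE.
  have E' : {near c q, (fun z => (fun z => 'd (c \o cinv a) z w) ((a \o cinv c) z)) =1
      field_rep c (coord_vec a w)}.
    by apply: filterS E => y; exact: esym.
  have [_ H] := smooth_comp_near aqE s3 s1 E'.
  apply: (etrans (H _)); congr ('d _ _ _).
  exact: (coord_vecK MP w' ac aq).
have gen (A B : 'rV[R]_n) : A = B -> A - B = 0 by move=> ->; exact: subrr.
apply: gen; exact: etrans (D v u) (etrans (schwarz v u s2) (esym (D u v))).
Qed.

Lemma dmap_rv_coord m (b : M -> rvspace R m) (a : chart R M n) p v : coord_system a ->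
  cdom a p -> msm b p ->
  'd ((b : M -> 'rV[R]_m) \o cinv a) (a p) (dchart a p v) = dmap b p v.
Proof.
move=> ac ap bs; have WP := rvspace_pre R m.
have E := dmapE MP WP (c' := std_chart R m) v ac (std_coord R m) ap I bs.
apply: etrans E _.
by apply: dchart_id; [exact: std_coord|exact: I|rewrite rv_chart_at].
Qed.

End CoordinateSystems.

Section AffineCoordinates.
Variable R : realType.
Variables (n : nat) (M : dfspace R n).
Hypothesis MP : pre_manifold M.
Hypothesis Dc : is_connection (df_conn M).
Hypothesis Dt : torsion_free (df_conn M).
Variable X : 'I_n -> M -> 'rV[R]_n.
Hypothesis XF : frame_of X.
Let VP := rvspace_pre R n.
Let Xp := frame_parallel XF.
Let Xu := frame_unit XF.
Let Xs i : smooth_field_on setT (X i) := (Xp i).1.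

(** The row [v *m W a y] consists of the values of the coframe dual to [X] on the
    coordinate field [v] of [a]. *)
Let W (a : chart R M n) y : 'M[R]_n := invmx (frame_rep X a y).

Let W_smooth a p : atlas M a -> cdom a p -> smooth_mx (a p) (W a).
Proof.
move=> aA ap; apply: smooth_invmx; last exact: frame_rep_smooth.
exact: frame_rep_unit (atlas_coord MP aA) ap.
Qed.

Let W_coord (a : chart R M n) v q : coord_system a -> cdom a q ->
  frame_coord X ((q, coord_vec a v q) : TM M) = v *m W a (a q).
Proof.
move=> ac aq; rewrite /frame_coord /W /=.
have -> : frame_rep X a (a q) = frame_mx X q *m dchart_mx a q by exact: frame_repE.
have E := coord_vecK MP v ac aq; rewrite dchart_mxE in E.
have Fu := Xu q; rewrite -/(frame_mx X q) in Fu.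
have Cu := dchart_mx_unit MP ac aq.
set w := coord_vec a v q in E *; set F := frame_mx X q in Fu *.
set C := dchart_mx a q in E Cu *.
have FC : F *m C \in unitmx by rewrite unitmx_mul Fu.
apply: (can_inj (mulmxK FC)); rewrite mulmxKV // mulmxA mulmxKV //.
Qed.

(** The coframe is closed. For coordinate fields, which commute, absence of torsion
    says that the covariant derivative is symmetric; in the parallel frame the
    covariant derivative is the derivative of the coefficients. *)
Let W_closed a p u v : atlas M a -> cdom a p ->
  'd (fun y => v *m W a y) (a p) u = 'd (fun y => u *m W a y) (a p) v.
Proof.
move=> aA ap; have ac := atlas_coord MP aA; have ao := mopen_dom MP ac.
pose ga w q := frame_coord X ((q, coord_vec a w q) : TM M).
have gs w : msm (ga w) p.
  exact: (field_coord_msm MP Xp Xu ao ap (coord_vec_smooth MP w ac)).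
have D w w' : 'd (fun y => w *m W a y) (a p) w' = dmap (ga w) p (coord_vec a w' p).
  have E := dmap_rv_coord MP (coord_vec a w' p) ac ap (gs w).
  have E2 : {near a p, (ga w : M -> 'rV[R]_n) \o cinv a =1 (fun y => w *m W a y)}.
    move: (coord_near ac ap); apply: filterS => y [ay yE].
    by rewrite /= /ga W_coord // yE.
  have [_ s1] := (msmP MP VP (c' := std_chart R n) ac (std_coord R n) ap I).1 (gs w).
  have [_ E3] := near_eq_differentiable E2 (smooth_diff s1).
  apply: etrans (E3 _) _; apply: etrans E.
  by congr ('d _ _ _); apply/esym; exact: coord_vecK.
apply: etrans (D v u) (etrans _ (esym (D u v))).
have := @Dt (cdom a) (coord_vec a u) (coord_vec a v) p ao ap
  (coord_vec_smooth MP u ac) (coord_vec_smooth MP v ac).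
rewrite coord_vec_bracket // subr0 /cov => /eqP; rewrite subr_eq0 => /eqP T.
have F w := conn_frame MP Dc Xp Xu (coord_vec a w p) ao ap (coord_vec_smooth MP _ ac).
have T2 := etrans (esym (F v u)) (etrans T (F u v)).
exact: (can_inj (mulmxK (Xu p))) T2.
Qed.

(** Integrate the [n] closed forms of the dual coframe to functions [gi]; together
    they form local coordinates by the inverse function theorem, and by
    construction the frame is their coordinate frame. The range is restricted to
    a ball, so that functions with vanishing derivative are constant on it. *)
Lemma affine_chart p (U0 : set M) : mopen U0 -> U0 p ->
  exists (c : chart R M n) (z : 'rV[R]_n) (r : R),
  [/\ affine_coords c, cdom c p, cdom c `<=` U0, 0 < r /\ crange c = ball z r &
      forall q i, cdom c q -> dchart c q (X i q) = delta_mx 0 i].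
Proof.
move=> Uo U0p; have [aA ap] := chart_atP MP p; set a := chart_at p in aA ap *.
have ac := atlas_coord MP aA.
pose w i y : 'rV[R]_n := \row_j W a y j i.
have ws q i : cdom a q -> smooth_at (w i) (a q).
  move=> aq; apply/smooth_rV_mx => i' j; apply: near_eq_smooth (W_smooth aA aq j i).
  by apply: near_all => y; rewrite mxE.
have wE i v y : dotv (w i y) v = (v *m W a y) 0 i.
  by rewrite mxE; apply: eq_bigr => j _; rewrite mxE mulrC.
have vWs q (v : 'rV[R]_n) : cdom a q -> smooth_at (fun y => v *m W a y) (a q).
  move=> aq; apply/smooth_rV_mx; apply: smooth_mulmx (W_smooth aA aq).
  by move=> i j; exact: smooth_cst.
have wcl q i : cdom a q -> forall u v, dotv ('d (w i) (a q) u) v = dotv ('d (w i) (a q) v) u.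
  move=> aq.
  have D u v : dotv ('d (w i) (a q) u) v = ('d (fun y => v *m W a y) (a q) u) 0 i.
    have dw := smooth_diff (ws q i aq).
    have E := diff_coord u i (smooth_diff (vWs q v aq)).
    have Ll : linear (fun z : 'rV[R]_n => dotv z v : R).
      by move=> k z z'; rewrite dotvDl dotvZl.
    apply: etrans _ E; apply: etrans (esym (diff_linear_comp u Ll dw)) _.
    by congr ('d _ _ _); apply/funext => y; exact: wE.
  have gen (A B : 'rV[R]_n) : A = B -> A 0 i = B 0 i by move=> ->.
  move=> u v; apply: etrans (D u v) (etrans _ (esym (D v u))); apply: gen.
  exact: W_closed.
have near_a q : cdom a q -> \forall y \near a q, exists2 q', cdom a q' & a q' = y.
  by move=> aq; move: (coord_near ac aq); apply: filterS => y [ay yE]; exists (cinv a y).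
have [gi giP] : exists gi : 'I_n -> 'rV[R]_n -> R, forall i, \forall y \near a p,
    differentiable (gi i) y /\ forall v, 'd (gi i) y v = dotv (w i y) v.
  apply: (@fin_all_exists _ _ (fun i g => \forall y \near a p,
    differentiable g y /\ forall v, 'd g y v = dotv (w i y) v)) => i.
  apply: poincare (ws p i ap) _; move: (near_a p ap); apply: filterS => y [q aq <-].
  exact: wcl.
pose g y : 'rV[R]_n := \row_i gi i y.
pose U := [set y | (a @` (U0 `&` cdom a)) y /\ forall i, \forall z \near y,
    differentiable (gi i) z /\ forall v, 'd (gi i) z v = dotv (w i z) v].
have ro0 : open (a @` (U0 `&` cdom a)).
  by apply: (coord_image_open MP ac (mopenI MP Uo (mopen_dom MP ac))) => q [].
have Uo' : open U.
  rewrite openE => y [y0 gy].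
  have H1 := open_nbhs_nbhs (conj ro0 y0).
  have H2 : \forall z \near y, forall i, \forall z' \near z,
      differentiable (gi i) z' /\ forall v, 'd (gi i) z' v = dotv (w i z') v.
    by apply: (@filter_forall _ _ _ (nbhs y) _) => i; have /near_join := gy i.
  by move: (nbhs_setI H1 H2); apply: filterS => z [].
have gs y : U y -> smooth_at g y /\ forall v, 'd g y v = v *m W a y.
  move=> [[q [_ aq] <-] gq].
  have s1 i : smooth_at (gi i) (a q).
    apply: (smooth_of_deriv (dg := fun y => dotv (w i y))); last exact: gq.
    move=> v; apply: near_eq_smooth (_ : smooth_at (fun y => (v *m W a y) 0 i) _).
      by apply: near_all => z; exact/esym/wE.
    exact: ((smooth_coord _ _).1 (vWs q v aq) i).
  have s2 : smooth_at g (a q).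
    apply/smooth_coord => i; apply: near_eq_smooth (s1 i).
    by apply: near_all => z; rewrite mxE.
  split=> // v; apply/rowP => i.
  apply: etrans (esym (diff_coord v i (smooth_diff s2))) _.
  have E : (fun z => g z 0 i) = gi i by apply/funext => z; rewrite mxE.
  rewrite E; have [_ H] := nbhs_singleton (gq i).
  by apply: etrans (H v) _; exact: wE.
have Up : U (a p) by split=> //; exists p.
have Ju : 'J g (a p) \in unitmx.
  have -> : 'J g (a p) = W a (a p).
    apply/row_matrixP => i; rewrite !rowE.
    exact: etrans (esym (jacobianE _ _ _)) ((gs _ Up).2 _).
  by rewrite unitmx_inv; exact: frame_rep_unit.
have gU : smooth_on U g by apply/smooth_onP => // y Uy; exact: (gs y Uy).1.
have [V [k [Vo Vp VU imo [kg ks]]]] := inverse_function Uo' Up gU Ju.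
have gVo : open (g @` V) by exact: imo.
have [r /= r0 rV] : nbhs_ball (g (a p)) (g @` V).
  by apply/nbhs_ballP; apply: open_nbhs_nbhs; split=> //; exists (a p).
pose B := ball (g (a p)) r; pose D := [set q | [/\ cdom a q, V (a q) & B (g (a q))]].
pose c : chart R M n := Chart D (fun q => g (a q)) (fun y => cinv a (k y)).
have ck y : B y -> exists q, [/\ D q, U0 q, g (a q) = y & k y = a q].
  move=> By; have [x Vx xy] := rV _ By; have [[q [Uq aq] qx] _] := VU _ Vx.
  by exists q; split=> //; rewrite ?/D /= ?qx ?xy // -xy kg.
have cr : crange c = B.
  apply/seteqP; split=> [_ [q [_ _ Bq] <-] //|y /ck [q [Dq _ qy _]]].
  by exists q.
have Bo : open B by exact: ball_open.
have kD q : D q -> cinv a (k (g (a q))) = q.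
  by move=> [aq Vq _]; rewrite kg // coordK.
have Dn q : D q -> \forall y \near a q, V y /\ B (g y).
  move=> [aq Vq Bq]; have H1 := open_nbhs_nbhs (conj Vo Vq).
  have gc := smooth_continuous (gs _ (VU _ Vq)).1.
  have H2 : \forall y \near a q, B (g y) by apply: gc; exact: open_nbhs_nbhs.
  exact: nbhs_setI H1 H2.
have cv : valid_chart c.
  by split; [move=> q Dq; exact: kD|rewrite cr].
have Do : mopen D.
  apply/(mopenP MP) => q Dq; have [aq _ _] := Dq; apply/(mnbhsP MP _ ac aq).
  move: (nbhs_setI (coord_near ac aq) (Dn q Dq)); apply: filterS => y [[ay yE] [Vy By]].
  by split; rewrite /= ?yE.
have cs q : D q -> msm (c : M -> rvspace R n) q.
  move=> [aq Vq _]; apply/(msmP MP VP (c' := std_chart R n) ac (std_coord R n) aq I).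
  split; first exact: near_all.
  apply: near_eq_smooth (gs _ (VU _ Vq)).1.
  by move: (coord_near ac aq); apply: filterS => y [_ yE] /=; rewrite yE.
have is_ y : crange c y -> msm (cinv c : rvspace R n -> M) y.
  rewrite cr => By; have [q [[aq Vq Bq] _ qy ky]] := ck y By.
  have aiq : cdom a (cinv a (k y)) by rewrite ky coordK.
  have ym : (g @` V) y by exact: rV.
  have ksy : smooth_at k y by exact: ((smooth_onP _ gVo).1 ks).
  have kcv : {for y, continuous k} := smooth_continuous ksy.
  have H1 : \forall z \near y, cdom a (cinv a (k z)) /\ a (cinv a (k z)) = k z.
    have H0 : \forall w \near k y, cdom a (cinv a w) /\ a (cinv a w) = w.
      by rewrite ky; exact: coord_near.
    exact: (kcv _ H0).
  apply/(msmP VP MP (c := std_chart R n) (c' := a) (f := cinv c) (p := y) (std_coord R n) ac I aiq).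
  split; first by move: H1; apply: filterS => z [].
  by apply: near_eq_smooth ksy; move: H1; apply: filterS => z [_ zE]; rewrite /= zE.
have cc : coord_system c by exact: coord_of_msm.
have Dp : D p by split=> //; exact: ballxx.
have Xc q i : cdom c q -> dchart c q (X i q) = delta_mx 0 i.
  move=> cq; have [aq Vq _] := cq.
  have E := dchart_comp MP (X i q) ac cc aq cq.
  apply: etrans E _.
  have gq := gs _ (VU _ Vq).
  have near_g : {near a q, g =1 c \o cinv a}.
    by move: (coord_near ac aq); apply: filterS => y [_ yE] /=; rewrite yE.
  have [_ H] := near_eq_differentiable near_g (smooth_diff gq.1).
  apply: etrans (H _) _; apply: etrans (gq.2 _) _.
  have -> : dchart a q (X i q) = row i (frame_rep X a (a q)).
    by rewrite rowK /field_rep coordK.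
  by rewrite -row_mul mulmxV ?row1 //; exact: frame_rep_unit.
exists c, (g (a p)), r; split=> //; last first.
  by move=> q [aq /VU [[q' [Uq' aq'] E] _] _]; rewrite -(coordK ac aq) -E coordK.
split=> // q i j Dq; rewrite /cov.
have E q' : cdom c q' -> coord_field c j q' = X j q'.
  by move=> cq'; rewrite /coord_field -(Xc q' j cq'); exact: dchartK.
have Xsc : smooth_field_on (cdom c) (X j).
  by apply: (smooth_field_onW (mopenT MP)).
have -> : df_conn M q (coord_field c i q) (coord_field c j) =
    df_conn M q (coord_field c i q) (X j).
  exact: (conn_local MP Dc _ Do Dq (coord_vec_smooth MP _ cc) Xsc E).
exact: (Xp j).2.
Qed.

End AffineCoordinates.

Section AffineMaps.
Variable R : realType.
Variables (n d : nat) (M : dfspace R n) (M' : dfspace R d).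
Hypotheses (MP : pre_manifold M) (MP' : pre_manifold M').
Hypotheses (Dc : is_connection (df_conn M)) (Dc' : is_connection (df_conn M')).
Hypotheses (Dt : torsion_free (df_conn M)) (Dt' : torsion_free (df_conn M')).
Variables (X : 'I_n -> M -> 'rV[R]_n) (X' : 'I_d -> M' -> 'rV[R]_d).
Hypotheses (XF : frame_of X) (XF' : frame_of X').
Variable f : M -> M'.
Hypothesis fs : forall p, msm f p.
Let VP := rvspace_pre R d.
Let Xp := frame_parallel XF.
Let Xu := frame_unit XF.
Let Xp' := frame_parallel XF'.

Lemma dchart_sum (c : chart R M' d) p k (b : 'rV[R]_k) (Y : 'I_k -> 'rV[R]_d) :
  dchart c p (\sum_i b 0 i *: Y i) = \sum_i b 0 i *: dchart c p (Y i).
Proof.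
rewrite dchart_mxE mulmx_suml; apply: eq_bigr => i _.
by rewrite dchart_mxE scalemxAl.
Qed.

(** In the coordinates of [affine_chart] on both sides, the derivative of the
    expression of [f] is the matrix of [df] in the frames. It is constant on the
    ball, so that the difference of [f] and this linear map is constant too. *)
Lemma affine_of_frame_diff0 :
  (forall i p v, dmap (frame_diff X X' f i) p v = 0) -> affine_map f.
Proof.
move=> dB; split=> [|p]; first by apply/(smooth_mapP MP MP').
have [c' [z' [r' [c'a c'fp _ _ c'X]]]] :=
  affine_chart MP' Dc' Dt' XF' (mopenT MP') (I : setT (f p)).
have c'c := c'a.1.
have Uo : mopen (f @^-1` cdom c').
  apply/(mopenP MP) => q c'q; apply: (msm_continuous MP MP' (fs q)).
  exact: mnbhs_dom.
have [c [z [r [ca cp cU [r0 cr] cX]]]] := affine_chart MP Dc Dt XF Uo c'fp.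
have cc := ca.1.
pose fh := c' \o f \o cinv c.
pose b i := (frame_diff X X' f i : M -> 'rV[R]_d) \o cinv c.
have in_ball y : ball z r y -> exists2 q, cdom c q & c q = y.
  by rewrite -cr => -[q]; exists q.
have fhs q : cdom c q -> smooth_at fh (c q).
  by move=> cq; have [_] := (msmP MP MP' cc c'c cq (cU _ cq)).1 (fs q).
have bc i q : cdom c q -> differentiable (b i) (c q) /\ forall v, 'd (b i) (c q) v = 0.
  move=> cq; have bs := frame_diff_msm MP MP' XF XF' fs i q.
  have [_ s] := (msmP MP VP (c' := std_chart R d) cc (std_coord R d) cq I).1 bs.
  split=> [|v]; first exact: smooth_diff s.
  have E := dmap_rv_coord MP (coord_vec c v q) cc cq bs.
  have vE := coord_vecK MP v cc cq.
  apply: etrans (etrans E (dB i q _)); congr ('d _ _ _); exact: esym.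
have zb : ball z r z by exact: ballxx.
pose A : 'M[R]_(n, d) := \matrix_i b i z.
have bA i y : ball z r y -> b i y = row i A.
  move=> By; rewrite rowK; apply: (@diff0_const _ _ _ (b i) z r) => // y' By'.
  by have [q cq <-] := in_ball y' By'; exact: bc.
have dfh q v : cdom c q -> 'd fh (c q) v = v *m A.
  move=> cq; have Bq : ball z r (c q) by rewrite -cr; exists q.
  have E i : 'd fh (c q) (delta_mx 0 i) = row i A.
    rewrite -(bA i _ Bq) /b /= (coordK cc cq) -(cX q i cq).
    apply: etrans (dmapE MP MP' (X i q) cc c'c cq (cU _ cq) (fs q)) _.
    apply: etrans (congr1 (dchart c' (f q)) (frame_diffE X XF' f i q)) _.
    rewrite -frame_sum dchart_sum [RHS]rV_sum_delta; apply: eq_bigr => k _.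
    by congr (_ *: _); apply: c'X; exact: cU.
  rewrite linear_rV {2}(rV_sum_delta v) mulmx_suml; apply: eq_bigr => i _.
  by rewrite E -scalemxAl -rowE.
exists c, c', A, (fh z - z *m A); split=> // q cq; split; first exact: cU.
pose gh y := - (y *m A) + fh y.
have ghc : gh (c q) = gh z.
  apply: (@diff0_const _ _ _ gh z r) => //; last by rewrite -cr; exists q.
  move=> y /in_ball [q' cq' <-].
  have Al : linear (fun y : 'rV[R]_n => - (y *m A)).
    by move=> k u w; rewrite mulmxDl opprD -scalemxAl scalerN.
  have [dg dgE] := diff_linear_add Al (smooth_diff (fhs q' cq')).
  have gen (s t : 'rV[R]_d) : s = t -> - t + s = 0 by move=> ->; exact: addNr.
  split=> // v; apply: etrans (dgE v) _; apply: gen; exact: dfh.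
have fq : c' (f q) = fh (c q) by rewrite /fh /= coordK.
have -> : fh z - z *m A = gh z by exact: addrC.
by rewrite fq -ghc addNKr.
Qed.

Lemma coord_vec_sum k (Q : mspace R k) (c : chart R Q k) p (v : 'rV[R]_k) :
  coord_vec c v p = \sum_j v 0 j *: coord_field c j p.
Proof. exact: (linear_rV ('d (chart_at p \o cinv c) (c p)) v). Qed.

(** Coordinate fields of affine coordinates are parallel, hence have locally
    constant coefficients in a parallel frame. *)
Lemma affine_frame_coord0 k (Q : dfspace R k) (QP : pre_manifold Q)
    (QDc : is_connection (df_conn Q)) (Y : 'I_k -> Q -> 'rV[R]_k) (YF : frame_of Y)
    (c : chart R Q k) j p v : affine_coords c -> cdom c p ->
  let ga q := frame_coord Y ((q, coord_field c j q) : TM Q) in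
  msm ga p /\ dmap ga p v = 0.
Proof.
move=> [cc ca] cp ga; have co := mopen_dom QP cc.
have sj := coord_vec_smooth QP (delta_mx 0 j) cc.
split; first exact: (field_coord_msm QP (frame_parallel YF) (frame_unit YF) co cp sj).
have E w := conn_frame QP QDc (frame_parallel YF) (frame_unit YF) w co cp sj.
have D0 i : dmap ga p (coord_field c i p) = 0.
  apply: (can_inj (mulmxK (frame_unit YF p))); rewrite mul0mx.
  exact: etrans (esym (E _)) (ca p i j cp).
have vE : v = \sum_i (dchart c p v) 0 i *: coord_field c i p.
  by rewrite -coord_vec_sum; exact/esym/dchartK.
rewrite vE; have Ll := dmap_linear ga p.
have S (F : 'I_k -> 'rV[R]_k) (a : 'I_k -> R) : (forall i, dmap ga p (F i) = 0) ->
    dmap ga p (\sum_i a i *: F i) = 0.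
  move=> F0; elim/big_rec: _ => [|i x _ IH]; first exact: dmap0.
  by rewrite Ll F0 scaler0 add0r.
exact: S.
Qed.

(** In affine coordinates [f] maps coordinate fields to combinations of coordinate
    fields with constant coefficients. Expressed in the frames, where all
    coefficients have vanishing derivative by [affine_frame_coord0], this kills
    the derivative of the matrix of [df] on the coefficients of each coordinate
    field, and these span. *)
Lemma frame_diff0_of_affine : affine_map f ->
  forall i p v, dmap (frame_diff X X' f i) p v = 0.
Proof.
move=> [_ fa] i p v; have [c [c' [A [B [ca c'a cp c'fp fE]]]]] := fa p.
have cc := ca.1; have c'c := c'a.1.
pose ga j q := frame_coord X ((q, coord_field c j q) : TM M).
pose ga' k q := frame_coord X' ((q, coord_field c' k q) : TM M').
have gaP j : msm (ga j) p /\ dmap (ga j) p v = 0 by exact: affine_frame_coord0.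
have ga'P k w : msm (ga' k) (f p) /\ dmap (ga' k) (f p) w = 0 by exact: affine_frame_coord0.
have cn := mnbhs_dom MP cc cp.
have fcoord q j : cdom c q -> dmap f q (coord_field c j q) =
    \sum_k A j k *: coord_field c' k (f q).
  move=> cq; have [c'fq _] := fE q cq.
  have E := dmap_coord MP MP' (coord_field c j q) cc c'c cq c'fq (fs q).
  apply: etrans E _; have -> : dchart c q (coord_field c j q) = delta_mx 0 j.
    exact: coord_vecK.
  have En : {near c q, (fun y : 'rV[R]_n => y *m A + B) =1 c' \o f \o cinv c}.
    move: (coord_near cc cq); apply: filterS => y [cy yE].
    by rewrite /= (fE _ cy).2 yE.
  have Al : linear (fun y : 'rV[R]_n => y *m A) by move=> k u w; rewrite mulmxDl scalemxAl.
  have [dA dE] := diff_linear_add Al (smooth_diff (smooth_cst (c q) B)).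
  have [_ H] := near_eq_differentiable En dA.
  have -> : 'd (c' \o f \o cinv c) (c q) (delta_mx 0 j) = row j A.
    have gen (s t e : 'rV[R]_d) : s = e -> t = 0 -> s + t = e.
      by move=> -> ->; exact: addr0.
    apply: etrans (H _) _; apply: etrans (dE _) _; apply: gen; first exact/esym/rowE.
    by rewrite diff_cst.
  rewrite coord_vec_sum; apply: eq_bigr => k _; by rewrite mxE.
(* Both sides are the frame coordinates of the image of the [j]-th coordinate
   field. *)
have two_ways j q : cdom c q ->
    \sum_i (ga j q : 'rV[R]_n) 0 i *: (frame_diff X X' f i q : 'rV[R]_d) =
    \sum_k (row j A) 0 k *: (ga' k (f q) : 'rV[R]_d).
  move=> cq; have E := frame_coord_tmap XF XF' f ((q, coord_field c j q) : TM M).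
  apply: etrans (esym E) _; rewrite /frame_coord /= fcoord // mulmx_suml.
  by apply: eq_bigr => k _; rewrite mxE -scalemxAl.
have dgB j : \sum_i (ga j p : 'rV[R]_n) 0 i *: dmap (frame_diff X X' f i) p v = 0.
  have [s1 /(_ v) D1] := dmap_lincomb MP (gaP j).1
    (fun i => frame_diff_msm MP MP' XF XF' fs i p).
  have fga k := msm_comp MP MP' (fs p) (ga'P k 0).1.
  have [s2 /(_ v) D2] := dmap_lincomb MP (al := fun _ => row j A : rvspace R d)
    (be := fun k => (ga' k : M' -> rvspace R d) \o f)
    (msm_cst VP _ p).1 (fun k => (fga k).1).
  have En : mnbhs p (fun q =>
      (\sum_i (ga j q : 'rV[R]_n) 0 i *: (frame_diff X X' f i q : 'rV[R]_d)) =
      (\sum_k (row j A) 0 k *: (ga' k (f q) : 'rV[R]_d)) :> rvspace R d).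
    exact: filterS (two_ways j) cn.
  have [_ /(_ v) E] := near_eq_msm MP En s1.
  have gen (a b e e' s t : 'rV[R]_d) : a = e + s -> b = e' + t -> b = a ->
      e = 0 -> e' = 0 -> t = 0 -> s = 0.
    by move=> -> -> H e0 e'0 t0; move: H; rewrite e0 e'0 t0 !add0r => /esym.
  have genz k (w : 'rV[R]_k) (y : 'rV[R]_d) l : w = 0 -> w 0 l *: y = 0.
    by move=> ->; rewrite mxE scale0r.
  have genZ (a : R) (y : 'rV[R]_d) : y = 0 -> a *: y = 0 by move=> ->; exact: scaler0.
  apply: (gen _ _ _ _ _ _ D1 D2 E); apply: big1 => k _.
  - apply: genz; exact: (gaP j).2.
  - apply: genz; exact: ((msm_cst VP (row j A : rvspace R d) p).2 v).
  - apply: genZ; exact: etrans ((fga k).2 v) (ga'P k _).2.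
have XE : X i p = \sum_j (dchart c p (X i p)) 0 j *: coord_field c j p.
  by rewrite -coord_vec_sum; exact/esym/dchartK.
have dE : delta_mx 0 i = \sum_j (dchart c p (X i p)) 0 j *: (ga j p : 'rV[R]_n).
  have E : frame_coord X ((p, X i p) : TM M) = (delta_mx 0 i : 'rV[R]_n).
    apply: etrans (frame_coord_mul Xu p (delta_mx 0 i)).
    by rewrite -rowE rowK.
  rewrite -[LHS]E /frame_coord /= {1}XE mulmx_suml; apply: eq_bigr => j _.
  by rewrite -scalemxAl.
have -> : dmap (frame_diff X X' f i) p v =
    \sum_i' (delta_mx 0 i : 'rV[R]_n) 0 i' *: dmap (frame_diff X X' f i') p v.
  rewrite (bigD1 i) //= mxE !eqxx scale1r big1 ?addr0 // => k /negbTE ki.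
  by rewrite mxE eqxx ki scale0r.
rewrite dE.
under eq_bigr => i' _.
  rewrite summxE scaler_suml; under eq_bigr => j _ do rewrite mxE -scalerA; over.
rewrite exchange_big /= big1 // => j _.
by rewrite -scaler_sumr dgB scaler0.
Qed.

End AffineMaps.

(** * Extension from a dense set *)

Section Metrics.
Variable R : realType.

Lemma metric0l n (M : mspace R n) (h : M -> 'rV[R]_n -> 'rV[R]_n -> R) p w :
  is_riemannian h -> h p 0 w = 0.
Proof.
by case=> hl _ _ _; have := hl p 1 0 0 w; rewrite scaler0 addr0 mul1r => /esym/eqP;
  rewrite -subr_eq0 addrK => /eqP.
Qed.

Lemma metric_sum n (M : mspace R n) (h : M -> 'rV[R]_n -> 'rV[R]_n -> R) p k
    (a b : 'rV[R]_k) (E : 'I_k -> 'rV[R]_n) : is_riemannian h ->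
  h p (\sum_i a 0 i *: E i) (\sum_i b 0 i *: E i) =
  \sum_i \sum_j a 0 i * b 0 j * h p (E i) (E j).
Proof.
move=> hr; have [hl hC _ _] := hr.
have S (I : Type) (r : seq I) (c : I -> R) (F : I -> 'rV[R]_n) w :
    h p (\sum_(i <- r) c i *: F i) w = \sum_(i <- r) c i * h p (F i) w.
  elim: r => [|i r IH]; first by rewrite !big_nil metric0l.
  by rewrite !big_cons hl IH.
rewrite S; apply: eq_bigr => i _; rewrite hC S mulr_sumr.
by apply: eq_bigr => j _; rewrite mulrA (hC p (E j)).
Qed.

Lemma isometric_injective n d (M : mspace R n) (M' : mspace R d)
    (g : M -> 'rV[R]_n -> 'rV[R]_n -> R) (g' : M' -> 'rV[R]_d -> 'rV[R]_d -> R)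
    (f : M -> M') : is_riemannian g -> is_riemannian g' -> isometric g g' f ->
  forall p, injective (dmap f p).
Proof.
move=> gr gr' fi p u v E; apply/eqP; rewrite -subr_eq0; apply/eqP.
apply: contrapT => /eqP; have [_ _ gp _] := gr; move=> /(gp p).
have H := fi p (u - v) (u - v).
have E0 : dmap f p (u - v) = 0 by apply: etrans (dmapB f p u v) _; rewrite E subrr.
by rewrite -H E0 metric0l ?ltxx.
Qed.

End Metrics.

Section ExtensionByDensity.
Variable R : realType.
Variables (n d : nat) (N : kspace R n) (N' : kspace R d).
Variable S : set N.
Hypothesis S_dense : forall x (A : set N), mnbhs x A -> exists2 y, A y & S y.
Hypotheses (NP : pre_manifold N) (NP' : pre_manifold N').
Variable m : N -> N'.
Hypothesis ms : forall x, msm m x.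

Lemma dense_zero (V : normedModType R) (h : 'rV[R]_(n + n) -> V)
    (c : chart R N (n + n)) x : coord_system c -> cdom c x ->
  {for c x, continuous h} -> mnbhs x (fun q => S q -> h (c q) = 0) -> h (c x) = 0.
Proof.
move=> cc cx hc h0; apply: contrapT => /eqP hx.
have H : \forall y \near c x, h y != 0 by exact: cvgr_neq0 hc hx.
have H' : mnbhs x (fun q => h (c q) != 0).
  apply/(mnbhsP NP _ cc cx); move: (nbhs_setI H (coord_near cc cx)).
  by apply: filterS => y [hy [_ yE]]; rewrite yE.
have [y [y0 hy] Sy] := S_dense (filterI h0 H').
by move: hy; rewrite (y0 Sy) eqxx.
Qed.

(** On coordinate fields of the atlas charts, the difference of the two metrics is
    a smooth, hence continuous function. *)
Lemma isometric_dense : is_riemannian (k_metric N) -> is_riemannian (k_metric N') ->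
  (forall x v w, S x -> k_metric N' (m x) (dmap m x v) (dmap m x w) = k_metric N x v w) ->
  isometric (k_metric N) (k_metric N') m.
Proof.
move=> gr gr' gS x v w.
have [cA cx] := chart_atP NP x; have [c'A c'x] := chart_atP NP' (m x).
set c := chart_at x in cA cx *; set c' := chart_at (m x) in c'A c'x *.
have cc := atlas_coord NP cA; have c'c := atlas_coord NP' c'A.
have [c'n mhs] := (msmP NP NP' cc c'c cx c'x).1 (ms x).
pose mh := c' \o m \o cinv c.
pose G' k l z := let p := cinv c' z in
  k_metric N' p (coord_vec c' (delta_mx 0 k) p) (coord_vec c' (delta_mx 0 l) p).
pose G a b y := let p := cinv c y in k_metric N p (coord_vec c a p) (coord_vec c b p).
pose H a b y : R := \sum_k \sum_l
  ('d mh y a) 0 k * ('d mh y b) 0 l * G' k l (mh y) - G a b y.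
have genS (al be : 'rV[R]_(d + d)) (F F' : 'I_(d + d) -> 'I_(d + d) -> R) :
    (forall k l, F k l = F' k l) ->
    \sum_k \sum_l al 0 k * be 0 l * F k l = \sum_k \sum_l al 0 k * be 0 l * F' k l.
  by move=> E; apply: eq_bigr => k _; apply: eq_bigr => l _; rewrite E.
have HE a b q : cdom c q -> cdom c' (m q) -> H a b (c q) =
    k_metric N' (m q) (dmap m q (coord_vec c a q)) (dmap m q (coord_vec c b q)) -
    k_metric N q (coord_vec c a q) (coord_vec c b q).
  move=> cq c'q; have qE := coordK cc cq; have mqE := coordK c'c c'q.
  have D e : dmap m q (coord_vec c e q) =
      \sum_k ('d mh (c q) e) 0 k *: coord_field c' k (m q).
    apply: etrans (dmap_coord NP NP' _ cc c'c cq c'q (ms q)) _.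
    apply: etrans (coord_vec_sum _ _ _) _.
    have -> : dchart c q (coord_vec c e q) = e by exact: coord_vecK.
    exact: erefl.
  have gen (s t s' t' : R) : s = s' -> t = t' -> s - t = s' - t' by move=> -> ->.
  apply: gen; last by rewrite /G qE.
  have E : cinv c' (mh (c q)) = m q by rewrite /mh /= qE mqE.
  have R1 (al be : 'rV[R]_(d + d)) :
      \sum_k \sum_l al 0 k * be 0 l * G' k l (mh (c q)) =
      k_metric N' (m q) (\sum_k al 0 k *: coord_field c' k (m q))
        (\sum_k be 0 k *: coord_field c' k (m q)).
    apply/esym; apply: etrans (metric_sum _ _ _ _ gr') _.
    pose F k l p := k_metric N' p (coord_field c' k p) (coord_field c' l p).
    apply: (genS al be (fun k l => F k l (m q)) (fun k l => G' k l (mh (c q)))) => k l.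
    exact: (congr1 (F k l) (esym E)).
  exact: etrans (R1 _ _) (esym (congr2 (k_metric N' (m q)) (D a) (D b))).
have Hs a b : smooth_at (H a b) (c x).
  have s1 := (smooth_coord _ _).1 (smooth_deriv a mhs).
  have s2 := (smooth_coord _ _).1 (smooth_deriv b mhs).
  have oc' := c'c.1.2; have oc := cc.1.2.
  have [_ _ _ h1] := gr; have [_ _ _ h2] := gr'.
  have s3 k l : smooth_at (fun y => G' k l (mh y)) (c x).
    have E : c' (m x) = mh (c x) by rewrite /mh /= (coordK cc cx).
    apply: smooth_compR mhs.
    have := (smooth_onP _ oc').1 (h2 c' (delta_mx 0 k) (delta_mx 0 l) c'A) (c' (m x)).
    by rewrite E; apply; exists (m x).
  have s4 : smooth_at (G a b) (c x).
    by apply: ((smooth_onP _ oc).1 (h1 c a b cA) (c x)); exists x.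
  apply: smooth_add.
    apply: smooth_sum => k _; apply: smooth_sum => l _; apply: smooth_mul (s3 k l).
    exact: smooth_mul (s1 k) (s2 l).
  apply: (near_eq_smooth _ (smooth_mul (smooth_cst (c x) (-1 : R)) s4)).
  by apply: near_all => y; exact: mulN1r.
have good : mnbhs x (fun q => cdom c q /\ cdom c' (m q)).
  apply: filterI; first exact: mnbhs_dom.
  exact: (msm_continuous NP NP' (ms x) (mnbhs_dom NP' c'c c'x)).
have H0 a b : H a b (c x) = 0.
  apply: (dense_zero cc cx (smooth_continuous (Hs a b))).
  apply: filterS good => q [cq c'q] Sq; apply: etrans (HE a b q cq c'q) _.
  by rewrite gS // subrr.
have E := HE (dchart c x v) (dchart c x w) x cx c'x.
have vE u : coord_vec c (dchart c x u) x = u by exact: dchartK.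
have gen (v' w' : 'rV[R]_(n + n)) : v' = v -> w' = w ->
    k_metric N' (m x) (dmap m x v') (dmap m x w') - k_metric N x v' w' = 0 ->
    k_metric N' (m x) (dmap m x v) (dmap m x w) = k_metric N x v w.
  by move=> -> -> /eqP; rewrite subr_eq0 => /eqP.
exact: gen (vE v) (vE w) (etrans (esym E) (H0 _ _)).
Qed.

(** In holomorphic coordinates the complex structures are constant, so that
    complex linearity of the derivative is a closed condition. *)
Lemma holomorphic_dense : complex_structure (k_J N) -> complex_structure (k_J N') ->
  (forall x v, S x -> dmap m x (k_J N x v) = k_J N' (m x) (dmap m x v)) ->
  holomorphic m.
Proof.
move=> Jc Jc' JS; split=> [|x v]; first by apply/(smooth_mapP NP NP').
have [c [cc cx cJ]] := Jc x; have [c' [c'c c'x cJ']] := Jc' (m x).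
pose mh := c' \o m \o cinv c.
have [c'n mhs] := (msmP NP NP' cc c'c cx c'x).1 (ms x).
pose h a y : 'rV[R]_(d + d) := 'd mh y (Jstd a) - Jstd ('d mh y a).
have dE q u : cdom c q -> cdom c' (m q) ->
    'd mh (c q) (dchart c q u) = dchart c' (m q) (dmap m q u).
  by move=> cq c'q; exact: (dmapE NP NP' u cc c'c cq c'q (ms q)).
have Jl k : linear (@Jstd R k).
  move=> a u w; rewrite /Jstd !linearP /= scale_row_mx add_row_mx.
  by congr row_mx; rewrite opprD scalerN.
have hs a : smooth_at (h a) (c x).
  apply: smooth_add; first exact: smooth_deriv.
  have Ln : linear (fun z : 'rV[R]_(d + d) => - Jstd z).
    by move=> k u w; rewrite Jl opprD scalerN.
  exact: (smooth_comp (g := fun z => - Jstd z) (f := fun y => 'd mh y a)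
    (smooth_linfun _ Ln) (smooth_deriv a mhs)).
have good : mnbhs x (fun q => cdom c q /\ cdom c' (m q)).
  apply: filterI; first exact: mnbhs_dom.
  exact: (msm_continuous NP NP' (ms x) (mnbhs_dom NP' c'c c'x)).
have gen (s t : 'rV[R]_(d + d)) : s = t <-> s - t = 0.
  by split=> [->|/eqP]; [exact: subrr|rewrite subr_eq0 => /eqP].
have h0 a : h a (c x) = 0.
  apply: (dense_zero cc cx (smooth_continuous (hs a))).
  apply: filterS good => q [cq c'q] Sq; apply: (gen _ _).1.
  pose u := coord_vec c a q; have uE : dchart c q u = a by exact: coord_vecK.
  have E1 : 'd mh (c q) a = dchart c' (m q) (dmap m q u).
    by apply: etrans (dE q u cq c'q); congr ('d _ _ _); exact: esym.
  have E2 : 'd mh (c q) (Jstd a) = dchart c' (m q) (dmap m q (k_J N q u)).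
    by apply: etrans (dE q (k_J N q u) cq c'q); congr ('d _ _ _); rewrite cJ // uE.
  apply: etrans E2 _; apply: etrans _ (congr1 (@Jstd R d) (esym E1)).
  apply: etrans (congr1 (dchart c' (m q)) (JS q u Sq)) _; exact: cJ'.
have inj (s t : 'rV[R]_(d + d)) : dchart c' (m x) s = dchart c' (m x) t -> s = t.
  move=> E; have Es := dchartK NP' s c'c c'x; have Et := dchartK NP' t c'c c'x.
  by rewrite -Es -Et E.
apply: inj; apply: etrans (esym (dE x _ cx c'x)) _.
apply: etrans _ (esym (cJ' _ _ c'x)).
apply: etrans _ (congr1 (@Jstd R d) (dE x v cx c'x)).
apply: etrans (congr1 ('d mh (c x)) (cJ x v cx)) _.
by apply/(gen _ _); exact: h0.
Qed.

End ExtensionByDensity.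

(** * Homomorphisms of tori *)

Section LocallyConstant.
Variable R : realType.

(** The function is constant on balls of a chart, so its level sets are open, and
    so are their complements. *)
Lemma dmap0_const n k (M : mspace R n) (b : M -> rvspace R k) :
  pre_manifold M -> connected_mspace M -> (forall p, msm b p) ->
  (forall p v, dmap b p v = 0) -> forall p q, b p = b q.
Proof.
move=> MP [_ Mc] bs db p q.
have loc x : mnbhs x (fun y => b y = b x).
  have [cA cx] := chart_atP MP x; set c := chart_at x in cA cx.
  have cc := atlas_coord MP cA; have KP := rvspace_pre R k.
  have xo : nbhs (c x) (crange c) by apply: open_nbhs_nbhs; split; [exact: cc.1.2|exists x].
  have [r /= r0 rc] : nbhs_ball (c x) (crange c) by apply/nbhs_ballP.
  have E y : ball (c x) r y -> b (cinv c y) = b (cinv c (c x)).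
    move=> By; apply: (@diff0_const _ _ _ ((b : M -> 'rV[R]_k) \o cinv c) (c x) r) => //.
      move=> z /rc [q' cq' <-].
      have [_ s] := (msmP MP KP (c' := std_chart R k) cc (std_coord R k) cq' I).1 (bs q').
      split=> [|v]; first exact: smooth_diff s.
      have vE := coord_vecK MP v cc cq'.
      have E := dmap_rv_coord MP (coord_vec c v q') cc cq' (bs q').
      apply: etrans (etrans E (db q' _)); congr ('d _ _ _); exact: esym.
    exact: ballxx.
  apply/(mnbhsP MP _ cc cx).
  have Bn : nbhs (c x) (ball (c x) r) by exact: nbhsx_ballx.
  by apply: filterS Bn => y /E ->; rewrite (coordK cc cx).
pose U := [set x | b x = b p].
have Uo : mopen U by apply/(mopenP MP) => x Ux; apply: filterS (loc x) => y; rewrite /U /= => ->.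
have UCo : mopen (~` U).
  by apply/(mopenP MP) => x Ux; apply: filterS (loc x) => y; rewrite /U /= => ->.
have [U0|UT] := Mc U Uo UCo.
  by have : U p by []; rewrite U0.
by have : U q by rewrite UT.
Qed.

End LocallyConstant.

Section TorusHomomorphisms.
Variable R : realType.
Variables (n d : nat) (A : 'M[R]_(n, d)).
Hypothesis AZ : forall k : 'rV[R]_n, k \in @int_lattice R n ->
  k *m A \in @int_lattice R d.

(** The choice of a representative is harmless: by [torus_homE] the map is the
    quotient of [t |-> t *m A]. *)
Definition torus_hom (a : torus R n) : torus R d := torus_pi (repr a *m A).

Lemma torus_homE t : torus_hom (torus_pi t) = torus_pi (t *m A).
Proof.
apply/torus_pi_eq; rewrite -mulmxBl; apply: AZ.
by rewrite -opprB rpredN; exact: torus_repr.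
Qed.

Lemma torus_hom_lie : lie_group_hom torus_hom.
Proof.
split=> [a b|].
  have [s <-] := torus_pi_surj a; have [t <-] := torus_pi_surj b.
  by rewrite -torus_piD !torus_homE mulmxDl torus_piD.
apply/(smooth_mapP (torus_pre R n) (torus_pre R d)) => a.
have [t <-] := torus_pi_surj a.
have VP := rvspace_pre R n; have VP' := rvspace_pre R d.
apply: (quotient_descend VP (@torus_deck R n) (@torus_linj R n) (@torus_pi_surj R n)
  (torus_pre R d)).
have lin_msm : msm (fun s : rvspace R n => (s : 'rV[R]_n) *m A : rvspace R d) t.
  apply/msm_rv; rewrite rv_chart_at; apply: smooth_linfun => k u v.
  by rewrite /= mulmxDl scalemxAl.
have pi_msm := (quotient_msm VP' (@torus_deck R d) (@torus_linj R d) (@torus_pi_surj R d)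
  ((t : 'rV[R]_n) *m A : rvspace R d)).1.
have [s _] := msm_comp VP VP' lin_msm pi_msm.
apply: (near_eq_msm VP _ s).1.
by apply/rv_mnbhs; exact: (@near_all 'rV[R]_n t _ (fun u => esym (torus_homE u))).
Qed.

Hypothesis A_inj : forall v : 'rV[R]_n, v *m A = 0 -> v = 0.

(** If [t *m A] is integral, so is [t *m S] for the Gram matrix [S = A *m A^T],
    which is integral and invertible; multiplication by the adjugate shows that
    [\det S] times [t] is integral. Hence the kernel consists of classes of
    vectors with coordinates in [1/N Z], for [N] the absolute value of the
    determinant, and there are at most [N ^ n] of them. *)
Lemma torus_hom_kernel : finite_set [set a | torus_hom a = 0].
Proof.
pose S := A *m A^T.
have Su : S \in unitmx.
  rewrite -row_free_unit -kermx_eq0; apply/eqP/row_matrixP => i; rewrite row0.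
  set v := row i _; have vS : v *m S = 0 by apply/sub_kermxP; exact: row_sub.
  apply: A_inj; set w := v *m A.
  have : \sum_j w 0 j * w 0 j = 0.
    have -> : \sum_j w 0 j * w 0 j = (w *m w^T) 0 0.
      by rewrite [RHS]mxE; apply: eq_bigr => j _; rewrite [w^T _ _]mxE.
    by rewrite trmx_mul mulmxA -(mulmxA v) vS mul0mx mxE.
  move=> /eqP; rewrite psumr_eq0 => [|j _]; last by rewrite -expr2 sqr_ge0.
  move=> /allP w0; apply/rowP => j; rewrite [RHS]mxE.
  by have := w0 j (mem_index_enum _); rewrite /= mulf_eq0 orbb => /eqP.
have AZij i j : A i j \is a Num.int.
  have : row i A \in @int_lattice R d.
    rewrite rowE; apply: AZ; apply: int_latticeP => k; rewrite mxE.
    by case: (_ && _); rewrite ?rpred0 ?rpred1.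
  by move/(int_lattice_coord j); rewrite mxE.
have SZ i j : S i j \is a Num.int.
  by rewrite mxE; apply: rpred_sum => k _; rewrite mxE rpredM.
have DZ : \det S \is a Num.int.
  by apply: rpred_sum => s _; rewrite rpredMsign; apply: rpred_prod.
have adjZ i j : (\adj S) i j \is a Num.int.
  rewrite mxE /cofactor rpredMsign; apply: rpred_sum => s _; rewrite rpredMsign.
  by apply: rpred_prod => k _; rewrite 2!mxE; exact: SZ.
have /intrP [D DE] := DZ.
have D0 : D != 0 by apply: contraTneq Su => D0; rewrite unitmxE DE D0 unitr0.
pose N := `|D|%N; have N0 : (0 < N)%N by rewrite absz_gt0.
have NZ : (N%:R : R) != 0 by rewrite pnatr_eq0 -lt0n.
pose g (x : {ffun 'I_n -> 'I_N}) : torus R n := torus_pi (\row_j ((x j)%:R / N%:R)).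
apply: (@sub_finite_set _ _ (g @` setT)); last first.
  by apply: finite_image; exact: finite_finset.
move=> a; have [t <-] := torus_pi_surj a => /=; rewrite torus_homE => tA0.
have tAZ : t *m A \in @int_lattice R d.
  have : torus_pi (t *m A) = torus_pi 0 by rewrite tA0 torus_pi0.
  by move/torus_pi_eq; rewrite subr0.
have Dt j : D%:~R * t 0 j \is a Num.int.
  have -> : D%:~R * t 0 j = (t *m S *m \adj S) 0 j.
    by rewrite -mulmxA mul_mx_adj DE mul_mx_scalar mxE.
  rewrite mxE; apply: rpred_sum => k _; rewrite rpredM //.
  rewrite /S mulmxA mxE; apply: rpred_sum => l _; rewrite rpredM ?[A^T _ _]mxE //.
  exact: int_lattice_coord.
have Nt j : exists z : int, N%:R * t 0 j = z%:~R.
  have /intrP [z zE] := Dt j.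
  have [N_D|N_D] : (N%:Z = D) \/ (N%:Z = - D) by rewrite /N; lia.
    by exists z; rewrite -zE -N_D.
  by exists (- z); rewrite mulrNz -zE -mulNr -mulrNz -N_D.
have [z zE] := fin_all_exists Nt.
have zm j : (`|(z j %% N)%Z|%N < N)%N by lia.
exists [ffun j => Ordinal (zm j)] => //; rewrite /g; apply/torus_pi_eq.
apply: int_latticeP => j; rewrite !mxE ffunE /=.
have -> : `|(z j %% N)%Z|%N%:R = ((z j %% N)%Z)%:~R :> R.
  by rewrite natr_absz ger0_norm // modz_ge0 // eqz_nat -lt0n.
have E : (z j)%:~R = ((z j %/ N)%Z)%:~R * N%:R + ((z j %% N)%Z)%:~R :> R.
  by rewrite {1}(divz_eq (z j) N) intrD intrM.
have -> : ((z j %% N)%Z)%:~R / N%:R - t 0 j = - ((z j %/ N)%Z)%:~R :> R.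
  apply: (mulIf NZ); rewrite mulrBl mulfVK // [t 0 j * _]mulrC zE E.
  by rewrite opprD addrCA subrr addr0 mulNr.
by rewrite rpredN; apply/intrP; eexists.
Qed.

End TorusHomomorphisms.

(** * The lifted map *)

Section LiftedMap.
Variable R : realType.
Variables (n d : nat) (M : dfspace R n) (M' : dfspace R d)
  (N : kspace R n) (N' : kspace R d)
  (Phi : torus R n -> N -> N) (Phi' : torus R d -> N' -> N')
  (m : N -> N') (f : M -> M').
Hypotheses (M_flat : dually_flat M) (M_conn : connected_mspace M).
Hypothesis M'_flat : dually_flat M'.
Hypotheses (N_tor : torification M Phi) (N'_tor : torification M' Phi').
Hypotheses (ms : smooth_map m) (fs : smooth_map f).
Variables (X : 'I_n -> M -> 'rV[R]_n) (X' : 'I_d -> M' -> 'rV[R]_d).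
Hypotheses (XF : frame_of X) (XF' : frame_of X').
Variables (tau : TM M -> N) (tau' : TM M' -> N').
Hypotheses (tauC : kahler_covering X Phi tau) (tauC' : kahler_covering X' Phi' tau').
Hypothesis mtau : forall u, m (tau u) = tau' (tmap f u).

Let MP : pre_manifold M. Proof. by case: M_flat => /manifold_pre. Qed.
Let MP' : pre_manifold M'. Proof. by case: M'_flat => /manifold_pre. Qed.
Let NM : is_manifold N. Proof. by case: N_tor => -[[]]. Qed.
Let NM' : is_manifold N'. Proof. by case: N'_tor => -[[]]. Qed.
Let NP := manifold_pre NM.
Let NP' := manifold_pre NM'.
Let Dc : is_connection (df_conn M). Proof. by case: M_flat. Qed.
Let Dc' : is_connection (df_conn M'). Proof. by case: M'_flat. Qed.
Let Dt : torsion_free (df_conn M). Proof. by case: M_flat => _ _ _ []. Qed.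
Let Dt' : torsion_free (df_conn M'). Proof. by case: M'_flat => _ _ _ []. Qed.
Let hr : is_riemannian (df_metric M). Proof. by case: M_flat. Qed.
Let hr' : is_riemannian (df_metric M'). Proof. by case: M'_flat. Qed.
Let gr : is_riemannian (k_metric N). Proof. by case: N_tor => -[[]]. Qed.
Let gr' : is_riemannian (k_metric N'). Proof. by case: N'_tor => -[[]]. Qed.
Let fsm p : msm f p. Proof. exact: (smooth_mapP MP MP' f).1. Qed.
Let msmm x : msm m x. Proof. exact: (smooth_mapP NP NP' m).1. Qed.

Lemma free_dense x (A : set N) : mnbhs x A -> exists2 y, A y & free_points Phi y.
Proof.
have [[_ Nconn] act eff hol _] := N_tor.
apply: (free_points_dense NM Nconn act eff) => a y.
by have [[/(smooth_mapP NP NP) h _] _] := hol a; exact: h.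
Qed.

(** Since [tau] and [tau'] have bijective derivatives, this determines the derivative
    of [m] at the free points from that of [tmap f], and conversely. *)
Lemma dmap_lift u A :
  dmap m (tau u) (dmap tau u A) = dmap tau' (tmap f u) (dmap (tmap f) u A).
Proof.
have TP := TM_pre MP; have TP' := TM_pre MP'.
have [s1 E1] := msm_comp TP NP (cov_msm tauC u) (msmm (tau u)).
have [s2 E2] := msm_comp TP TP' (tmap_msm MP MP' u fsm) (cov_msm tauC' (tmap f u)).
apply: etrans (esym (E1 A)) (etrans _ (E2 A)).
exact: dmap_eq.
Qed.

Lemma kahler_immersion_of_tmap :
  (forall u A, dmap (tmap f) u (TM_J u A) = TM_J (tmap f u) (dmap (tmap f) u A)) ->
  (forall u A B, TM_metric (tmap f u) (dmap (tmap f) u A) (dmap (tmap f) u B)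
    = TM_metric u A B) -> kahler_immersion m.
Proof.
move=> fJ fg.
have iso : isometric (k_metric N) (k_metric N') m.
  apply: (isometric_dense free_dense NP NP' msmm gr gr') => x v w.
  move=> /(cov_surj tauC) [u <-].
  have [A <-] := cov_onto tauC u v; have [B <-] := cov_onto tauC u w.
  apply: etrans (congr2 (k_metric N' (m (tau u))) (dmap_lift u A) (dmap_lift u B)) _.
  rewrite mtau; apply: etrans (cov_metric tauC' _ _ _) _.
  apply: etrans (fg u A B) _; exact/esym/(cov_metric tauC).
split=> //.
  by split=> // x; exact: (isometric_injective gr gr' iso).
apply: (holomorphic_dense free_dense NP NP' msmm).
- by case: N_tor => -[[]].
- by case: N'_tor => -[[]].
move=> x v /(cov_surj tauC) [u <-]; have [A <-] := cov_onto tauC u v.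
apply: etrans (congr1 (dmap m (tau u)) (cov_J tauC u A)) _.
apply: etrans (dmap_lift u _) _.
apply: etrans (congr1 (dmap tau' (tmap f u)) (fJ u A)) _.
apply: etrans (esym (cov_J tauC' _ _)) _; rewrite -mtau.
by congr (k_J N' _ _); exact/esym/dmap_lift.
Qed.

Lemma tmap_of_kahler_immersion : kahler_immersion m ->
  (forall u A, dmap (tmap f) u (TM_J u A) = TM_J (tmap f u) (dmap (tmap f) u A)) /\
  (forall u A B, TM_metric (tmap f u) (dmap (tmap f) u A) (dmap (tmap f) u B)
    = TM_metric u A B).
Proof.
move=> [_ [_ mJ] mg]; split=> [u A|u A B].
  have inj (s t : 'rV[R]_(d + d)) :
      dmap tau' (tmap f u) s = dmap tau' (tmap f u) t -> s = t.
    move=> E; apply/eqP; rewrite -subr_eq0; apply/eqP; apply: (cov_inj tauC' (u := tmap f u)).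
    by apply: etrans (dmapB _ _ _ _) _; rewrite E subrr.
  apply: inj; apply: etrans (esym (dmap_lift u _)) _.
  apply: etrans (congr1 (dmap m (tau u)) (esym (cov_J tauC u A))) _.
  apply: etrans (mJ _ _) _; rewrite mtau.
  apply: etrans (congr1 (k_J N' (tau' (tmap f u))) (dmap_lift u A)) _.
  exact: (cov_J tauC').
apply: etrans (esym (cov_metric tauC' _ _ _)) _; apply: etrans _ (cov_metric tauC u A B).
apply: etrans _ (mg (tau u) _ _); rewrite mtau.
exact: congr2 (esym (dmap_lift u A)) (esym (dmap_lift u B)).
Qed.

Lemma kahler_immersion_iff : kahler_immersion m <-> isometric_affine_immersion f.
Proof.
split=> [/tmap_of_kahler_immersion [fJ fg]|[_ fi fa]].
  have fi := isometric_of_tmap MP MP' Dc Dc' XF XF' fsm hr hr' fg.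
  have dB := (tmap_holomorphic MP MP' Dc Dc' XF XF' fsm).1 fJ.
  split=> //; first by split=> // p; exact: (isometric_injective hr hr' fi).
  exact: (affine_of_frame_diff0 MP MP' Dc Dc' Dt Dt' XF XF' fsm).
have dB := frame_diff0_of_affine MP MP' Dc Dc' XF XF' fsm fa.
apply: kahler_immersion_of_tmap.
  exact: ((tmap_holomorphic MP MP' Dc Dc' XF XF' fsm).2 dB).
exact: (tmap_isometric MP MP' Dc Dc' XF XF' fsm dB fi).
Qed.

Section Equivariance.
Hypothesis fa : affine_map f.
Hypothesis finj : forall p, injective (dmap f p).

Let dB := frame_diff0_of_affine MP MP' Dc Dc' XF XF' fsm fa.

Let some_point : exists p : M, True. Proof. by case: M_conn. Qed.
Let p0 : M := projT1 (cid some_point).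
(** The matrix of [df] at one point; by connectedness it is the matrix at every
    point. *)
Let A : 'M[R]_(n, d) := \matrix_i (frame_diff X X' f i p0 : 'rV[R]_d).

Let AE i p : frame_diff X X' f i p = row i A.
Proof.
by rewrite rowK; apply: (dmap0_const MP M_conn (frame_diff_msm MP MP' XF XF' fsm i)); exact: dB.
Qed.

Let row_comb (a : 'rV[R]_n) p :
  \sum_i a 0 i *: (frame_diff X X' f i p : 'rV[R]_d) = a *m A.
Proof.
rewrite [in RHS](rV_sum_delta a) mulmx_suml; apply: eq_bigr => i _.
by rewrite AE -scalemxAl -rowE.
Qed.

Let tmap_translation t u : tmap f (translation X t u) = translation X' (t *m A) (tmap f u).
Proof.
rewrite !translationE /tmap /=; congr (_, _); apply: etrans (dmapD _ _ _ _) _.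
congr (_ + _); apply: etrans (dmap_frame X XF' f u.1 t) _.
by congr (_ *m _); exact: row_comb.
Qed.

Let m_equiv t u : m (Phi (torus_pi t) (tau u)) = Phi' (torus_pi (t *m A)) (m (tau u)).
Proof. by rewrite -(cov_equiv tauC) mtau tmap_translation (cov_equiv tauC') -mtau. Qed.

(** The translation by an integral vector does not move [tau u], hence its image
    does not move the free point [m (tau u)]. *)
Let A_integral k : k \in @int_lattice R n -> k *m A \in @int_lattice R d.
Proof.
move=> kZ; pose u : TM M := (p0, 0).
have k0 : torus_pi k = 0.
  by rewrite -torus_pi0; apply/torus_pi_eq; rewrite subr0.
have [[_ _] [Phi0 _ _] _ _ _] := N_tor.
have E := m_equiv k u; rewrite k0 Phi0 in E.
have free : free_points Phi' (m (tau u)) by rewrite mtau; exact: (cov_free tauC').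
by move/free: (esym E) => /esym; rewrite -torus_pi0 => /esym/torus_pi_eq; rewrite subr0.
Qed.

Let A_inj (v : 'rV[R]_n) : v *m A = 0 -> v = 0.
Proof.
move=> vA; have := dmap_frame X XF' f p0 v; rewrite row_comb vA mul0mx => E.
have E0 : v *m frame_mx X p0 = 0 by apply: (@finj p0); apply: etrans E _; exact/esym/dmap0.
by apply: (can_inj (mulmxK (frame_unit XF p0))); rewrite mul0mx.
Qed.

Lemma equivariant_hom : exists! rho : torus R n -> torus R d,
  [/\ lie_group_hom rho, finite_set [set a | rho a = 0] &
      forall a x, m (Phi a x) = Phi' (rho a) (m x)].
Proof.
have [_ [Phi0' PhiD' _] _ hol' _] := N'_tor.
have [_ _ _ hol _] := N_tor.
have equiv a x : m (Phi a x) = Phi' (torus_hom A a) (m x).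
  have [t <-] := torus_pi_surj a; rewrite (torus_homE A_integral).
  have Ps y : msm (Phi (torus_pi t)) y.
    by have [[/(smooth_mapP NP NP) h _] _] := hol (torus_pi t); exact: h.
  have Ps' y : msm (Phi' (torus_pi (t *m A))) y.
    by have [[/(smooth_mapP NP' NP') h _] _] := hol' (torus_pi (t *m A)); exact: h.
  apply: contrapT => ne.
  have [s1 _] := msm_comp NP NP (Ps x) (msmm _).
  have [s2 _] := msm_comp NP NP' (msmm x) (Ps' _).
  have NH' : hausdorff_mspace N' by case: NM'.
  have [y ney /(cov_surj tauC) [u uy]] := free_dense (eq_closed NP NP' NH' s1 s2 ne).
  by apply: ney; rewrite /= -uy; exact: m_equiv.
exists (torus_hom A); split.
  split=> //; first exact: (torus_hom_lie A_integral).
  exact: (torus_hom_kernel A_integral A_inj).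
move=> rho [_ _ equiv']; apply/funext => a.
pose u : TM M := (p0, 0).
have E : Phi' (rho a) (m (tau u)) = Phi' (torus_hom A a) (m (tau u)).
  by rewrite -equiv -equiv'.
have free : free_points Phi' (m (tau u)) by rewrite mtau; exact: (cov_free tauC').
have : - rho a + torus_hom A a = 0 by apply: free; rewrite PhiD' -E -PhiD' addNr Phi0'.
by move=> /eqP; rewrite addrC subr_eq0 => /eqP.
Qed.

End Equivariance.
End LiftedMap.

Theorem proposition9p3 (R : realType) (n d : nat)
    (M : dfspace R n) (M' : dfspace R d)
    (N : kspace R n) (N' : kspace R d)
    (Phi : torus R n -> N -> N) (Phi' : torus R d -> N' -> N')
    (m : N -> N') (f : M -> M')
    (M_flat : dually_flat M) (M_conn : connected_mspace M)
    (M'_flat : dually_flat M') (M'_conn : connected_mspace M')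
    (N_tor : torification M Phi) (N'_tor : torification M' Phi')
    (m_smooth : smooth_map m) (f_smooth : smooth_map f)
    (m_lift : is_lift Phi Phi' m f) :
  (kahler_immersion m <-> isometric_affine_immersion f) /\
  (isometric_affine_immersion f ->
     exists! rho : torus R n -> torus R d,
       [/\ lie_group_hom rho,
           finite_set [set a | rho a = 0] &
           forall a x, m (Phi a x) = Phi' (rho a) (m x)]).
Proof.
have [tau [tau' [cov_tau cov_tau' mtau]]] := m_lift.
have NM : is_manifold N by case: N_tor => -[[]].
have NM' : is_manifold N' by case: N'_tor => -[[]].
have [X XF tauC] := compatible_covering_kahler M_flat NM cov_tau.
have [X' XF' tauC'] := compatible_covering_kahler M'_flat NM' cov_tau'.
have lift u : m (tau u) = tau' (tmap f u) by exact: (congr1 (fun g => g u) mtau).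
split.
  exact: (kahler_immersion_iff M_flat M'_flat N_tor N'_tor m_smooth f_smooth XF XF'
    tauC tauC' lift).
move=> [[_ finj] _ fa].
exact: (equivariant_hom M_flat M_conn M'_flat N_tor N'_tor m_smooth f_smooth XF XF'
  tauC tauC' lift fa finj).
Qed.
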